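(* Let $\rho_1,\dots,\rho_{m_a}$ be substitution rules in $\mathbb{R}^d$ with a common alphabet $\mathcal{A}=\{T_1,\dots,T_{n_a}\}$, with expansion maps $\phi_1,\dots,\phi_{m_a}$ (possibly different) and Fourier matrices $B^{(1)},\dots,B^{(m_a)}$, and assume that the family $\{\rho_1,\dots,\rho_{m_a}\}$ has finite local complexity. Let $(i_j)_{j\ge 1}\in\{1,\dots,m_a\}^{\mathbb{N}}$ be a directive sequence and let $\mathcal{T}^{(1)}$ be an S-adic tiling belonging to $(i_j)_j$, with de-substituted tilings $\mathcal{T}^{(k)}$, $k\ge 1$. Assume that for each $k$ all patch frequencies of $\mathcal{T}^{(k)}$ converge. Suppose there is $\varepsilon>0$ such that for Lebesgue-a.e. $t\in\mathbb{R}^d$ $$\liminf_{k\to\infty}\Bigl(\frac{1}{2k}\log\bigl(|\det\phi_{i_1}|\cdots|\det\phi_{i_k}|\bigr)-\frac1k\log\bigl\|B^{(i_1)}(t)\,B^{(i_2)}(\phi_{i_1}^*(t))\cdots B^{(i_k)}(\phi_{i_{k-1}}^*\circ\phi_{i_{k-2}}^*\circ\cdots\circ\phi_{i_1}^*(t))\bigr\|\Bigr)>\varepsilon ,$$ where ${}^*$ denotes the adjoint. Then the diffraction spectrum of $\mathcal{T}^{(1)}$ has zero absolutely continuous part; that is, for every choice of weights $w_1,\dots,w_{n_a}\in\mathbb{C}$, the absolutely continuous part (with respect to Lebesgue measure) of the diffraction measure of $\mathcal{T}^{(1)}$ is zero.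
   Context: $\mu_{\mathrm L}$ is Lebesgue measure on $\mathbb{R}^d$; $B_R$ is the closed ball of radius $R$ about $0$; $\|\cdot\|$ on matrices is the operator norm. Tiles and patches. A tile is either a nonempty compact set $T\subset\mathbb{R}^d$ with $T=\overline{T^\circ}$ (then $\operatorname{supp}T=T$), or a pair $T=(S,\ell)$ of such a compact set $S=\operatorname{supp}T$ and a label $\ell$ from a finite set; translation is $T+x$, resp. $(S+x,\ell)$. A patch is a set of tiles whose supports have pairwise disjoint interiors; its support is the union of the supports of its tiles; it is a tiling if its support is $\mathbb{R}^d$. $\mathcal{P}+x=\{T+x: T\in\mathcal{P}\}$. Substitution rules. Let $\mathcal{A}=\{T_1,\dots,T_{n_a}\}$ be a finite set of tiles, no two of which are translates of each other, and let $\mathcal{A}^*$ be the set of patches all of whose tiles are translates of elements of $\mathcal{A}$. A substitution rule with alphabet $\mathcal{A}$ consists of a linear map $\phi:\mathbb{R}^d\to\mathbb{R}^d$ with $\min_{\|v\|=1}\|\phi(v)\|>1$ (expansion map) and a map $\rho:\mathcal{A}\to\mathcal{A}^*$ with $\operatorname{supp}\rho(T)=\phi(\operatorname{supp}T)$ for $T\in\mathcal{A}$. It extends to $\rho:\mathcal{A}^*\to\mathcal{A}^*$ by $\rho(T+x)=\rho(T)+\phi(x)$, $\rho(\mathcal{P})=\bigcup_{T\in\mathcal{P}}\rho(T)$. The digit sets $T_{i,j}\subset\mathbb{R}^d$ are determined by $\rho(T_j)=\{T_i+x: 1\le i\le n_a,\ x\in T_{i,j}\}$. The Fourier matrix of $\rho$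 is the $n_a\times n_a$ matrix function $B(t)$, $t\in\mathbb{R}^d$, with entries $B_{i,j}(t)=\sum_{s\in T_{i,j}}e^{2\pi \mathrm{i}\langle s,t\rangle}$. Finite local complexity. For a patch $\mathcal{P}$ and $S\subset\mathbb{R}^d$ put $\mathcal{P}\sqcap S=\{T\in\mathcal{P}:\operatorname{supp}T\cap S\ne\emptyset\}$. The family $\{\rho_1,\dots,\rho_{m_a}\}$ has finite local complexity (FLC) if for each compact $K\subset\mathbb{R}^d$ the set $\{\rho_{j_1}\circ\cdots\circ\rho_{j_n}(P)\sqcap(K+x): P\in\mathcal{A},\,n>0,\,j_1,\dots,j_n\in\{1,\dots,m_a\},\,x\in\mathbb{R}^d\}$ is finite up to translation. S-adic tilings. Convergence of patches is in the local matching topology: two patches $\mathcal{P},\mathcal{Q}$ are close if there are small $x,y\in\mathbb{R}^d$ such that $\mathcal{P}+x$ and $\mathcal{Q}+y$ agree inside $B_R$ for some large $R$. Given $(i_j)_j$, an S-adic tiling belonging to $(i_j)_j$ is a tiling of the form $\lim_{l\to\infty}\rho_{i_1}\circ\cdots\circ\rho_{i_{n_l}}(\mathcal{P}_l)$ with $n_1<n_2<\cdots$ and each $\mathcal{P}_l$ a patch included in a translate of some $\rho_{j_1}\circ\cdots\circ\rho_{j_m}(P)$ ($m>0$, $P\in\mathcal{A}$). By FLC, after passing to a subsequence of $(n_l,\mathcal{P}_l)_l$ the limits $\mathcal{T}^{(k)}=\lim_{l\to\infty}\rho_{i_k}\circ\rho_{i_{k+1}}\circ\cdots\circ\rho_{i_{n_l}}(\mathcal{P}_l)$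 exist for all $k\ge1$ simultaneously; such $(n_l,\mathcal P_l)_l$ is fixed, and these $\mathcal{T}^{(k)}$ are the de-substituted tilings; $\rho_{i_k}(\mathcal{T}^{(k+1)})=\mathcal{T}^{(k)}$. Patch frequencies. The patch frequencies of $\mathcal{T}$ converge if for every nonempty finite patch $\mathcal{P}$ the limit $\lim_{R\to\infty}\mu_{\mathrm L}(B_R)^{-1}\,\#\{t\in B_R:\mathcal{P}+t\subset\mathcal{T}\}$ exists. Diffraction. For weights $w_1,\dots,w_{n_a}\in\mathbb{C}$ let $\mu_{\mathcal{T}}=\sum_i w_i\sum_{t\in D_i}\delta_t$ with $D_i=\{t\in\mathbb{R}^d:T_i+t\in\mathcal{T}\}$. For a Radon (complex) measure $\mu$, $\tilde\mu$ is given by $\langle\tilde\mu,\varphi\rangle=\overline{\langle\mu,\tilde\varphi\rangle}$, $\tilde\varphi(t)=\overline{\varphi(-t)}$. The autocorrelation of $\mathcal{T}$ is the vague limit as $R\to\infty$ of $\mu_{\mathrm L}(B_R)^{-1}\,\mu|_{B_R}*\widetilde{\mu|_{B_R}}$ with $\mu=\mu_{\mathcal{T}}$; it is positive definite, and its Fourier transform (a positive measure) is the diffraction measure of $\mathcal{T}$. Here the Fourier transform of a Radon measure $\gamma$ is the unique Radon measure $\hat\gamma$ (if it exists) such that for all $\varphi,\psi\in C_c(\mathbb{R}^d)$ the inverse Fourier transform $(\varphi*\psi)^{\vee}$ lies in $L^1(\hat\gamma)$ and $\langle\varphi*\psi,\gamma\rangle=\langle(\varphi*\psi)^{\vee},\hat\gamma\rangle$.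 The absolutely continuous part is taken in the Lebesgue decomposition with respect to $\mu_{\mathrm L}$. *)

(* Defs.v *)
From HB Require Import structures.
From mathcomp Require Import all_boot all_order all_algebra.
From mathcomp Require Import all_classical all_reals all_analysis.
From mathcomp Require Import finmap complex.

Set Implicit Arguments.
Unset Strict Implicit.
Unset Printing Implicit Defensive.
Import Order.TTheory GRing.Theory Num.Theory.
Import numFieldNormedType.Exports.
Local Open Scope classical_set_scope.
Local Open Scope ring_scope.

(** Lebesgue measure on the Borel sets of R^d: the pushforward of the iterated
    product measure on tuples; [lebesgue_Rd_box] pins down its values. *)
Section Lebesgue.
Variable R : realType.
Local Notation M := (measurableTypeR R).

Definition tcons n (p : M * n.-tuple M) : n.+1.-tuple M :=
  [tuple of p.1 :: p.2].

Lemma measurable_tcons n : measurable_fun setT (@tcons n).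
Proof. exact: measurable_cons. Qed.

Section step.
Variables (n : nat) (m : {sigma_finite_measure set (n.-tuple M) -> \bar R}).
Local Notation leb1 :=
  (@lebesgue_measure R : {sigma_finite_measure set M -> \bar R}).
Local Notation mu := (leb1 \x m)%E.

Definition lebesgue_step : set (n.+1.-tuple M) -> \bar R :=
  pushforward mu (@tcons n).

Let step0 : lebesgue_step set0 = 0%E.
Proof. by rewrite /lebesgue_step /pushforward preimage_set0 measure0. Qed.

Let step_ge0 A : (0 <= lebesgue_step A)%E.
Proof. by rewrite /lebesgue_step /pushforward measure_ge0. Qed.

Let step_sigma_additive : semi_sigma_additive lebesgue_step.
Proof.
move=> F mF tF mUF; rewrite /lebesgue_step /pushforward preimage_bigcup.
have mT A : measurable A -> measurable (@tcons n @^-1` A).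
  by move=> mA; rewrite -[X in measurable X]setTI; exact: measurable_tcons.
apply: measure_semi_sigma_additive => //.
- by move=> i; exact: mT.
- apply/trivIsetP => /= i j _ _ ij; rewrite -preimage_setI.
  by move/trivIsetP : tF => /(_ _ _ _ _ ij) ->//; rewrite preimage_set0.
- by rewrite -preimage_bigcup; exact: mT.
Qed.

HB.instance Definition _ := isMeasure.Build _ _ _ lebesgue_step
  step0 step_ge0 step_sigma_additive.

Let step_sigma_finite : sigma_finite setT lebesgue_step.
Proof.
have /sigma_finiteP[F [TF ndF Foo]] := sigma_finiteT leb1.
have /sigma_finiteP[G [TG ndG Goo]] := sigma_finiteT m.
pose uncons (t : n.+1.-tuple M) : M * n.-tuple M :=
  (thead t, [tuple of behead t]).
have munc : measurable_fun setT uncons.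
  apply: measurable_fun_pair; first exact: measurable_tnth.
  exact: measurable_behead.
have tconsK : cancel (@tcons n) uncons.
  by move=> [x t]; congr (_, _); apply: val_inj.
exists (fun k => uncons @^-1` (F k `*` G k)).
  rewrite -preimage_bigcup; apply/seteqP; split=> [t _|//].
  have [i _ Fi] : (\bigcup_k F k) (uncons t).1 by rewrite -TF.
  have [j _ Gj] : (\bigcup_k G k) (uncons t).2 by rewrite -TG.
  exists (maxn i j) => //; split => /=.
    by move: Fi; exact/subsetPset/ndF/leq_maxl.
  by move: Gj; exact/subsetPset/ndG/leq_maxr.
move=> k; have [mF Fk] := Foo k; have [mG Gk] := Goo k; split.
  by rewrite -[X in measurable X]setTI; apply: munc => //; exact: measurableX.
rewrite /lebesgue_step /pushforward -comp_preimage.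
rewrite (_ : _ \o _ = id) ?preimage_id; last by apply/funext=> p /=.
by rewrite product_measure1E// lte_mul_pinfty// ge0_fin_numE.
Qed.

HB.instance Definition _ := Measure_isSigmaFinite.Build _ _ _ lebesgue_step
  step_sigma_finite.
End step.

Fixpoint lebesgue_tuple n : {sigma_finite_measure set (n.-tuple M) -> \bar R} :=
  if n is n'.+1 then lebesgue_step (lebesgue_tuple n')
  else @dirac _ (0.-tuple M) [tuple] R.

Lemma measurable_tuple_box n (A : 'I_n -> set M) :
  (forall i, measurable (A i)) ->
  measurable [set t : n.-tuple M | forall i, A i (tnth t i)].
Proof.
move=> mA; rewrite (_ : [set _ | _] =
    \bigcap_(i in [set: 'I_n]) ((@tnth n M ^~ i) @^-1` A i)).
  apply: fin_bigcap_measurable => // i _.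
  by rewrite -[X in measurable X]setTI; exact: measurable_tnth.
by apply/seteqP; split=> [t At i _|t At i]; exact: At.
Qed.

Definition borelRd d := g_sigma_algebraType (@open 'rV[R]_d).

Definition row_of_tuple d (t : d.-tuple M) : borelRd d := \row_i (tnth t i : R).

Lemma measurable_row_of_tuple d : measurable_fun setT (@row_of_tuple d).
Proof.
apply: (@measurability _ _ _ (borelRd d) setT (@row_of_tuple d)
  (@open 'rV[R]_d) erefl).
move=> _ [U oU <-]; rewrite setTI.
pose box (p : 'rV[rat]_d * 'rV[rat]_d) : set (d.-tuple M) :=
  [set t | forall i, `]ratr (p.1 ord0 i), ratr (p.2 ord0 i)[%classic
                       (tnth t i : R)].
have -> : @row_of_tuple d @^-1` U =
    \bigcup_p (if `[< box p `<=` @row_of_tuple d @^-1` U >] then box p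
               else set0).
  apply/seteqP; split=> [t Ut|t [p _]]; last first.
    by case: asboolP => // /[apply].
  have := open_nbhs_nbhs (conj oU Ut) => /nbhs_ballP[e /= e0 eU].
  have ltx i : tnth t i - e < (tnth t i : R) by rewrite ltrBlDr ltrDl.
  have gtx i : (tnth t i : R) < tnth t i + e by rewrite ltrDl.
  pose a := \row_i projT1 (cid (rat_in_itvoo (ltx i))).
  pose b := \row_i projT1 (cid (rat_in_itvoo (gtx i))).
  have aP i : ratr (a ord0 i) \in `]tnth t i - e, (tnth t i : R)[.
    by rewrite mxE; case: cid.
  have bP i : ratr (b ord0 i) \in `](tnth t i : R), tnth t i + e[.
    by rewrite mxE; case: cid.
  exists (a, b) => //; case: asboolP => [_ i|[]] /=.
    rewrite in_itv/=; move: (aP i) (bP i); rewrite !in_itv/=.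
    by move=> /andP[_ ->] /andP[-> _].
  move=> s sab; apply: eU; split => // j i; rewrite !mxE.
  have := sab i; move: (aP i) (bP i); rewrite /= !in_itv/=.
  move=> /andP[a1 a2] /andP[b1 b2] /andP[s1 s2].
  rewrite /ball/= ltr_distlC; apply/andP; split.
    exact: lt_trans s1.
  exact: lt_trans b2.
apply: (@countable_bigcupT_measurable _ (d.-tuple M)) => [|p].
  exact: countableP.
case: asboolP => // _; apply: (@measurable_tuple_box d (fun i =>
  `]ratr (p.1 ord0 i), ratr (p.2 ord0 i)[%classic)) => i.
exact: measurable_itv.
Qed.

Section lebesgue_Rd.
Variable d : nat.
Definition lebesgue_Rd : set (borelRd d) -> \bar R :=
  pushforward (lebesgue_tuple d) (@row_of_tuple d).

Let mrow A : measurable A -> measurable (@row_of_tuple d @^-1` A).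
Proof.
by move=> mA; rewrite -[X in measurable X]setTI; exact: measurable_row_of_tuple.
Qed.

Let leb0 : lebesgue_Rd set0 = 0%E.
Proof. by rewrite /lebesgue_Rd /pushforward preimage_set0 measure0. Qed.

Let leb_ge0 A : (0 <= lebesgue_Rd A)%E.
Proof. by rewrite /lebesgue_Rd /pushforward measure_ge0. Qed.

Let leb_sigma_additive : semi_sigma_additive lebesgue_Rd.
Proof.
move=> F mF tF mUF; rewrite /lebesgue_Rd /pushforward preimage_bigcup.
apply: measure_semi_sigma_additive => //.
- by move=> i; exact: mrow.
- apply/trivIsetP => /= i j _ _ ij; rewrite -preimage_setI.
  by move/trivIsetP : tF => /(_ _ _ _ _ ij) ->//; rewrite preimage_set0.
- by rewrite -preimage_bigcup; exact: mrow.
Qed.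

HB.instance Definition _ := isMeasure.Build _ _ _ lebesgue_Rd
  leb0 leb_ge0 leb_sigma_additive.

Lemma lebesgue_Rd_box (A : 'I_d -> set M) : (forall i, measurable (A i)) ->
  lebesgue_Rd [set x | forall i, A i (x ord0 i)] =
  (\prod_(i < d) lebesgue_measure (A i))%E.
Proof.
move=> mA; rewrite /lebesgue_Rd /pushforward.
have -> : @row_of_tuple d @^-1` [set x | forall i, A i (x ord0 i)] =
    [set t : d.-tuple M | forall i, A i (tnth t i)].
  by apply/seteqP; split=> t /= At i; have := At i; rewrite mxE.
elim: d A mA => [|n ih] A mA /=.
  rewrite big_ord0 diracE mem_set// => i; exact: (False_rect _ (notF (ltn_ord i))).
rewrite /lebesgue_step /pushforward.
rewrite big_ord_recl -ih// -product_measure1E//; last first.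
  by apply: (@measurable_tuple_box n (fun i => A (lift ord0 i))) => i; exact: mA.
congr (_ _); apply/seteqP; split=> [[x t] At|[x t] /= [Ax At] i] /=.
  split=> [|i]; first exact: (At ord0).
  by have := At (lift ord0 i); rewrite tnthS.
by case: (unliftP ord0 i) => [j ->|->//]; rewrite tnthS; exact: At.
Qed.
End lebesgue_Rd.
End Lebesgue.
Arguments lebesgue_Rd {R d}.

Section Euclidean.
Variables (R : realType) (d : nat).
Local Notation E := 'rV[R]_d.

Definition dotp (x y : E) : R := \sum_(i < d) x ord0 i * y ord0 i.
Definition enorm (x : E) : R := Num.sqrt (dotp x x).
Definition eball (r : R) : set E := [set x | enorm x <= r].

Definition ldet (f : {linear E -> E}) : R := \det (lin1_mx f).
(** With row vectors, [f x = x *m lin1_mx f], so that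
    [dotp (f x) t = dotp x (adjoint f t)]. *)
Definition adjoint (f : {linear E -> E}) (t : E) : E := t *m (lin1_mx f)^T.

Definition set_shift (x : E) (S : set E) : set E := [set y + x | y in S].
End Euclidean.

(** [cis x] is exp(i x). *)
Definition cis (R : realType) (x : R) : R[i] := Complex (cos x) (sin x).

Definition cvnorm (R : realType) n (v : 'cV[R[i]]_n) : R :=
  Num.sqrt (\sum_(i < n) Normc.normc (v i ord0) ^+ 2).

Definition opnorm (R : realType) n (B : 'M[R[i]]_n) : R :=
  sup [set cvnorm (B *m v) | v in [set v | cvnorm v <= 1]].

Section Tiles.
Variables (R : realType) (d : nat) (L : finType).
Local Notation E := 'rV[R]_d.

(** The label [None] stands for an unlabelled tile. *)
Definition tile : Type := set E * option L.
Definition supp (T : tile) : set E := T.1.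
Definition is_tile (T : tile) : Prop :=
  [/\ supp T !=set0, compact (supp T) & supp T = closure (supp T)°].
Definition tile_shift (x : E) (T : tile) : tile := (set_shift x T.1, T.2).

Definition tile_patch : Type := set tile.
Local Notation patch := tile_patch.
Definition is_patch (P : patch) : Prop :=
  (forall T, P T -> is_tile T) /\ trivIset P (fun T => (supp T)°).
Definition patch_supp (P : patch) : set E := \bigcup_(T in P) supp T.
Definition is_tiling (P : patch) : Prop := is_patch P /\ patch_supp P = setT.
Definition patch_shift (x : E) (P : patch) : patch := tile_shift x @` P.

Definition meeting (P : patch) (S : set E) : patch :=
  [set T | P T /\ supp T `&` S !=set0].
Definition inside (P : patch) (S : set E) : patch :=
  [set T | P T /\ supp T `<=` S].

Definition patch_cvg (Q : nat -> patch) (P : patch) : Prop :=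
  forall e r : R, 0 < e -> 0 < r ->
  \forall l \near \oo, exists x y : E,
    [/\ enorm x < e, enorm y < e &
        inside (patch_shift x (Q l)) (eball r) =
        inside (patch_shift y P) (eball r)].

Definition patch_frequencies_converge (T : patch) : Prop :=
  forall P : patch, is_patch P -> finite_set P -> P !=set0 ->
  cvg ((#|` fset_set [set t : E | eball r t /\ patch_shift t P `<=` T]|%:R
        / fine (lebesgue_Rd (eball r : set (borelRd R d))) : R)
       @[r --> +oo%R]).
End Tiles.

Section Substitutions.
Variables (R : realType) (d : nat) (L : finType) (na : nat).
Variable A : 'I_na -> tile R d L.
Local Notation E := 'rV[R]_d.
Local Notation patch := (tile_patch R d L).

Definition is_alphabet : Prop :=
  (forall i, is_tile (A i)) /\
  (forall i j x, A j = tile_shift x (A i) -> i = j).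

Definition is_Apatch (P : patch) : Prop :=
  is_patch P /\ forall T, P T -> exists i x, T = tile_shift x (A i).

Record substitution := Substitution {
  expansion : {linear E -> E};
  rule : 'I_na -> patch;
  expansionP : 1 < inf [set enorm (expansion v) | v in [set v | enorm v = 1]];
  rule_Apatch : forall j, is_Apatch (rule j);
  rule_supp : forall j, patch_supp (rule j) = expansion @` supp (A j)
}.

Definition subst (rho : substitution) (P : patch) : patch :=
  [set T | exists j x, P (tile_shift x (A j)) /\
                       patch_shift (expansion rho x) (rule rho j) T].

Definition digits (rho : substitution) (i j : 'I_na) : set E :=
  [set x | rule rho j (tile_shift x (A i))].

Definition fourier_mx (rho : substitution) (t : E) : 'M[R[i]]_na :=
  \matrix_(i, j) \sum_(s \in digits rho i j) cis (2 * pi * dotp s t).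

Variables (ma : nat) (rho : 'I_ma -> substitution).

(** [subst_word [:: j1; ...; jn]] is rho_j1 o ... o rho_jn. *)
Definition subst_word (s : seq 'I_ma) (P : patch) : patch :=
  foldr (fun j => subst (rho j)) P s.

Definition FLC : Prop :=
  forall K : set E, compact K ->
  exists F : set patch, finite_set F /\
    forall (j : 'I_na) (s : seq 'I_ma) (x : E), s != [::] ->
    exists Q y, F Q /\
      meeting (subst_word s [set A j]) (set_shift x K) = patch_shift y Q.

Definition legal (P : patch) : Prop :=
  is_patch P /\
  exists (j : 'I_na) (s : seq 'I_ma) (x : E),
    s != [::] /\ P `<=` patch_shift x (subst_word s [set A j]).

(** Indices start at 0: [i j], [T k], [adj_orbit k] stand for i_(j+1),
    T^(k+1) and the argument of the (k+1)-st factor of the product of Fourier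
    matrices. *)
Variable i : nat -> 'I_ma.

Definition subst_from (k n : nat) (P : patch) : patch :=
  subst_word [seq i j | j <- index_iota k n] P.

Definition Sadic_tiling (T : patch) : Prop :=
  exists (n : nat -> nat) (P : nat -> patch),
    [/\ {homo n : l m / (l < m)%N}, forall l, legal (P l), is_tiling T &
        patch_cvg (fun l => subst_from 0 (n l) (P l)) T].

(** [T 0] is an S-adic tiling belonging to [i], and the [T k] are its
    de-substituted tilings along one fixed sequence (n_l, P_l). *)
Definition desubstituted_tilings (T : nat -> patch) : Prop :=
  exists (n : nat -> nat) (P : nat -> patch),
    [/\ {homo n : l m / (l < m)%N}, forall l, legal (P l) &
        forall k, is_tiling (T k) /\
          patch_cvg (fun l => subst_from k (n l) (P l)) (T k)].

Lemma desubstituted_tilings_Sadic (T : nat -> patch) :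
  desubstituted_tilings T -> Sadic_tiling (T 0%N).
Proof. by move=> [n [P [nP lP TP]]]; exists n, P; have [] := TP 0%N. Qed.

Fixpoint adj_orbit (t : E) (k : nat) : E :=
  if k is k'.+1 then adjoint (expansion (rho (i k'))) (adj_orbit t k') else t.

Definition fourier_prod (t : E) (k : nat) : 'M[R[i]]_na :=
  \big[mulmx/1%:M]_(j < k) fourier_mx (rho (i j)) (adj_orbit t j).

(** Extended-real valued, with [lne 0 = -oo]; only used for [0 < k]. *)
Definition exponent_gap (t : E) (k : nat) : \bar R :=
  ((ln (\prod_(j < k) `|ldet (expansion (rho (i j)))|) / (2 * k%:R))%:E
   - (k%:R^-1)%:E * lne (opnorm (fourier_prod t k))%:E)%E.

End Substitutions.

(** Complex Radon measures on R^d are continuous linear functionals on Cc(R^d).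
    The functionals below are written as total maps on functions; only their
    values on Cc matter. *)
Section Diffraction.
Variables (R : realType) (d : nat).
Local Notation E := 'rV[R]_d.
Local Notation C := R[i].
Local Notation functional := ((E -> C) -> C).

Definition Cc (f : E -> C) : Prop :=
  continuous (f : E -> C^o) /\ compact (closure [set x | f x != 0]).

Definition is_radon (g : functional) : Prop :=
  (forall a f h, Cc f -> Cc h -> g (fun x => a * f x + h x) = a * g f + g h) /\
  (forall K : set E, compact K -> exists c : R, forall f (b : R),
     Cc f -> closure [set x | f x != 0] `<=` K ->
     (forall x, Normc.normc (f x) <= b) -> Normc.normc (g f) <= c * b).

Definition mtilde (m : functional) : functional :=
  fun f => (m (fun t => (f (- t))^*))^*.

Definition mconv (m n : functional) : functional :=
  fun f => m (fun x => n (fun y => f (x + y))).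

Definition cintegral (mu : {measure set (borelRd R d) -> \bar R}) (f : E -> C) : C :=
  Complex (\int[mu]_(x in setT) complex.Re (f x))
          (\int[mu]_(x in setT) complex.Im (f x)).

Definition cintegrable (mu : {measure set (borelRd R d) -> \bar R}) (f : E -> C) : Prop :=
  mu.-integrable setT (fun x => (complex.Re (f x))%:E) /\
  mu.-integrable setT (fun x => (complex.Im (f x))%:E).

Definition fconv (f h : E -> C) : E -> C :=
  fun x => cintegral lebesgue_Rd (fun y => f (x - y) * h y).

Definition inv_fourier (f : E -> C) : E -> C :=
  fun t => cintegral lebesgue_Rd (fun x => f x * cis (2 * pi * dotp x t)).

(** Only positive Fourier transforms are needed, so [ghat] is a Borel measure,
    finite on compact sets. *)
Definition is_fourier_transform (g : functional)
    (ghat : {measure set (borelRd R d) -> \bar R}) : Prop :=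
  (forall K : set E, compact K -> (ghat K < +oo)%E) /\
  forall f h, Cc f -> Cc h ->
    cintegrable ghat (inv_fourier (fconv f h)) /\
    g (fconv f h) = cintegral ghat (inv_fourier (fconv f h)).

(** [a] is the absolutely continuous part in the Lebesgue decomposition of [mu]
    with respect to Lebesgue measure. *)
Definition is_ac_part (mu a : {measure set (borelRd R d) -> \bar R}) : Prop :=
  exists s : {measure set (borelRd R d) -> \bar R},
    [/\ forall X, measurable X -> mu X = (a X + s X)%E,
        a `<< lebesgue_Rd &
        exists N, [/\ measurable N, lebesgue_Rd N = 0%E & s (~` N) = 0%E]].

Variables (L : finType) (na : nat) (A : 'I_na -> tile R d L) (w : 'I_na -> C).
Variable T : tile_patch R d L.

(** The restriction to [eball r] of the sum of the w_i delta_t, t in D_i. *)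
Definition comb (r : R) : functional := fun f =>
  \sum_(i < na) w i *
    \sum_(t \in [set t | T (tile_shift t (A i)) /\ eball r t]) f t.

Definition is_autocorrelation (g : functional) : Prop :=
  is_radon g /\
  forall f, Cc f ->
    (((fine (lebesgue_Rd (eball r : set (borelRd R d))))^-1)%:C%C *
       mconv (comb r) (mtilde (comb r)) f : C^o) @[r --> +oo%R]
    --> (g f : C^o).

Definition is_diffraction_measure
    (ghat : {measure set (borelRd R d) -> \bar R}) : Prop :=
  exists g, is_autocorrelation g /\ is_fourier_transform g ghat.

End Diffraction.

(* Main.v *)
Require Import Defs.
From HB Require Import structures.
From mathcomp Require Import all_boot all_order all_algebra.
From mathcomp Require Import all_classical all_reals all_analysis.
From mathcomp Require Import finmap complex.
From mathcomp Require Import perm measurable_realfun ring lra.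

Set Implicit Arguments.
Unset Strict Implicit.
Unset Printing Implicit Defensive.
Import Order.TTheory GRing.Theory Num.Theory.
Import numFieldNormedType.Exports.
Local Open Scope classical_set_scope.
Local Open Scope ring_scope.

(** The comb [F_R] of the points of the first tiling in the ball [B_R] is, up to
    boundary points, [\sum_ij w_i B_ij X_j], where [B] is the product of the first
    [n] Fourier matrices, seen as a matrix of sums of translations, and the [X_j]
    are the positions of the [n]-times de-substituted tiles expanded by
    [Phi_n = phi_1 ... phi_n]. By packing, [X_j] has at most
    [C * vol B_R / |det Phi_n|] points, with [C] independent of [n].

    Let [b t] be the sum of the squared moduli of the entries of [B t]. Testing the
    diffraction measure [ghat] against [|v^|^2] with [v = (1 - S)^m f], [f] a bump
    function and [S] the translation operator with Fourier multiplier [b / M],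
    gives the limit of [|| v * F_R ||^2 / vol B_R]. On the Fourier side [v^] is
    [(1 - b / M)^m f^], which is bounded below where [b <= theta]. In physical
    space, [0 <= S <= 1] yields [|| B_ij (1 - S)^m u ||^2 <= M / (2 m + 1) || u ||^2],
    the operator form of [x (1 - x)^(2 m) <= 1 / (2 m + 1)]. With
    [m ~ M / (4 theta)], for every compact [K],
    [ghat ({b <= theta} n K) <= C_K theta / |det Phi_n|].

    By hypothesis, almost every [t] satisfies
    [b t <= const * e^(-2 eps n) |det Phi_n|] for all large [n], so almost every [t]
    lies in a [ghat]-null set: [ghat] is singular. *)

(** * Lebesgue measure under linear maps *)

(** A sharp cut-off to [b <= theta] would not keep test functions compactly supported. A polynomial
    in [S] is a finite sum of translations: it preserves compact support and commutes with every
    [B_ij], so [(1 - S)^m] can be moved past the positions [X_j] and made to act on bumps. The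
    constants are of two kinds. Thicknesses of boundary shells may depend on [n], because the radius
    of the ball goes to infinity first, with [n] fixed. The factor [C_K] may not: the crude
    normalisation [M], which can grow with the digit sets, enters only through
    [M / (2 m + 1) <= 4 theta]. The bump [f] is fixed before [n]. Its support is below the packing
    distance of the prototiles, which expansion can only increase, so its translates along [X_j] are
    orthogonal; it is also small relative to [K], so that [f^] is bounded below on [K]. *)

Section LebesgueMeasurable.
Variables (R : realType) (d : nat).
Local Notation E := 'rV[R]_d.
Local Notation B := (borelRd R d).
Local Notation M := (measurableTypeR R).

Lemma borelRd_measurable_open (U : set E) : open U -> measurable (U : set B).
Proof. by move=> oU; exact: sub_sigma_algebra. Qed.

Lemma borelRd_measurable_closed (U : set E) : closed U -> measurable (U : set B).
Proof.
move=> cU; rewrite -[X in measurable X]setCK; apply: measurableC.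
by apply: borelRd_measurable_open; exact: closed_openC.
Qed.

Lemma borelRd_measurable_continuous (f : E -> R) :
  continuous f -> measurable_fun setT (f : B -> M).
Proof.
move=> cf; apply: (measurability _ (RGenOpens.measurableE R)).
move=> _ [_ [a [b ->]] <-]; rewrite setTI; apply: borelRd_measurable_open.
by apply: open_comp => // x _; exact: cf.
Qed.

Lemma measurable_fun_row dT (T : measurableType dT) (f : T -> E) :
  (forall i, measurable_fun setT ((fun x => f x ord0 i) : T -> M)) ->
  measurable_fun setT (f : T -> B).
Proof.
move=> mf; pose g x : d.-tuple M := [tuple (f x ord0 i : M) | i < d].
rewrite (_ : f = @row_of_tuple R d \o g); last first.
  by apply/funext => x; apply/rowP => i; rewrite /row_of_tuple /g /= mxE tnth_mktuple.
apply: measurableT_comp; first exact: measurable_row_of_tuple.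
apply/measurable_fun_tnthP => i.
rewrite (_ : _ \o _ = (fun x => f x ord0 i)) //.
by apply/funext => x /=; rewrite /g tnth_mktuple.
Qed.

Lemma continuous_coord (i : 'I_d) : continuous (fun x : E => x ord0 i).
Proof. exact: coord_continuous. Qed.

Lemma measurable_coord (i : 'I_d) :
  measurable_fun setT ((fun x : E => x ord0 i) : B -> M).
Proof. by apply: borelRd_measurable_continuous; exact: continuous_coord. Qed.

Definition obox (a b : E) : set E :=
  [set x | forall i, a ord0 i < x ord0 i < b ord0 i].

Lemma oboxE a b : obox a b =
  [set x | forall i, `]a ord0 i, b ord0 i[%classic (x ord0 i)].
Proof. by apply/seteqP; split=> x /= h i; have := h i; rewrite in_itv. Qed.

Lemma measurable_obox a b : measurable (obox a b : set B).
Proof.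
rewrite (_ : obox a b = \bigcap_(i in [set: 'I_d])
    ((fun x : E => x ord0 i) @^-1` `]a ord0 i, b ord0 i[%classic)).
  apply: fin_bigcap_measurable => // i _.
  rewrite -[X in measurable X]setTI.
  exact: (measurable_coord i measurableT (measurable_itv _)).
by rewrite oboxE; apply/seteqP; split=> [t At i _|t At i]; exact: At.
Qed.

Lemma lebesgue_obox a b : lebesgue_Rd (obox a b : set B) =
  (\prod_(i < d) Num.max 0 (b ord0 i - a ord0 i))%:E.
Proof.
rewrite oboxE (@lebesgue_Rd_box R d (fun i => `]a ord0 i, b ord0 i[%classic)).
  rewrite -prodEFin; apply: eq_bigr => i _; rewrite lebesgue_measure_itv/= lte_fin.
  by case: ltP => h; congr _%:E; rewrite maxEle; case: leP => // ?; lra.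
by move=> i; exact: measurable_itv.
Qed.

Lemma obox_setI : setI_closed (range (fun p : E * E => obox p.1 p.2)).
Proof.
move=> _ _ [[a b] _ <-] [[a' b'] _ <-].
exists (\row_i Num.max (a ord0 i) (a' ord0 i),
        \row_i Num.min (b ord0 i) (b' ord0 i)) => //.
apply/seteqP; split=> x /=.
  move=> h; split=> i; have := h i; rewrite !mxE gt_max lt_min;
    by move=> /andP[/andP[h1 h2] /andP[h3 h4]]; apply/andP.
by move=> [h h'] i; rewrite !mxE gt_max lt_min; have /andP[-> ->] := h i; have /andP[-> ->] := h' i.
Qed.

(** The nontrivial inclusion writes an open set as the countable union of the boxes with rational
    corners that it contains. *)
Lemma borelRd_measurableE :
  measurable = <<s range (fun p : E * E => obox p.1 p.2) >> :> set (set B).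
Proof.
apply/seteqP; split; last first.
  apply: smallest_sub; first exact: sigma_algebra_measurable.
  by move=> _ [p _ <-]; exact: measurable_obox.
apply: smallest_sub; first exact: smallest_sigma_algebra.
move=> U oU.
pose box (p : 'rV[rat]_d * 'rV[rat]_d) : set E :=
  obox (map_mx ratr p.1) (map_mx ratr p.2).
rewrite (_ : U = \bigcup_p (if `[< box p `<=` U >] then box p else set0)).
  apply: (@countable_bigcupT_measurable _
    (g_sigma_algebraType (range (fun p : E * E => obox p.1 p.2)))) => [|p].
    exact: countableP.
  case: asboolP => // _; apply: sub_sigma_algebra.
  by exists (map_mx ratr p.1, map_mx ratr p.2).
apply/seteqP; split=> [t Ut|t [p _]]; last by case: asboolP => // /[apply].
have := open_nbhs_nbhs (conj oU Ut) => /nbhs_ballP[e /= e0 eU].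
have ltx i : t ord0 i - e < t ord0 i by rewrite ltrBlDr ltrDl.
have gtx i : t ord0 i < t ord0 i + e by rewrite ltrDl.
pose a := \row_i projT1 (cid (rat_in_itvoo (ltx i))).
pose b := \row_i projT1 (cid (rat_in_itvoo (gtx i))).
have aP i : ratr (a ord0 i) \in `]t ord0 i - e, t ord0 i[.
  by rewrite mxE; case: cid.
have bP i : ratr (b ord0 i) \in `]t ord0 i, t ord0 i + e[.
  by rewrite mxE; case: cid.
exists (a, b) => //; case: asboolP => [_ i|[]] /=.
  move: (aP i) (bP i); rewrite !in_itv/= => /andP[_ h1] /andP[h2 _].
  by rewrite [map_mx _ a _ _]mxE [map_mx _ b _ _]mxE h1 h2.
move=> s sab; apply: eU; split => // j i.
have := sab i; move: (aP i) (bP i); rewrite /= [map_mx _ a _ _]mxE.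
rewrite [map_mx _ b _ _]mxE !in_itv/=.
move=> /andP[a1 a2] /andP[b1 b2] /andP[s1 s2].
rewrite (ord1 j) /ball/= ltr_distlC; apply/andP; split.
  exact: lt_trans s1.
exact: lt_trans b2.
Qed.

Lemma coord_le_norm (x : E) i : `|x ord0 i| <= `|x|.
Proof.
rewrite [leRHS]/Num.norm /= mx_normrE; apply/bigmax_geP; right => /=.
by exists (ord0, i).
Qed.

Lemma norm_le_coord (x : E) c : 0 <= c ->
  (forall i, `|x ord0 i| <= c) -> `|x| <= c.
Proof.
move=> c0 h; rewrite [leLHS]/Num.norm /= mx_normrE; apply/bigmax_leP; split => //.
by move=> [i j] _ /=; rewrite (ord1 i).
Qed.

Lemma norm_lt_coord (x : E) c : 0 < c ->
  (forall i, `|x ord0 i| < c) -> `|x| < c.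
Proof.
move=> c0 h; rewrite [ltLHS]/Num.norm /= mx_normrE; apply/bigmax_ltP; split => //.
by move=> [i j] _ /=; rewrite (ord1 i).
Qed.

(** The open ball of the sup norm, which is the norm [|x|] on row vectors; it is the unit of volume
    in the packing arguments. *)
Definition ocube (c : E) (q : R) : set E := obox (c - const_mx q) (c + const_mx q).

Lemma ocubeE c q x : ocube c q x <-> forall i, `|x ord0 i - c ord0 i| < q.
Proof.
split=> h i; have := h i; rewrite !mxE distrC ltr_distlC //.
Qed.

Lemma bigcup_ocube : \bigcup_k ocube 0 (k%:R : R) = setT.
Proof.
apply/seteqP; split=> // x _.
exists (Num.trunc `|x|).+1 => //; apply/ocubeE => i.
rewrite !mxE subr0; apply: le_lt_trans (truncnS_gt _).
exact: coord_le_norm.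
Qed.

Lemma lebesgue_ocube c q : 0 <= q ->
  lebesgue_Rd (ocube c q : set B) = ((2 * q) ^+ d)%:E.
Proof.
move=> q0; rewrite lebesgue_obox; congr _%:E.
rewrite (eq_bigr (fun i => 2 * q)); first by rewrite prodr_const card_ord.
by move=> i _; rewrite !mxE maxEle; case: leP => // ?; lra.
Qed.

(** The boxes form a generating pi-system, and the cubes [ocube 0 k] exhaust the space with finite
    measure. *)
Lemma obox_unique (m1 m2 : {measure set B -> \bar R}) :
  (forall a b, m1 (obox a b) = m2 (obox a b)) ->
  (forall a b, (m1 (obox a b) < +oo)%E) ->
  forall A, measurable A -> m1 A = m2 A.
Proof.
move=> h12 h1 A mA.
apply: (@measure_unique _ R B (range (fun p : E * E => obox p.1 p.2))
  (fun k => ocube 0 (k%:R : R)) borelRd_measurableE obox_setI _ bigcup_ocube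
  m1 m2 _ _ A mA).
- by move=> k; exists (0 - const_mx k%:R, 0 + const_mx k%:R).
- by move=> _ [p _ <-]; exact: h12.
- by move=> k; exact: h1.
Qed.

Lemma lebesgue_obox_lty a b : (lebesgue_Rd (obox a b : set B) < +oo)%E.
Proof. by rewrite lebesgue_obox ltry. Qed.

Lemma lebesgue_Rd_sigma_finite : sigma_finite setT (@lebesgue_Rd R d).
Proof.
exists (fun k => ocube 0 (k%:R : R)); first by rewrite bigcup_ocube.
by move=> k; split; [exact: measurable_obox|exact: lebesgue_obox_lty].
Qed.

HB.instance Definition _ := Measure_isSigmaFinite.Build _ _ _ (@lebesgue_Rd R d)
  lebesgue_Rd_sigma_finite.

End LebesgueMeasurable.

Section Pushforward.
Context d1 d2 (X : measurableType d1) (Y : measurableType d2) (R : realType).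
Variables (mu : {measure set X -> \bar R}) (phi : X -> Y).
Variable mphi : measurable_fun setT phi.

Definition image_measure : {measure set Y -> \bar R} :=
  measure_function_pushforward__canonical__measure_function_Measure mu mphi.

Lemma image_measureE A : image_measure A = mu (phi @^-1` A).
Proof. by []. Qed.
End Pushforward.

(** * Translations, diagonal and permutation matrices; uniqueness of Haar measure *)

Section LebesgueInvariance.
Variables (R : realType) (d : nat).
Local Notation E := 'rV[R]_d.
Local Notation B := (borelRd R d).
Local Notation M := (measurableTypeR R).
Local Notation leb := (@lebesgue_Rd R d).

Lemma lebesgue_preimage_scale (phi : B -> B) (c : R) : 0 <= c ->
  measurable_fun setT phi ->
  (forall a b, leb (phi @^-1` obox a b) = (c%:E * leb (obox a b))%E) ->
  forall A, measurable A -> leb (phi @^-1` A) = (c%:E * leb A)%E.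
Proof.
move=> c0 mphi h A mA.
pose m2 : {measure set B -> \bar R} := mscale (NngNum c0) leb.
rewrite -[LHS](image_measureE leb mphi).
apply: (@obox_unique R d (image_measure leb mphi) m2) => // a b.
apply: (@le_lt_trans _ _ (c%:E * leb (obox a b))%E); first by rewrite -h.
by rewrite lebesgue_obox -EFinM ltry.
Qed.

Lemma measurable_fun_coord dT (T : measurableType dT) (f : T -> B) i :
  measurable_fun setT f -> measurable_fun setT ((fun x => (f x : E) ord0 i) : T -> M).
Proof.
move=> mf.
exact (measurableT_comp (measurable_coord i) mf).
Qed.

Lemma measurable_fun_addE dT (T : measurableType dT) (f g : T -> B) :
  measurable_fun setT f -> measurable_fun setT g ->
  measurable_fun setT ((fun x => (f x : E) + g x) : T -> B).
Proof.
move=> mf mg; apply: measurable_fun_row => i.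
rewrite (_ : (fun _ => _) = (fun x => (f x : E) ord0 i + (g x : E) ord0 i)).
  by apply: measurable_funD; exact: measurable_fun_coord.
by apply/funext => x; rewrite mxE.
Qed.

Lemma measurable_fun_oppE dT (T : measurableType dT) (f : T -> B) :
  measurable_fun setT f -> measurable_fun setT ((fun x => - (f x : E)) : T -> B).
Proof.
move=> mf; apply: measurable_fun_row => i.
rewrite (_ : (fun _ => _) = (fun x => - ((f x : E) ord0 i))).
  by apply: measurableT_comp => //; exact: measurable_fun_coord.
by apply/funext => x; rewrite mxE.
Qed.

Lemma measurable_fun_mulmx dT (T : measurableType dT) (f : T -> B) (N : 'M[R]_d) :
  measurable_fun setT f -> measurable_fun setT ((fun x => (f x : E) *m N) : T -> B).
Proof.
move=> mf; apply: measurable_fun_row => i.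
rewrite (_ : (fun _ => _) = (fun x => \sum_(j < d) (f x : E) ord0 j * N j i)).
  apply: measurable_sum => j.
  by apply: measurable_funM => //; exact: measurable_fun_coord.
by apply/funext => x; rewrite mxE.
Qed.

Lemma lebesgue_shift (s : E) (A : set B) : measurable A ->
  leb [set x : E | A (x + s)] = leb A.
Proof.
move=> mA; rewrite -[RHS]mul1e.
apply: (@lebesgue_preimage_scale (fun x => (x : E) + s)) => //.
  exact: measurable_fun_addE.
move=> a b; rewrite mul1e.
have -> : (fun x : E => x + s) @^-1` obox a b = obox (a - s) (b - s).
  apply/seteqP; split=> x /= h i; have := h i; rewrite !mxE ltrBlDr ltrBrDr //.
rewrite !lebesgue_obox; congr _%:E; apply: eq_bigr => i _; rewrite !mxE.
by congr (Num.max _ _); ring.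
Qed.

Lemma lebesgue_opp (A : set B) : measurable A -> leb [set x : E | A (- x)] = leb A.
Proof.
move=> mA; rewrite -[RHS]mul1e.
apply: (@lebesgue_preimage_scale (fun x => - (x : E))) => //.
  exact: measurable_fun_oppE.
move=> a b; rewrite mul1e.
have -> : (fun x : E => - x) @^-1` obox a b = obox (- b) (- a).
  apply/seteqP; split=> x /= h i; have := h i; rewrite !mxE;
  by move=> /andP[h1 h2]; apply/andP; split; lra.
rewrite !lebesgue_obox; congr _%:E; apply: eq_bigr => i _; rewrite !mxE.
by congr (Num.max _ _); ring.
Qed.

Lemma lebesgue_diag (D : E) (A : set B) : measurable A ->
  (forall i, D ord0 i != 0) ->
  leb [set x : E | A (x *m diag_mx D)] = ((\prod_i `|D ord0 i|)^-1%:E * leb A)%E.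
Proof.
move=> mA D0.
apply: (@lebesgue_preimage_scale (fun x => (x : E) *m diag_mx D)) => //.
- by rewrite invr_ge0; apply: prodr_ge0.
- exact: measurable_fun_mulmx.
move=> a b.
(* A negative diagonal entry exchanges the two ends of the interval. *)
pose lo := \row_i (if 0 < D ord0 i then a ord0 i / D ord0 i else b ord0 i / D ord0 i).
pose hi := \row_i (if 0 < D ord0 i then b ord0 i / D ord0 i else a ord0 i / D ord0 i).
have -> : (fun x : E => x *m diag_mx D) @^-1` obox a b = obox lo hi.
  have E1 (x : E) i : (a ord0 i < (x *m diag_mx D) ord0 i < b ord0 i) =
      (lo ord0 i < x ord0 i < hi ord0 i).
    rewrite mul_mx_diag !mxE; have [Di|Di|Di] := ltgtP 0 (D ord0 i).
    - by rewrite ltr_pdivrMr// ltr_pdivlMr.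
    - by rewrite ltr_ndivrMr// ltr_ndivlMr// andbC.
    - by have := D0 i; rewrite -Di eqxx.
  by apply/seteqP; split=> x h i; have := h i; rewrite /= E1.
rewrite !lebesgue_obox -EFinM; congr _%:E.
rewrite -prodfV -big_split /=; apply: eq_bigr => i _; rewrite !mxE.
have Di : 0 < `|D ord0 i| by rewrite normr_gt0.
rewrite maxr_pMr ?invr_ge0// mulr0; congr Num.max.
have [Di'|Di'|Di'] := ltgtP 0 (D ord0 i).
- by rewrite gtr0_norm//; field.
- by rewrite ltr0_norm//; field.
- by have := D0 i; rewrite -Di' eqxx.
Qed.

Lemma lebesgue_perm (s : 'S_d) (A : set B) : measurable A ->
  leb [set x : E | A (x *m perm_mx s)] = leb A.
Proof.
move=> mA; rewrite -[RHS]mul1e.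
apply: (@lebesgue_preimage_scale (fun x => (x : E) *m perm_mx s)) => //.
  exact: measurable_fun_mulmx.
have xs (x : E) i : (x *m perm_mx s) ord0 i = x ord0 (s^-1%g i).
  by rewrite -[in LHS](invgK s) -col_permE mxE.
move=> a b; rewrite mul1e.
have -> : (fun x : E => x *m perm_mx s) @^-1` obox a b =
    obox (\row_i a ord0 (s i)) (\row_i b ord0 (s i)).
  apply/seteqP; split=> x /= h i.
    by have := h (s i); rewrite xs permK !mxE.
  by have := h (s^-1%g i); rewrite xs 2!mxE permKV.
rewrite !lebesgue_obox; congr _%:E; rewrite [RHS](reindex_inj (@perm_inj _ s)) /=.
by apply: eq_bigr => i _; rewrite !mxE.
Qed.

Lemma lebesgue_rev (s : E) (A : set B) : measurable A ->
  leb [set x : E | A (s - x)] = leb A.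
Proof.
move=> mA; rewrite -[RHS]lebesgue_opp//.
rewrite -(@lebesgue_shift (- s) [set x : E | A (- x)]).
  by congr (leb _); apply/seteqP; split=> x /=; rewrite opprB addrC // addrC.
have := @measurable_fun_oppE _ _ id (@measurable_id _ B setT).
by move=> /(_ measurableT A mA); rewrite setTI.
Qed.

Lemma measurable_preimageT dT (T : measurableType dT) (f : T -> B) A :
  measurable_fun setT f -> measurable A -> measurable (f @^-1` A).
Proof. by move=> mf mA; rewrite -[X in measurable X]setTI; exact: mf. Qed.

Lemma integral_indic_set dT (T : measurableType dT)
    (m : {measure set T -> \bar R}) (A : set T) : measurable A ->
  (\int[m]_x (\1_A x)%:E = m A)%E.
Proof. by move=> mA; rewrite integral_indic// setIT. Qed.

Lemma integral_indic_setZr dT (T : measurableType dT)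
    (m : {measure set T -> \bar R}) (A : set T) c : measurable A -> (0 <= c)%E ->
  (\int[m]_x ((\1_A x)%:E * c) = m A * c)%E.
Proof.
move=> mA c0; rewrite -(integral_indic_set m mA); apply: ge0_integralZr => //.
by apply/measurable_EFinP; exact: measurable_indic.
Qed.

(* Uniqueness of Haar measure, by computing the product measure of
   [A x Q] along the shears (x, y) -> (x, y + x) and (x, y) -> (x - y, y). *)
Lemma shift_invariant_unique (nu : {sigma_finite_measure set B -> \bar R})
    (A Q : set B) : measurable A -> measurable Q ->
  (forall (s : E) (C : set B), measurable C -> nu [set x : E | C (x + s)] = nu C) ->
  (nu A * leb Q = nu Q * leb A)%E.
Proof.
move=> mA mQ nus.
have mfst : measurable_fun setT (fst : (B * B)%type -> B) by exact: measurable_fst.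
have msnd : measurable_fun setT (snd : (B * B)%type -> B) by exact: measurable_snd.
have mind (C : set B) : measurable C -> measurable_fun setT (fun x : B => (\1_C x)%:E : \bar R).
  by move=> mC; apply/measurable_EFinP; exact: measurable_indic.
have mindc (C : set B) (f : (B * B)%type -> B) : measurable C -> measurable_fun setT f ->
    measurable_fun setT (fun x => (\1_C (f x))%:E : \bar R).
  by move=> mC mf; apply: (@measurableT_comp _ _ _ _ _ _ (fun x : B => (\1_C x)%:E) _ f (mind _ mC) mf).
have sh (s : E) (C : set B) : measurable C -> measurable ([set x : E | C (x + s)] : set B).
  move=> mC; apply: (@measurable_preimageT _ B (fun x : B => (x : E) + s) C) => //.
  exact: measurable_fun_addE.
have rv (s : E) (C : set B) : measurable C -> measurable ([set x : E | C (s - x)] : set B).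
  move=> mC; apply: (@measurable_preimageT _ B (fun x : B => s - (x : E)) C) => //.
  by apply: measurable_fun_addE => //; exact: measurable_fun_oppE.
pose f (p : (B * B)%type) : \bar R :=
  ((\1_A p.1)%:E * (\1_Q ((p.2 : E) + p.1 : B))%:E)%E.
pose h (p : (B * B)%type) : \bar R :=
  ((\1_A ((p.1 : E) - p.2 : B))%:E * (\1_Q p.1)%:E)%E.
have mf : measurable_fun setT f.
  apply: emeasurable_funM; first exact: (mindc A fst).
  by apply: (mindc Q (fun p : (B * B)%type => (p.2 : E) + p.1)) => //; exact: measurable_fun_addE.
have mh : measurable_fun setT h.
  apply: emeasurable_funM; last exact: (mindc Q fst).
  apply: (mindc A (fun p : (B * B)%type => (p.1 : E) - p.2)) => //.
  by apply: measurable_fun_addE => //; exact: measurable_fun_oppE.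
have f0 p : (0 <= f p)%E by rewrite mule_ge0 ?lee_fin.
have h0 p : (0 <= h p)%E by rewrite mule_ge0 ?lee_fin.
transitivity (\int[nu]_x \int[leb]_y f (x, y))%E.
  rewrite -integral_indic_setZr//.
  apply: eq_integral => x _; rewrite /f /= ge0_integralZl ?lee_fin//.
    congr (_ * _)%E.
    rewrite -(lebesgue_shift x mQ) -integral_indic_set//; last exact: sh.
  exact: (mind _ (sh x Q mQ)).
rewrite fubini_tonelli//.
transitivity (\int[leb]_y \int[nu]_x h (x, y))%E.
  apply: eq_integral => y _.
  transitivity (nu (A `&` [set x : E | Q (y + x)])).
    rewrite -integral_indic_set; last first.
      by apply: measurableI => //; rewrite (_ : mkset _ = [set x : E | Q (x + y)]);
        [exact: sh|apply/seteqP; split=> x /=; rewrite addrC].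
    by apply: eq_integral => x _; rewrite indicI /f /= EFinM.
  (* Invariance of [nu] replaces [x] by [x - y], which moves the dependence on [y] from [Q] to
     [A]. *)
  rewrite -(nus (- y)); last first.
    by apply: measurableI => //; rewrite (_ : mkset _ = [set x : E | Q (x + y)]);
        [exact: sh|apply/seteqP; split=> x /=; rewrite addrC].
  have -> : [set x : E | (A `&` [set x : E | Q (y + x)]) (x - y)] =
            [set x : E | A (x - y)] `&` Q.
    by apply/seteqP; split=> x /=; rewrite (addrC y) subrK.
  rewrite -integral_indic_set; last by apply: measurableI => //; exact: sh.
  by apply: eq_integral => x _; rewrite indicI /h /= EFinM.
rewrite -fubini_tonelli//.
rewrite -[RHS]integral_indic_setZr//.
  apply: eq_integral => x _; rewrite /h /= ge0_integralZr ?lee_fin//.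
    rewrite muleC; congr (_ * _)%E.
    rewrite -(lebesgue_rev x mA) -integral_indic_set//; last exact: rv.
  exact: (mind _ (rv x A mA)).
Qed.

End LebesgueInvariance.

Lemma bernoulli_sub (R : realFieldType) (x : R) n : 0 <= x <= 1 -> 1 - n%:R * x <= (1 - x) ^+ n.
Proof.
move=> /andP[x0 x1]; elim: n => [|n ih]; first by rewrite mul0r subr0.
rewrite exprS; apply: (@le_trans _ _ ((1 - x) * (1 - n%:R * x))).
  have : 0 <= n%:R * x * x by rewrite !mulr_ge0.
  by rewrite -natr1; lra.
by rewrite ler_wpM2l// subr_ge0.
Qed.

(** * The volume factor of an invertible matrix *)

Section LebesgueLinear.
Variables (R : realType) (d : nat).
Local Notation E := 'rV[R]_d.
Local Notation B := (borelRd R d).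
Local Notation leb := (@lebesgue_Rd R d).
Implicit Types (N : 'M[R]_d) (c : R).

(** Formulated with preimages, whose measurability is automatic; the factor is therefore the inverse
    of the absolute determinant. *)
Definition scales_volume N c := forall A : set B, measurable A ->
  leb [set x : E | A (x *m N)] = (c%:E * leb A)%E.

Lemma measurable_preimage_mulmx N (A : set B) :
  measurable A -> measurable ([set x : E | A (x *m N)] : set B).
Proof.
move=> mA; apply: (@measurable_preimageT R d _ B (fun x : B => (x : E) *m N) A) => //.
exact: measurable_fun_mulmx.
Qed.

Lemma lebesgue_le (A C : set B) : measurable A -> measurable C -> A `<=` C ->
  (leb A <= leb C)%E.
Proof. by move=> mA mC AC; apply: le_measure => //; exact/mem_set. Qed.

Lemma scales_volumeM N1 N2 c1 c2 : scales_volume N1 c1 -> scales_volume N2 c2 ->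
  scales_volume (N1 *m N2) (c1 * c2).
Proof.
move=> h1 h2 A mA.
have := h1 [set x : E | A (x *m N2)] (measurable_preimage_mulmx N2 mA).
rewrite h2// muleA -EFinM => <-; congr (leb _).
by apply/seteqP; split=> x /=; rewrite mulmxA.
Qed.

Lemma scales_volume1 : scales_volume 1%:M 1.
Proof.
by move=> A mA; rewrite mul1e; congr (leb _); apply/seteqP; split=> x /=; rewrite mulmx1.
Qed.

Lemma norm_mulmx_le (x : E) N (k : R) : (forall i j, `|N i j| <= k) ->
  `|x *m N| <= d%:R * k * `|x|.
Proof.
move=> h; have [->|] := eqVneq x 0; first by rewrite mul0mx !normr0 mulr0.
move=> x0; apply: norm_le_coord => [|j].
  suff dk : 0 <= d%:R * k by rewrite mulr_ge0.
  have [d0|d0] := posnP d; first by rewrite [X in X%:R]d0 mul0r.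
  by rewrite mulr_ge0//; exact: le_trans (normr_ge0 _) (h (Ordinal d0) (Ordinal d0)).
rewrite mxE; apply: le_trans (ler_norm_sum _ _ _) _.
rewrite -mulrA -[X in X%:R]card_ord mulr_natl -sumr_const; apply: ler_sum => i _.
by rewrite normrM mulrC ler_pM// coord_le_norm.
Qed.

Lemma ocube0E (q : R) (x : E) : 0 < q -> ocube 0 q x <-> `|x| < q.
Proof.
move=> q0; rewrite ocubeE; split=> h.
  by apply: norm_lt_coord => // i; have := h i; rewrite mxE subr0.
by move=> i; rewrite mxE subr0; apply: le_lt_trans h; exact: coord_le_norm.
Qed.

Lemma mulmx_norm_bound N : exists2 k : R, 0 < k & forall x : E, `|x *m N| <= k * `|x|.
Proof.
exists (d%:R * (\sum_i \sum_j `|N i j|) + 1).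
  by rewrite ltr_wpDl// mulr_ge0// sumr_ge0// => i _; rewrite sumr_ge0.
move=> x; apply: (le_trans (norm_mulmx_le (k := \sum_i \sum_j `|N i j|) x _)).
  move=> i j; rewrite (bigD1 i)//= (bigD1 j)//= -addrA lerDl addr_ge0 ?sumr_ge0//.
  by move=> l _; rewrite sumr_ge0.
by rewrite ler_wpM2r// lerDl.
Qed.

Lemma ocube_mulmx_lty N q : N \in unitmx -> 0 < q ->
  (leb [set x : E | ocube 0 q (x *m N)] < +oo)%E.
Proof.
move=> uN q0; have [k k0 hk] := mulmx_norm_bound (invmx N).
apply: (@le_lt_trans _ _ (leb (ocube 0 (k * q)))); last first.
  by rewrite lebesgue_ocube ?ltry// mulr_ge0// ltW.
apply: lebesgue_le.
- exact: (@measurable_preimage_mulmx N (ocube 0 q) (measurable_obox _ _)).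
- exact: measurable_obox.
move=> x /= /ocube0E - /(_ q0) h; apply/ocube0E; first exact: mulr_gt0.
rewrite -(mulmxK uN x); apply: le_lt_trans (hk _) _.
by rewrite ltr_pM2l.
Qed.

(** The image of Lebesgue measure under [x |-> x N] is again translation invariant, so uniqueness of
    Haar measure makes it a multiple of Lebesgue measure. The factor is read off on [ocube 0 1],
    which has volume [2 ^ d]. *)
Lemma scales_volume_exists N : N \in unitmx -> exists2 c, 0 <= c & scales_volume N c.
Proof.
move=> uN; have mN : measurable_fun setT (fun x : B => (x : E) *m N : B).
  exact: measurable_fun_mulmx.
have sf : sigma_finite setT (image_measure leb mN).
  exists (fun k => ocube 0 (k.+1%:R : R)); last first.
    move=> k; split; first exact: measurable_obox.
    exact: ocube_mulmx_lty.
  apply/esym/seteqP; split=> // x _.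
  have [k _ /ocubeE kx] : (\bigcup_k ocube 0 (k%:R : R)) x by rewrite bigcup_ocube.
  by exists k => //; apply/ocubeE => i; apply: lt_trans (kx i) _; rewrite ltr_nat.
pose nuS := Measure_isSigmaFinite.Build _ _ _ (image_measure leb mN) sf.
pose nu : {sigma_finite_measure set B -> \bar R} := HB.pack (Measure.sort (image_measure leb mN)) nuS.
pose Q : set B := ocube 0 1.
have mQ : measurable Q by exact: measurable_obox.
have nuQ : (nu Q < +oo)%E by exact: ocube_mulmx_lty.
exists (fine (nu Q) / 2 ^+ d); first by rewrite divr_ge0// fine_ge0.
move=> A mA.
have := @shift_invariant_unique R d nu A Q mA mQ.
rewrite (lebesgue_ocube _ ler01) mulr1 => h.
have : (nu A * (2 ^+ d)%:E = nu Q * leb A)%E.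
  apply: h => s C mC.
  rewrite -[RHS](lebesgue_shift (s *m invmx N)); last exact: measurable_preimage_mulmx.
  by congr (leb _); apply/seteqP; split=> x /=; rewrite mulmxDl mulmxKV.
rewrite -[nu A]/(leb [set x : E | A (x *m N)]) => {}h.
rewrite mulrC EFinM fineK; last by rewrite ge0_fin_numE.
by rewrite -muleA -h muleCA -EFinM mulVf ?mule1.
Qed.

Lemma scales_volume_perm (s : 'S_d) : scales_volume (perm_mx s) 1.
Proof. by move=> A mA; rewrite lebesgue_perm// mul1e. Qed.

Lemma scales_volume_diag (D : E) : (forall i, D ord0 i != 0) ->
  scales_volume (diag_mx D) (\prod_i `|D ord0 i|)^-1.
Proof. by move=> D0 A mA; rewrite lebesgue_diag. Qed.

Lemma diag_mxV (D : E) : (forall i, D ord0 i != 0) ->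
  diag_mx D *m diag_mx (\row_i (D ord0 i)^-1) = 1%:M.
Proof.
move=> D0; apply/matrixP => i j; rewrite mul_diag_mx !mxE.
by case: eqVneq => [->|_]; rewrite ?mulr1n ?mulr0n ?mulr0// divff.
Qed.

Lemma scales_volume_conj (D : E) N c : (forall i, D ord0 i != 0) ->
  scales_volume N c ->
  scales_volume (diag_mx D *m N *m diag_mx (\row_i (D ord0 i)^-1)) c.
Proof.
move=> D0 Nc; have D0' i : (\row_i (D ord0 i)^-1) ord0 i != 0.
  by rewrite mxE invr_eq0.
have := scales_volumeM (scales_volumeM (scales_volume_diag D0) Nc)
  (scales_volume_diag D0').
congr scales_volume; rewrite mulrC mulrA -invfM -big_split/= big1 ?invr1 ?mul1r//.
by move=> i _; rewrite mxE -normrM mulVf// normr1.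
Qed.

(** The preimage of the unit cube lies between the cubes of radii [(1 + eta)^-1] and [(1 - eta)^-1].
    Comparing volumes and applying Bernoulli's inequality gives both bounds. *)
Lemma scales_volume_near1 N c eta : 0 < eta < 1 -> 0 <= c ->
  scales_volume N c -> (forall x : E, `|x *m N - x| <= eta * `|x|) ->
  c * (1 - d%:R * eta) <= 1 /\ 1 - d%:R * eta <= c.
Proof.
move=> /andP[e0 e1] c0 Nc h.
have mQ : measurable (ocube 0 1 : set B) by exact: measurable_obox.
have bern : 1 - d%:R * eta <= (1 - eta) ^+ d.
  by apply: bernoulli_sub; rewrite !ltW.
have p0 : 0 < 1 - eta by rewrite subr_gt0.
have q0 : 0 < 1 + eta by rewrite ltr_wpDr// ltW.
have v2 : (0 : R) < 2 ^+ d by rewrite exprn_gt0.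
have := Nc _ mQ; rewrite lebesgue_ocube// mulr1 -EFinM => hQ; split.
  apply: (@le_trans _ _ (c * (1 - eta) ^+ d)); first by rewrite ler_wpM2l.
  suff : (leb [set x : E | ocube 0 1 (x *m N)] <= leb (ocube 0 ((1 - eta)^-1)))%E.
    rewrite hQ lebesgue_ocube ?invr_ge0 ?(ltW p0)// lee_fin exprMn mulrC ler_pM2l//.
    by rewrite exprVn -[X in _ <= X]div1r ler_pdivlMr ?exprn_gt0.
  apply: lebesgue_le.
  - exact: (@measurable_preimage_mulmx N (ocube 0 1)).
  - exact: measurable_obox.
  move=> x /= /ocube0E - /(_ ltr01) xN; apply/ocube0E; first by rewrite invr_gt0.
  rewrite -[X in _ < X]mul1r ltr_pdivlMr// mulrC mulrBl mul1r.
  rewrite ltrBlDr; apply: le_lt_trans (_ : `|x *m N| + `|x *m N - x| < _).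
    by rewrite -{1}(subKr (x *m N) x) ; exact: ler_normB.
  exact: ltr_leD.
apply: (@le_trans _ _ ((1 + eta) ^- d)).
  rewrite -[X in _ <= X]div1r ler_pdivlMr ?exprn_gt0//.
  apply: (@le_trans _ _ ((1 - eta) ^+ d * (1 + eta) ^+ d)).
    by rewrite ler_wpM2r// exprn_ge0// ltW.
  rewrite -exprMn exprn_ile1//; first by rewrite mulr_ge0// ltW.
  have : 0 <= eta * eta by rewrite mulr_ge0// ltW.
  lra.
suff : (leb (ocube 0 ((1 + eta)^-1)) <= leb [set x : E | ocube 0 1 (x *m N)])%E.
  rewrite hQ lebesgue_ocube ?invr_ge0 ?(ltW q0)// lee_fin exprMn mulrC ler_pM2r//.
  by rewrite exprVn.
apply: lebesgue_le.
- exact: measurable_obox.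
- exact: (@measurable_preimage_mulmx N (ocube 0 1)).
move=> x /= /ocube0E; rewrite invr_gt0 => /(_ q0).
rewrite -[X in _ < X]mul1r ltr_pdivlMr// mulrC mulrDl mul1r => xN.
apply/ocube0E => //; apply: le_lt_trans xN.
by rewrite -{1}(subrK x (x *m N)) addrC; apply: le_trans (ler_normD _ _) _; rewrite lerD2l.
Qed.

(* Conjugating by [diag (t ^ w i)] with [t] large brings [N] close to the
   identity, and leaves the volume factor unchanged. *)
Lemma scales_volume_unipotent N (w : 'I_d -> nat) : N \in unitmx ->
  (forall i, N i i = 1) -> (forall i j, i != j -> N i j != 0 -> (w i < w j)%N) ->
  scales_volume N 1.
Proof.
move=> uN N1 Nw; have [c c0 Nc] := scales_volume_exists uN.
suff near eta : 0 < eta < 1 ->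
    c * (1 - d%:R * eta) <= 1 /\ 1 - d%:R * eta <= c.
  suff -> : 1 = c by [].
  have hd : 0 < 1 + d%:R * (c + 1) by rewrite ltr_wpDr// mulr_ge0// addr_ge0.
  (* This [eta] makes both errors, [d c eta] and [d eta], at most [e]. *)
  have key e : 0 < e -> exists2 eta : R, 0 < eta < 1 & d%:R * (c + 1) * eta <= e.
    move=> e0; exists (Num.min (1/2) (e / (1 + d%:R * (c + 1)))).
      by rewrite lt_min divr_gt0//= divr_gt0// gt_min; apply/orP; left; lra.
    apply: (@le_trans _ _ (d%:R * (c + 1) * (e / (1 + d%:R * (c + 1))))).
      by rewrite ler_wpM2l ?mulr_ge0 ?addr_ge0// ge_min lexx orbT.
    rewrite mulrCA ler_piMr ?(ltW e0)// ler_pdivrMr// mul1r; lra.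
  apply/eqP; rewrite eq_le; apply/andP; split; apply/ler_addgt0Pr => e /key[eta he le].
    have [_ ] := near _ he; have : 0 <= d%:R * c * eta.
      by rewrite !mulr_ge0//; case/andP : he => /ltW.
    lra.
  have [+ _] := near _ he; have : 0 <= d%:R * eta.
      by rewrite !mulr_ge0//; case/andP : he => /ltW.
  lra.
move=> he; have /andP[e0 e1] := he.
pose m : R := \sum_i \sum_j `|N i j|.
have m0 : 0 <= m by rewrite sumr_ge0// => i _; rewrite sumr_ge0.
have mN i j : `|N i j| <= m.
  rewrite /m (bigD1 i)//= (bigD1 j)//= -addrA lerDl addr_ge0 ?sumr_ge0//.
  by move=> l _; rewrite sumr_ge0.
(* Conjugation multiplies the entry [(i, j)] by [t ^ (w i) / t ^ (w j)], which is at most [1 / t] at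
   nonzero off-diagonal entries; this [t] gives [d m / t <= eta]. *)
pose t : R := 1 + d%:R * m / eta.
have t0 : 0 < t by rewrite ltr_wpDr// divr_ge0 ?mulr_ge0// ltW.
pose D : E := \row_i t ^+ w i.
have D0 i : D ord0 i != 0 by rewrite mxE expf_neq0// gt_eqF.
apply: (@scales_volume_near1 _ c eta he c0 (scales_volume_conj D0 Nc)) => x.
rewrite -[X in _ - X]mulmx1 -mulmxBr.
apply: (@le_trans _ _ (d%:R * (m / t) * `|x|)).
  apply: norm_mulmx_le => i j.
  rewrite mul_mx_diag mul_diag_mx !mxE.
  case: (eqVneq i j) => [<-|ij].
    by rewrite N1 mulr1 divff ?expf_neq0 ?gt_eqF// subrr normr0 divr_ge0// ltW.
  rewrite subr0 mulrAC normrM.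
  have [->|Nij] := eqVneq (N i j) 0; first by rewrite normr0 mulr0 divr_ge0// ltW.
  rewrite mulrC ler_pM// normrM normfV !ger0_norm ?exprn_ge0 ?(ltW t0)//.
  have t1 : 1 <= t by rewrite lerDl divr_ge0 ?mulr_ge0// ltW.
  rewrite ler_pdivrMr ?exprn_gt0// mulrC ler_pdivlMr// -exprSr.
  by rewrite ler_weXn2l// Nw.
rewrite ler_wpM2r// mulrA ler_pdivrMr// /t mulrDr mulr1 mulrCA divff ?mulr1 ?gt_eqF//.
by rewrite lerDr ltW.
Qed.

End LebesgueLinear.

(** The LUP decomposition, with [U] split as a diagonal matrix times a unitriangular one, reduces
    [N] to matrices of known factor: permutations and unitriangular matrices preserve volume, and
    the diagonal part carries the determinant. *)
Lemma scales_volume_det (R : realType) d (N : 'M[R]_d) : N \in unitmx ->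
  scales_volume N `|\det N|^-1.
Proof.
case: d N => [|n] N uN.
  have -> : N = 1%:M by apply/matrixP => -[].
  by rewrite det1 normr1 invr1; exact: scales_volume1.
have := cormen_lup_correct N; have := cormen_lup_perm N; have := cormen_lup_detL N.
have := @cormen_lup_lower _ _ N; have := @cormen_lup_upper _ _ N.
case: cormen_lup => [[P L] U] /= hU hL dL pP PN.
have /is_perm_mxP[s Ps] := pP.
have {}PN : perm_mx s *m N = L *m U by rewrite -Ps.
have dU : \det U = \prod_i U i i.
  rewrite -det_tr det_trig; last first.
    by apply/is_trig_mxP => i j ij; rewrite mxE hU.
  by apply: eq_bigr => i _; rewrite mxE.
have dN : `|\det N| = \prod_i `|U i i|.
  have : \det (perm_mx s *m N) = \det (L *m U) by rewrite PN.
  rewrite !det_mulmx det_perm dL mul1r dU => h.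
  by rewrite -normr_prod -h normrM normrX normrN1 expr1n mul1r.
have U0 i : U i i != 0.
  have : `|\det N| != 0 by rewrite normr_eq0 -unitfE -unitmxE.
  by rewrite dN => /prodf_neq0 /(_ i isT); rewrite normr_eq0.
pose D : 'rV[R]_n.+1 := \row_i U i i.
have D0 i : D ord0 i != 0 by rewrite mxE.
pose V := diag_mx (\row_i (D ord0 i)^-1) *m U.
have UV : U = diag_mx D *m V by rewrite mulmxA diag_mxV// mul1mx.
(* The weights have to increase along nonzero off-diagonal entries: [n - i] does so below the
   diagonal, and [i] does so above it for [V]. *)
have sL : scales_volume L 1.
  apply: (@scales_volume_unipotent R n.+1 L (fun i => n - i)%N).
  - by rewrite unitmxE dL unitr1.
  - by move=> i; rewrite hL ?eqxx.
  move=> i j ij; case: (leqP i j) => [lij|lij _].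
    by rewrite hL// (negbTE ij) eqxx.
  by rewrite ltn_sub2l// (leq_trans lij)// -ltnS.
have sV : scales_volume V 1.
  apply: (@scales_volume_unipotent R n.+1 V (fun i => i)).
  - rewrite unitmxE /V det_mulmx dU det_diag -big_split/= unitfE.
    by apply/prodf_neq0 => i _; rewrite !mxE mulVf ?oner_neq0.
  - by move=> i; rewrite /V mul_diag_mx !mxE mulVf.
  move=> i j ij; rewrite /V mul_diag_mx !mxE; case: (ltngtP i j) => // lij.
    by rewrite (hU i j lij) mulr0 eqxx.
  by move/ord_inj : lij ij => ->; rewrite eqxx.
have -> : N = perm_mx s^-1%g *m (L *m (diag_mx D *m V)).
  by rewrite -UV -PN mulmxA -perm_mxM mulVg perm_mx1 mul1mx.
have := scales_volumeM (@scales_volume_perm R n.+1 s^-1%g)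
  (scales_volumeM sL (scales_volumeM (scales_volume_diag D0) sV)).
congr scales_volume; rewrite !mul1r mulr1 -UV -PN mulmxA -perm_mxM mulVg perm_mx1 mul1mx.
by rewrite dN; congr (_^-1); apply: eq_bigr => i _; rewrite mxE.
Qed.

(** * Positive contractions and translations *)

Section PositiveContraction.
(** [P] will be [Ccr], [q] the inner product [ip] and [S] a normalised Gram operator. Functional
    calculus for [S] is replaced by telescoping sums. *)
Variables (R : realFieldType) (V : zmodType) (P : V -> Prop) (q : V -> V -> R).
Variable S : V -> V.
Hypothesis PB : forall u v, P u -> P v -> P (u - v).
Hypothesis PS : forall u, P u -> P (S u).
Hypothesis qB : forall u v w, P u -> P v -> P w -> q (u - v) w = q u w - q v w.
Hypothesis qC : forall u v, q u v = q v u.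
Hypothesis SB : forall u v, S (u - v) = S u - S v.
Hypothesis SA : forall u v, P u -> P v -> q (S u) v = q u (S v).
Hypothesis q0 : forall u, P u -> 0 <= q u u.
Hypothesis S0 : forall u, P u -> 0 <= q (S u) u.
Hypothesis S1 : forall u, P u -> q (S u) u <= q u u.

Definition contr (u : V) : V := u - S u.

Let PT u : P u -> P (contr u).
Proof. by move=> Pu; apply: PB => //; exact: PS. Qed.

Lemma iter_contr_closed m u : P u -> P (iter m contr u).
Proof. by move=> Pu; elim: m => //= m ih; exact: PT. Qed.

Let qBr u v w : P u -> P v -> P w -> q w (u - v) = q w u - q w v.
Proof. by move=> Pu Pv Pw; rewrite qC qB// !(qC w). Qed.

Let TA u v : P u -> P v -> q (contr u) v = q u (contr v).
Proof.
by move=> Pu Pv; rewrite /contr qB ?qBr ?SA//; exact: PS.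
Qed.

Let TnA m u v : P u -> P v -> q (iter m contr u) v = q u (iter m contr v).
Proof.
elim: m u v => //= m ih u v Pu Pv.
rewrite TA//; last exact: iter_contr_closed.
by rewrite ih//; [rewrite -iterS iterSr|exact: PT].
Qed.

Let ST u : S (contr u) = contr (S u).
Proof. by rewrite /contr SB. Qed.

Let STn m u : S (iter m contr u) = iter m contr (S u).
Proof. by elim: m => //= m ih; rewrite ST ih. Qed.

Let T0 u : P u -> 0 <= q (contr u) u.
Proof. by move=> Pu; rewrite /contr qB ?subr_ge0 ?S1//; exact: PS. Qed.

Let evenT m u : P u -> q (iter m.*2 contr u) u = q (iter m contr u) (iter m contr u).
Proof.
by move=> Pu; rewrite -addnn iterD TnA//; exact: iter_contr_closed.
Qed.

(** An even power of the self-adjoint [1 - S] is a square; an odd power is [1 - S] between two equal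
    powers, hence positive by [T0]. *)
Let Tn0 m u : P u -> 0 <= q (iter m contr u) u.
Proof.
move=> Pu; have Ph := iter_contr_closed m./2 Pu.
rewrite -(odd_double_half m); case: odd => /=; last first.
  by rewrite add0n evenT//; exact: q0.
change (0 <= q (iter (m./2.*2).+1 contr u) u).
rewrite -addnn -addnS iterD (@TnA m./2)//.
  exact: (T0 Ph).
exact: (PT Ph).
Qed.

Let step m u : iter m contr u - iter m.+1 contr u = S (iter m contr u).
Proof. by rewrite iterS /contr subKr. Qed.

Let c u m := q (S (iter m contr u)) u.

(** With [T = 1 - S], the difference of consecutive terms is [q (T^m (S u)) (S u)], which is
    nonnegative by [Tn0]. *)
Let c_decr u m : P u -> c u m.+1 <= c u m.
Proof.
move=> Pu; have PSu := PS Pu; have Pm := iter_contr_closed m Pu.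
have Pm1 := iter_contr_closed m.+1 Pu.
rewrite -subr_ge0 /c -qB//; try exact: PS.
rewrite -SB step SA//; last exact: PS.
by rewrite STn; exact: Tn0.
Qed.

Let c_mono u m n : P u -> (m <= n)%N -> c u n <= c u m.
Proof.
move=> Pu /subnK <-; elim: (n - m)%N => //= k ih.
by apply: le_trans ih; rewrite addSn; exact: c_decr.
Qed.

Let c_sum u n : P u -> \sum_(k < n) c u k = q u u - q (iter n contr u) u.
Proof.
move=> Pu; elim: n => [|n ih]; first by rewrite big_ord0 subrr.
have Pn := iter_contr_closed n Pu; have Pn1 := iter_contr_closed n.+1 Pu.
by rewrite big_ord_recr/= ih /c -step qB// addrA subrK.
Qed.

(* Operator form of x (1 - x)^(2 m) <= 1 / (2 m + 1) on [0, 1]. *)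
Lemma contr_decay m u : P u ->
  (m.*2.+1)%:R * q (S (iter m contr u)) (iter m contr u) <= q u u.
Proof.
move=> Pu; have Pm := iter_contr_closed m Pu.
have -> : q (S (iter m contr u)) (iter m contr u) = c u m.*2.
  by rewrite /c -addnn iterD [in RHS]STn TnA//; exact: PS.
(* The terms decrease, so the last of these [2 m + 1] terms is at most their mean; their sum
   telescopes to at most [q u u]. *)
apply: (@le_trans _ _ (\sum_(k < m.*2.+1) c u k)).
  rewrite -[X in X%:R]card_ord mulr_natl -sumr_const; apply: ler_sum => k _.
  by apply: c_mono => //; rewrite -ltnS.
by rewrite c_sum// lerBlDr lerDl; exact: Tn0.
Qed.

(** With [T = 1 - S], the defect [q u u - q (T^(2 m) u) u] is the sum of the [c u k] for [k < 2 m].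
    Each is at least [c u (2 k)], which equals [q (S x) x] for [x = T^k u] and so is nonnegative. *)
Lemma contr_norm_le m u : P u -> q (iter m contr u) (iter m contr u) <= q u u.
Proof.
move=> Pu; rewrite -evenT//; have := c_sum m.*2 Pu => h.
have : 0 <= \sum_(k < m.*2) c u k.
  apply: sumr_ge0 => k _; apply: (@le_trans _ _ (c u k.*2)).
    rewrite /c -addnn iterD STn TnA//; last by apply: PS; exact: iter_contr_closed.
    by apply: S0; exact: iter_contr_closed.
  by apply: c_mono => //; rewrite -[X in (_ <= X)%N]addnn leq_addr.
by rewrite h subr_ge0.
Qed.

End PositiveContraction.

Lemma integrable_indic_lty dT (T : measurableType dT) (R : realType)
    (m : {measure set T -> \bar R}) (A : set T) : measurable A -> (m A < +oo)%E ->
  m.-integrable setT (fun x => (\1_A x)%:E).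
Proof.
move=> mA mAoo; apply/integrableP; split.
  by apply/measurable_EFinP; exact: measurable_indic.
rewrite (eq_integral (fun x => (\1_A x)%:E)) ?integral_indic_set//.
by move=> x _; rewrite gee0_abs// lee_fin.
Qed.

(** * Compactly supported real functions, their inner product and sums of translations *)

Section CompactlySupported.
Variables (R : realType) (d : nat).
Local Notation E := 'rV[R]_d.
Local Notation B := (borelRd R d).
Local Notation leb := (@lebesgue_Rd R d).
Implicit Types (u v w : E -> R) (s t x y : E) (l : seq E).

(* The bound [c] is kept with the support bound [k] so that closure under the
   operations below needs no compactness argument. *)
Definition Ccr u : Prop := continuous u /\
  exists k c : R, forall x, `|u x| <= c /\ (k < `|x| -> u x = 0).

Lemma Ccr0 : Ccr (fun=> 0).
Proof.
split; first by move=> x; exact: cst_continuous.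
by exists 0, 0 => x; rewrite normr0.
Qed.

Lemma CcrD u v : Ccr u -> Ccr v -> Ccr (fun x => u x + v x).
Proof.
move=> [cu [k [c h]]] [cv [k' [c' h']]]; split.
  by move=> x; apply: continuousD; [exact: cu|exact: cv].
exists (Num.max k k'), (c + c') => x; split.
  by apply: le_trans (ler_normD _ _) _; rewrite lerD// ?(h x).1 ?(h' x).1.
by rewrite gt_max => /andP[h1 h2]; rewrite (h x).2// (h' x).2// addr0.
Qed.

Lemma CcrM u w (c' : R) : Ccr u -> continuous w -> (forall x, `|w x| <= c') ->
  Ccr (fun x => u x * w x).
Proof.
move=> [cu [k [c h]]] cw h'; split.
  by move=> x; apply: continuousM; [exact: cu|exact: cw].
exists k, (c * c') => x; split.
  by rewrite normrM ler_pM// (h x).1.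
by move=> kx; rewrite (h x).2// mul0r.
Qed.

Lemma Ccr_mul u v : Ccr u -> Ccr v -> Ccr (fun x => u x * v x).
Proof. by move=> Cu [cv [k [c h]]]; apply: (CcrM Cu cv (c' := c)) => x; exact: (h x).1. Qed.

Lemma CcrZ a u : Ccr u -> Ccr (fun x => a * u x).
Proof.
move=> Cu; rewrite (_ : (fun _ => _) = fun x => u x * cst a x).
  apply: (@CcrM u (cst a) `|a|) => // x; first exact: cst_continuous.
by apply/funext => x; rewrite mulrC.
Qed.

Lemma CcrB u v : Ccr u -> Ccr v -> Ccr (u - v).
Proof.
move=> Cu Cv; rewrite (_ : u - v = fun x => u x + (-1) * v x).
  by apply: CcrD => //; exact: CcrZ.
by apply/funext => x; rewrite mulN1r.
Qed.

Lemma Ccr_sum (J : Type) (r : seq J) (F : J -> E -> R) :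
  (forall j, Ccr (F j)) -> Ccr (fun x => \sum_(j <- r) F j x).
Proof.
move=> h; elim: r => [|j r ih].
  by rewrite (_ : (fun _ => _) = fun=> 0); [exact: Ccr0|apply/funext => x; rewrite big_nil].
rewrite (_ : (fun _ => _) = fun x => F j x + \sum_(j <- r) F j x); first exact: CcrD.
by apply/funext => x; rewrite big_cons.
Qed.

Lemma Ccr_shift s u : Ccr u -> Ccr (fun x => u (x - s)).
Proof.
move=> [cu [k [c h]]]; split.
  move=> x; apply: (@continuous_comp _ _ _ (fun x => x - s) u); last exact: cu.
  by apply: continuousB; [exact: id|exact: cst_continuous].
exists (k + `|s|), c => x; split; first exact: (h _).1.
move=> kx; apply: (h _).2; rewrite -ltrBrDr in kx.
by apply: lt_le_trans kx _; exact: lerB_dist.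
Qed.

Lemma Ccr_rev s u : Ccr u -> Ccr (fun x => u (s - x)).
Proof.
move=> [cu [k [c h]]]; split.
  move=> x; apply: (@continuous_comp _ _ _ (fun x => s - x) u); last exact: cu.
  by apply: continuousB; [exact: cst_continuous|exact: id].
exists (k + `|s|), c => x; split; first exact: (h _).1.
move=> kx; apply: (h _).2; rewrite -ltrBrDr in kx.
by rewrite distrC; apply: lt_le_trans kx _; exact: lerB_dist.
Qed.

Lemma Ccr_measurable u : Ccr u -> measurable_fun setT (u : B -> measurableTypeR R).
Proof. by case=> cu _; exact: borelRd_measurable_continuous. Qed.

Lemma Ccr_integrable u : Ccr u -> leb.-integrable setT (EFin \o u).
Proof.
move=> Cu; have mu := Ccr_measurable Cu; case: Cu => _ [k [c h]].
pose K : set E := ocube 0 (`|k| + 1).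
have mK : measurable (K : set B) by exact: measurable_obox.
have k1 : 0 < `|k| + 1 by rewrite ltr_wpDl.
apply: (@le_integrable _ _ _ leb setT measurableT _ (fun x => c%:E * (\1_K x)%:E)%E).
- by apply/measurable_EFinP.
- move=> x _; rewrite /= lee_fin indicE.
  have [Kx|Kx] := pselect (K x).
    by rewrite mem_set// mulr1 (le_trans (h x).1)// ler_norm.
  rewrite memNset// mulr0 (h x).2 ?normr0//; apply: contrapT => /negP.
  rewrite -leNgt => xk; apply: Kx; apply/ocube0E => //.
  by apply: le_lt_trans xk _; rewrite (le_lt_trans (ler_norm _))// ltrDl.
apply: integrableZl => //; apply: integrable_indic_lty => //.
by have := lebesgue_obox_lty (0 - const_mx (`|k| + 1)) (0 + const_mx (`|k| + 1) : E).
Qed.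

Definition rint u : R := \int[leb]_(x in setT) u x.

Lemma rintD u v : Ccr u -> Ccr v -> rint (fun x => u x + v x) = rint u + rint v.
Proof. by move=> Cu Cv; apply: RintegralD => //; exact: Ccr_integrable. Qed.

Lemma rintZ a u : Ccr u -> rint (fun x => a * u x) = a * rint u.
Proof. by move=> Cu; apply: RintegralZl => //; exact: Ccr_integrable. Qed.

Lemma rint0 : rint (fun=> 0) = 0.
Proof. by rewrite /rint Rintegral_cst// mul0r. Qed.

Lemma rint_sum (J : Type) (r : seq J) (F : J -> E -> R) :
  (forall j, Ccr (F j)) ->
  rint (fun x => \sum_(j <- r) F j x) = \sum_(j <- r) rint (F j).
Proof.
move=> h; elim: r => [|j r ih].
  rewrite big_nil -[RHS]rint0; congr rint; apply/funext => x; exact: big_nil.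
rewrite big_cons -ih -rintD//; last exact: Ccr_sum.
by congr rint; apply/funext => x; rewrite big_cons.
Qed.

Lemma rint_le u v : Ccr u -> Ccr v -> (forall x, u x <= v x) -> rint u <= rint v.
Proof. by move=> Cu Cv h; apply: le_Rintegral => //; exact: Ccr_integrable. Qed.

Lemma rint_ge0 u : (forall x, 0 <= u x) -> 0 <= rint u.
Proof. by move=> h; apply: Rintegral_ge0. Qed.

Lemma rint_comp (phi : E -> E) u : Ccr u -> Ccr (u \o phi) ->
  measurable_fun setT (phi : B -> B) ->
  (forall A : set B, measurable A -> leb (phi @^-1` A) = leb A) ->
  rint (u \o phi) = rint u.
Proof.
move=> Cu Cup mphi hphi; rewrite /rint /Rintegral; congr fine.
have := @integral_pushforward _ _ B B R phi mphi leb setT (EFin \o u).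
rewrite preimage_setT => <-//.
- by apply: eq_measure_integral => A mA _; exact: hphi.
- by apply/measurable_EFinP; exact: Ccr_measurable.
- exact: (Ccr_integrable Cup).
Qed.

Lemma rint_shift s u : Ccr u -> rint (fun x => u (x - s)) = rint u.
Proof.
move=> Cu; apply: (@rint_comp (fun x => x - s)) => //; first exact: Ccr_shift.
  exact: measurable_fun_addE.
by move=> A mA; exact: lebesgue_shift.
Qed.

Lemma rint_rev s u : Ccr u -> rint (fun x => u (s - x)) = rint u.
Proof.
move=> Cu; apply: (@rint_comp (fun x => s - x)) => //; first exact: Ccr_rev.
  by apply: measurable_fun_addE => //; exact: measurable_fun_oppE.
by move=> A mA; exact: lebesgue_rev.
Qed.

Definition ip u v : R := rint (fun x => u x * v x).

Lemma ipC u v : ip u v = ip v u.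
Proof. by congr rint; apply/funext => x; rewrite mulrC. Qed.

Lemma ip_ge0 u : 0 <= ip u u.
Proof. by apply: rint_ge0 => x; rewrite -expr2 sqr_ge0. Qed.

Lemma ipD u v w : Ccr u -> Ccr v -> Ccr w ->
  ip (fun x => u x + v x) w = ip u w + ip v w.
Proof.
move=> Cu Cv Cw; rewrite /ip -rintD//; try exact: Ccr_mul.
by congr rint; apply/funext => x; rewrite mulrDl.
Qed.

Lemma ipZ a u w : Ccr u -> Ccr w -> ip (fun x => a * u x) w = a * ip u w.
Proof.
move=> Cu Cw; rewrite /ip -rintZ//; last exact: Ccr_mul.
by congr rint; apply/funext => x; rewrite mulrA.
Qed.

Lemma ipB u v w : Ccr u -> Ccr v -> Ccr w -> ip (u - v) w = ip u w - ip v w.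
Proof.
move=> Cu Cv Cw; rewrite -[in RHS]mulN1r -ipZ// -ipD//; last exact: CcrZ.
by congr (ip _ w); apply/funext => x; rewrite mulN1r.
Qed.

Lemma ip_suml (J : Type) (r : seq J) (F : J -> E -> R) w :
  (forall j, Ccr (F j)) -> Ccr w ->
  ip (fun x => \sum_(j <- r) F j x) w = \sum_(j <- r) ip (F j) w.
Proof.
move=> h Cw; rewrite /ip -rint_sum; last by move=> j; exact: Ccr_mul.
by congr rint; apply/funext => x; rewrite mulr_suml.
Qed.

Lemma ip_sumr (J : Type) (r : seq J) (F : J -> E -> R) w :
  (forall j, Ccr (F j)) -> Ccr w ->
  ip w (fun x => \sum_(j <- r) F j x) = \sum_(j <- r) ip w (F j).
Proof. by move=> h Cw; rewrite ipC ip_suml//; apply: eq_bigr => j _; rewrite ipC. Qed.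

(** Cauchy-Schwarz by induction: the cross term of the step is controlled by the square of
    [n * a j - S]. *)
Lemma sqr_sum_le (J : Type) (r : seq J) (a : J -> R) :
  (\sum_(j <- r) a j) ^+ 2 <= (size r)%:R * \sum_(j <- r) a j ^+ 2.
Proof.
elim: r => [|j r ih]; first by rewrite !big_nil expr0n mulr0.
rewrite !big_cons /= -natr1; set S := \sum_(_ <- r) _ in ih *.
set Q := \sum_(_ <- r) _ in ih *; set n : R := _%:R in ih *.
have Q0 : 0 <= Q by apply: sumr_ge0 => i _; exact: sqr_ge0.
have [n0|n0] : n = 0 \/ 0 < n.
  by have := ler0n R (size r); rewrite le_eqVlt -/n => /orP[/eqP|]; [left|right].
  have S0 : S = 0 by apply/eqP; rewrite -sqrf_eq0 eq_le sqr_ge0 andbT; move: ih; rewrite n0 mul0r.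
  by rewrite S0 n0 addr0 add0r mul1r lerDl.
suff : 2 * a j * S <= n * a j ^+ 2 + Q by move: ih; rewrite !expr2; lra.
rewrite -(ler_pM2l n0); have := sqr_ge0 (n * a j - S); move: ih; rewrite !expr2; lra.
Qed.

Lemma sumr_const_seq (J : Type) (r : seq J) (c : R) :
  \sum_(j <- r) c = (size r)%:R * c.
Proof. by rewrite big_const_seq count_predT iter_addr addr0 mulr_natl. Qed.

Lemma ip_sum_le (J : Type) (r : seq J) (F : J -> E -> R) :
  (forall j, Ccr (F j)) ->
  ip (fun x => \sum_(j <- r) F j x) (fun x => \sum_(j <- r) F j x) <=
  (size r)%:R * \sum_(j <- r) ip (F j) (F j).
Proof.
move=> h; rewrite /ip -rint_sum; last by move=> j; exact: Ccr_mul.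
have hs : Ccr (fun x => \sum_(j <- r) F j x * F j x).
  by apply: Ccr_sum => j; exact: Ccr_mul.
rewrite -rintZ//; apply: rint_le; first by apply: Ccr_mul; exact: Ccr_sum.
  exact: CcrZ.
by move=> x; rewrite -expr2; apply: sqr_sum_le.
Qed.

(** Convolution with the comb of unit masses at the points of [l], counted with multiplicity. *)
Definition ops l u : E -> R := fun x => \sum_(s <- l) u (x - s).

Lemma Ccr_ops l u : Ccr u -> Ccr (ops l u).
Proof. by move=> Cu; apply: Ccr_sum => s; exact: Ccr_shift. Qed.

Lemma ip_shift s t u v : Ccr u -> Ccr v ->
  ip (fun x => u (x - s)) (fun x => v (x - t)) = ip (fun x => u (x - (s - t))) v.
Proof.
move=> Cu Cv; rewrite /ip -[RHS](rint_shift t); last first.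
  by apply: Ccr_mul => //; exact: Ccr_shift.
by congr rint; apply/funext => x; congr (u _ * _); rewrite opprB addrA subrK.
Qed.

Lemma ops_adj l u v : Ccr u -> Ccr v ->
  ip (ops l u) v = ip u (ops (map -%R l) v).
Proof.
move=> Cu Cv; rewrite /ops ip_suml//; last by move=> s; exact: Ccr_shift.
rewrite ip_sumr//; last by move=> s; exact: Ccr_shift.
rewrite big_map; apply: eq_bigr => s _; rewrite [RHS]ipC.
rewrite -[LHS](rint_shift (- s)); last by apply: Ccr_mul => //; exact: Ccr_shift.
by congr rint; apply/funext => x; rewrite opprK addrK mulrC.
Qed.

Lemma ops_comm l l' u : ops l (ops l' u) = ops l' (ops l u).
Proof.
apply/funext => x; rewrite /ops exchange_big/=; apply: eq_bigr => s _.
by apply: eq_bigr => t _; rewrite addrAC.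
Qed.

Lemma opsB l u v : ops l (u - v) = ops l u - ops l v.
Proof. by apply/funext => x; rewrite /ops -[RHS]sumrB. Qed.

Lemma opsZ l a u : ops l (fun x => a * u x) = fun x => a * ops l u x.
Proof. by apply/funext => x; rewrite /ops mulr_sumr. Qed.

Lemma ip_ops_le l u : Ccr u ->
  ip (ops l u) (ops l u) <= (size l)%:R ^+ 2 * ip u u.
Proof.
move=> Cu; apply: le_trans (ip_sum_le _ _) _; first by move=> s; exact: Ccr_shift.
rewrite expr2 -mulrA ler_wpM2l//.
rewrite (eq_bigr (fun=> ip u u)) ?sumr_const_seq//.
move=> s _; rewrite ip_shift// subrr; congr ip; apply/funext => x; by rewrite subr0.
Qed.

(** Translates by distinct points of [l] have disjoint supports, so only the diagonal terms survive.
    The factor is [size l] instead of the [size l ^ 2] of [ip_ops_le]; this gain turns counting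
    bounds into norm bounds of the right order. *)
Lemma ip_ops_separated l u (r : R) : Ccr u -> uniq l ->
  (forall x, u x != 0 -> `|x| < r) ->
  (forall s t, s \in l -> t \in l -> s != t -> 2 * r <= `|s - t|) ->
  ip (ops l u) (ops l u) = (size l)%:R * ip u u.
Proof.
move=> Cu ul hr sep.
rewrite /ops ip_suml//; last by apply: Ccr_ops.
  transitivity (\sum_(s <- l) ip u u); last first.
    exact: sumr_const_seq.
  apply: eq_big_seq => s sl; rewrite ip_sumr; last exact: Ccr_shift.
    rewrite (bigD1_seq s)//= big1_seq ?addr0.
      by rewrite ip_shift// subrr; congr ip; apply/funext => x; rewrite subr0.
    move=> t /andP[ts tl]; rewrite -[RHS]rint0; congr rint; apply/funext => x.
    apply/eqP; rewrite mulf_eq0; apply/norP => -[/hr xs /hr xt].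
    have := sep s t sl tl; rewrite eq_sym => /(_ ts); apply/negP; rewrite -ltNge.
    rewrite (_ : s - t = (x - t) - (x - s)); last by rewrite opprB addrCA addrAC subrr add0r.
    by apply: le_lt_trans (ler_normB _ _) _; lra.
  by move=> t; exact: Ccr_shift.
by move=> t; exact: Ccr_shift.
Qed.

(* [ops (map -%R l)] is the adjoint of [ops l], so [gram k Ds] is positive and
   self-adjoint for [0 <= k]; on the Fourier side it is multiplication by
   [k * \sum_l `|csum l t| ^ 2]. *)
Definition gram (k : R) (Ds : seq (seq E)) u : E -> R :=
  fun x => k * \sum_(l <- Ds) ops (map -%R l) (ops l u) x.

Lemma Ccr_gram k Ds u : Ccr u -> Ccr (gram k Ds u).
Proof.
by move=> Cu; apply: CcrZ; apply: Ccr_sum => l; apply: Ccr_ops; exact: Ccr_ops.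
Qed.

Lemma gramB k Ds u v : gram k Ds (u - v) = gram k Ds u - gram k Ds v.
Proof.
apply/funext => x; rewrite /gram -[RHS]/(_ - _) -mulrBr -sumrB; congr (_ * _).
by apply: eq_bigr => l _; rewrite !opsB.
Qed.

Lemma ops_gram l k Ds u : ops l (gram k Ds u) = gram k Ds (ops l u).
Proof.
rewrite /gram opsZ; apply/funext => x; congr (_ * _).
rewrite /ops exchange_big/=; apply: eq_bigr => l' _.
rewrite -[LHS]/(ops l (ops (map -%R l') (ops l' u)) x) ops_comm.
by rewrite (ops_comm l l').
Qed.

(** Combinations of translations commute. Smoothing a comb by the filtered bump is thus the same as
    filtering the comb smoothed by the bump. *)
Lemma ops_contr l k Ds m u :
  ops l (iter m (contr (gram k Ds)) u) = iter m (contr (gram k Ds)) (ops l u).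
Proof. by elim: m => //= m ih; rewrite /contr opsB ops_gram ih. Qed.

Lemma ip_gram k Ds u v : Ccr u -> Ccr v ->
  ip (gram k Ds u) v = k * \sum_(l <- Ds) ip (ops l u) (ops l v).
Proof.
move=> Cu Cv; rewrite /gram ipZ//; last first.
  by apply: Ccr_sum => l; apply: Ccr_ops; exact: Ccr_ops.
rewrite ip_suml//; last by move=> l; apply: Ccr_ops; exact: Ccr_ops.
congr (_ * _); apply: eq_bigr => l _.
rewrite ops_adj//; last exact: Ccr_ops.
by rewrite -map_comp (eq_map (@opprK _)) map_id.
Qed.

Section bounds.
Variables (Ds : seq (seq E)) (M : R).
Hypothesis M0 : 0 < M.
(** As [ops l] has norm at most [size l], this normalisation yields [0 <= S <= 1]. *)
Hypothesis DM : \sum_(l <- Ds) (size l)%:R ^+ 2 <= M.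
Let S := gram M^-1 Ds.

Let Mi0 : 0 <= M^-1. Proof. by rewrite invr_ge0 ltW. Qed.

Let S0 u : Ccr u -> 0 <= ip (S u) u.
Proof.
by move=> Cu; rewrite ip_gram// mulr_ge0// sumr_ge0// => l _; exact: ip_ge0.
Qed.

Let S1 u : Ccr u -> ip (S u) u <= ip u u.
Proof.
move=> Cu; rewrite ip_gram// mulrC ler_pdivrMr//.
apply: (@le_trans _ _ (\sum_(l <- Ds) (size l)%:R ^+ 2 * ip u u)).
  by apply: ler_sum => l _; exact: ip_ops_le.
by rewrite -mulr_suml mulrC ler_wpM2l ?ip_ge0.
Qed.

Let SA u v : Ccr u -> Ccr v -> ip (S u) v = ip u (S v).
Proof.
move=> Cu Cv; rewrite [RHS]ipC !ip_gram//; congr (_ * _).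
by apply: eq_bigr => l _; rewrite ipC.
Qed.

Lemma Ccr_contr m u : Ccr u -> Ccr (iter m (contr S) u).
Proof.
by apply: iter_contr_closed => [? ? ? ?|? ?]; [exact: CcrB|exact: Ccr_gram].
Qed.

(** The squared norm of [ops l x] is one of the nonnegative summands of [M * ip (S x) x], and
    [contr_decay] bounds the whole. *)
Lemma ip_ops_contr m u l : Ccr u -> l \in Ds ->
  (m.*2.+1)%:R * ip (ops l (iter m (contr S) u)) (ops l (iter m (contr S) u)) <=
  M * ip u u.
Proof.
move=> Cu lDs; have Cm := Ccr_contr m Cu.
apply: (@le_trans _ _ (m.*2.+1%:R * (M * ip (S (iter m (contr S) u)) (iter m (contr S) u)))).
  rewrite ler_wpM2l// ip_gram// mulrA divff ?gt_eqF// mul1r.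
  rewrite (big_rem l)//= lerDl sumr_ge0// => l' _; exact: ip_ge0.
rewrite mulrCA ler_wpM2l ?(ltW M0)//.
apply: (@contr_decay _ _ Ccr ip S) => //.
- exact: CcrB.
- by move=> v; exact: Ccr_gram.
- exact: ipB.
- exact: ipC.
- exact: gramB.
- by move=> v _; exact: ip_ge0.
Qed.

Lemma ip_contr_le m u : Ccr u ->
  ip (iter m (contr S) u) (iter m (contr S) u) <= ip u u.
Proof.
move=> Cu; apply: (@contr_norm_le _ _ Ccr ip S) => //.
- exact: CcrB.
- by move=> v; exact: Ccr_gram.
- exact: ipB.
- exact: ipC.
- exact: gramB.
- by move=> v _; exact: ip_ge0.
Qed.
End bounds.

End CompactlySupported.

(** * Fourier transforms and the diffraction measure *)

Section FourierSide.
Variables (R : realType) (d : nat).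
Local Notation E := 'rV[R]_d.
Local Notation B := (borelRd R d).
Local Notation leb := (@lebesgue_Rd R d).
Local Notation C := R[i].
Implicit Types (u v w : E -> R) (s t x y : E) (l : seq E).

Lemma dotpDl x y t : dotp (x + y) t = dotp x t + dotp y t.
Proof. by rewrite /dotp -big_split; apply: eq_bigr => i _; rewrite mxE mulrDl. Qed.

Lemma dotpNl x t : dotp (- x) t = - dotp x t.
Proof. by rewrite /dotp -sumrN; apply: eq_bigr => i _; rewrite mxE mulNr. Qed.

Lemma continuous_dotp t : continuous (fun x => dotp x t).
Proof.
rewrite (_ : (fun _ => _) = \sum_(i < d) (fun x : E => x ord0 i * t ord0 i)); last first.
  by apply/funext => x; rewrite fct_sumE.
elim/big_ind : _ => [x|f g cf cg x|i _ x].
- exact: cst_continuous.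
- by apply: continuousD; [exact: cf|exact: cg].
- by apply: continuousM; [exact: continuous_coord|exact: cst_continuous].
Qed.

Definition phase x t : R := 2 * pi * dotp x t.

Lemma angD x y t : phase (x + y) t = phase x t + phase y t.
Proof. by rewrite /phase dotpDl mulrDr. Qed.

Lemma angN x t : phase (- x) t = - phase x t.
Proof. by rewrite /phase dotpNl mulrN. Qed.

Lemma continuous_ang t : continuous (fun x => phase x t).
Proof.
rewrite /phase => x.
by apply: (@continuousM _ _ (cst (2 * pi)) (fun x => dotp x t)); [exact: cst_continuous|exact: continuous_dotp].
Qed.

Lemma continuous_cos_ang t : continuous (fun x => cos (phase x t)).
Proof.
move=> x; apply: (@continuous_comp _ _ _ (fun x => phase x t) (@cos R)).
  exact: continuous_ang.
exact: continuous_cos.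
Qed.

Lemma continuous_sin_ang t : continuous (fun x => sin (phase x t)).
Proof.
move=> x; apply: (@continuous_comp _ _ _ (fun x => phase x t) (@sin R)).
  exact: continuous_ang.
exact: continuous_sin.
Qed.

Lemma normr_cos_le1 (a : R) : `|cos a| <= 1.
Proof. by rewrite ler_norml cos_geN1 cos_le1. Qed.

Lemma normr_sin_le1 (a : R) : `|sin a| <= 1.
Proof. by rewrite ler_norml sin_geN1 sin_le1. Qed.

Lemma Ccr_cos u t : Ccr u -> Ccr (fun x => u x * cos (phase x t)).
Proof.
move=> Cu; apply: (CcrM (c' := 1) Cu); first exact: continuous_cos_ang.
by move=> x; exact: normr_cos_le1.
Qed.

Lemma Ccr_sin u t : Ccr u -> Ccr (fun x => u x * sin (phase x t)).
Proof.
move=> Cu; apply: (CcrM (c' := 1) Cu); first exact: continuous_sin_ang.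
by move=> x; exact: normr_sin_le1.
Qed.

Definition cos_transform u t : R := rint (fun x => u x * cos (phase x t)).
Definition sin_transform u t : R := rint (fun x => u x * sin (phase x t)).
(** The exponent has a plus sign, as in [inv_fourier] and in the Fourier matrices; for real [u] the
    modulus does not depend on this sign. *)
Definition fhat u t : C := Complex (cos_transform u t) (sin_transform u t).

Lemma rintB u v : Ccr u -> Ccr v -> rint (fun x => u x - v x) = rint u - rint v.
Proof. by move=> Cu Cv; apply: RintegralB => //; exact: Ccr_integrable. Qed.

Lemma fhat_shift s u t : Ccr u ->
  fhat (fun x => u (x - s)) t = cis (phase s t) * fhat u t.
Proof.
move=> Cu; have h1 := Ccr_cos t Cu; have h2 := Ccr_sin t Cu.
rewrite /fhat /cis; simpc; congr Complex.
  rewrite /cos_transform /sin_transform -!rintZ// -rintB; [|exact: CcrZ|exact: CcrZ].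
  rewrite -[RHS](rint_shift s); last by
    rewrite -[X in Ccr X]/(((fun x => _ * (u x * _)) - (fun x => _ * (u x * _)))%R);
    apply: CcrB; exact: CcrZ.
  congr rint; apply/funext => x.
  rewrite (_ : phase x t = phase (x - s) t + phase s t); last by rewrite -angD subrK.
  by rewrite cosD /=; ring.
rewrite /cos_transform /sin_transform -!rintZ// -rintD; [|exact: CcrZ|exact: CcrZ].
rewrite -[RHS](rint_shift s); last by apply: CcrD; exact: CcrZ.
congr rint; apply/funext => x.
rewrite (_ : phase x t = phase (x - s) t + phase s t); last by rewrite -angD subrK.
by rewrite sinD /=; ring.
Qed.

Lemma fhat_sum (J : Type) (r : seq J) (F : J -> E -> R) t :
  (forall j, Ccr (F j)) ->
  fhat (fun x => \sum_(j <- r) F j x) t = \sum_(j <- r) fhat (F j) t.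
Proof.
move=> h; elim: r => [|j r ih].
  rewrite big_nil /fhat /cos_transform /sin_transform; congr Complex; rewrite -[RHS](rint0 R d);
  by congr rint; apply/funext => x; rewrite big_nil mul0r.
rewrite big_cons -ih /fhat; simpc; have Cs := Ccr_sum r h.
congr Complex; rewrite /cos_transform /sin_transform -rintD; try exact: Ccr_cos; try exact: Ccr_sin;
by congr rint; apply/funext => x; rewrite big_cons mulrDl.
Qed.

Lemma fhatZ a u t : Ccr u -> fhat (fun x => a * u x) t = a%:C%C * fhat u t.
Proof.
move=> Cu; rewrite /fhat; simpc; congr Complex; rewrite /cos_transform /sin_transform -rintZ;
  try exact: Ccr_cos; try exact: Ccr_sin;
by congr rint; apply/funext => x; rewrite mulrA.
Qed.

Lemma fhatB u v t : Ccr u -> Ccr v -> fhat (u - v) t = fhat u t - fhat v t.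
Proof.
move=> Cu Cv; rewrite /fhat; simpc; congr Complex; rewrite /cos_transform /sin_transform -rintB;
  try exact: Ccr_cos; try exact: Ccr_sin;
by congr rint; apply/funext => x; rewrite -mulrBl.
Qed.

(** The Fourier multiplier of [ops l]; for a digit set it is an entry of the Fourier matrix. *)
Definition csum l t : C := \sum_(s <- l) cis (phase s t).

Lemma fhat_ops l u t : Ccr u -> fhat (ops l u) t = csum l t * fhat u t.
Proof.
move=> Cu; rewrite /ops fhat_sum; last by move=> s; exact: Ccr_shift.
by rewrite /csum mulr_suml; apply: eq_bigr => s _; exact: fhat_shift.
Qed.

Lemma csumN l t : csum (map -%R l) t = conjc (csum l t).
Proof.
rewrite /csum big_map (raddf_sum (@conjc R)); apply: eq_bigr => s _.
by rewrite angN /cis cosN sinN.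
Qed.

Lemma conjc_mul (z : C) : conjc z * z = (Normc.normc z ^+ 2)%:C%C.
Proof.
case: z => a b; simpc; rewrite /= sqr_sqrtr ?addr_ge0 ?sqr_ge0//.
by congr Complex; ring.
Qed.

Lemma fhat_gram k (Ds : seq (seq E)) u t : Ccr u ->
  fhat (gram k Ds u) t =
  (k * \sum_(l <- Ds) Normc.normc (csum l t) ^+ 2)%:C%C * fhat u t.
Proof.
move=> Cu; rewrite /gram fhatZ; last first.
  by apply: Ccr_sum => l; apply: Ccr_ops; exact: Ccr_ops.
rewrite fhat_sum; last by move=> l; apply: Ccr_ops; exact: Ccr_ops.
rewrite (rmorphM (real_complex R)) -mulrA; congr (_ * _).
rewrite (rmorph_sum (real_complex R)) mulr_suml; apply: eq_bigr => l _.
rewrite fhat_ops; last exact: Ccr_ops.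
by rewrite fhat_ops// csumN mulrA conjc_mul.
Qed.

Lemma fhat_contr m k (Ds : seq (seq E)) u t : Ccr u ->
  fhat (iter m (contr (gram k Ds)) u) t =
  ((1 - k * \sum_(l <- Ds) Normc.normc (csum l t) ^+ 2) ^+ m)%:C%C * fhat u t.
Proof.
move=> Cu; elim: m => [|m ih]; first by rewrite expr0 mul1r.
have Cm : Ccr (iter m (contr (gram k Ds)) u).
  by apply: iter_contr_closed => [? ? ? ?|? ?|//]; [exact: CcrB|exact: Ccr_gram].
rewrite iterS /contr fhatB//; last exact: Ccr_gram.
rewrite fhat_gram// ih exprS !(rmorphM (real_complex R)) (rmorphB (real_complex R)) (rmorphM (real_complex R)) (rmorph1 (real_complex R)).
by ring.
Qed.

Definition fourier_norm2 u t : R := cos_transform u t ^+ 2 + sin_transform u t ^+ 2.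

Lemma pow_ge0 u t : 0 <= fourier_norm2 u t.
Proof. by rewrite addr_ge0// sqr_ge0. Qed.

Lemma pow_contr m k (Ds : seq (seq E)) u t : Ccr u ->
  fourier_norm2 (iter m (contr (gram k Ds)) u) t =
  (1 - k * \sum_(l <- Ds) Normc.normc (csum l t) ^+ 2) ^+ m.*2 * fourier_norm2 u t.
Proof.
move=> /(fhat_contr m k Ds t); rewrite /fhat /fourier_norm2; simpc => -[-> ->].
by rewrite -mul2n mulnC exprM; ring.
Qed.

Lemma rintE u : Ccr u -> (\int[leb]_x (u x)%:E)%E = (rint u)%:E.
Proof.
move=> Cu; rewrite /rint /Rintegral fineK//; apply: integrable_fin_num => //.
exact: Ccr_integrable.
Qed.

(** The real part of the rule that the transform of the autocorrelation is [|v^|^2]. After Fubini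
    and the substitution of [y - z] for [z], the addition formula of the cosine separates the
    variables and leaves the squares of the two transforms. *)
Lemma autocorr_fourier v t : Ccr v ->
  rint (fun z => rint (fun y => v (y - z) * v y) * cos (phase z t)) = fourier_norm2 v t.
Proof.
move=> Cv; pose G (p : (B * B)%type) : R :=
  v ((p.2 : E) - p.1) * v p.2 * cos (phase p.1 t).
have mG : measurable_fun setT (EFin \o G).
  apply/measurable_EFinP; apply: measurable_funM; first apply: measurable_funM.
  - apply: (@measurableT_comp _ _ _ _ _ _ (v : B -> measurableTypeR R) _
      (fun p : (B * B)%type => (p.2 : E) - p.1 : B)); first exact: Ccr_measurable.
    by apply: measurable_fun_addE => //; exact: measurable_fun_oppE.
  - apply: (@measurableT_comp _ _ _ _ _ _ (v : B -> measurableTypeR R) _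
      (snd : (B * B)%type -> B)) => //; exact: Ccr_measurable.
  apply: (@measurableT_comp _ _ _ _ _ _ ((fun x => cos (phase x t)) : B -> measurableTypeR R) _
      (fst : (B * B)%type -> B)) => //.
  by apply: borelRd_measurable_continuous; exact: continuous_cos_ang.
have iG : (leb \x leb)%E.-integrable setT (EFin \o G).
  have [_ [k [c h]]] := Cv.
  have c0 : 0 <= c by exact: le_trans (normr_ge0 _) (h 0).1.
  pose q := `|k| + 1; have q0 : 0 < q by rewrite ltr_wpDl.
  have kq : k < q by rewrite (le_lt_trans (ler_norm _))// ltrDl.
  (* The integrand vanishes unless the second variable and the difference of the two are below [q]
     in norm, which confines the first to [q + q]. *)
  pose K : set (B * B)%type := ocube 0 (q + q) `*` ocube 0 q.
  have mK : measurable K by apply: measurableX; exact: measurable_obox.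
  have v0 x : q <= `|x| -> v x = 0 by move=> qx; apply: (h x).2; exact: lt_le_trans qx.
  pose g (x : (B * B)%type) : \bar R := ((c * c)%:E * (\1_K x)%:E)%E.
  apply: (le_integrable measurableT mG (g := g)).
    move=> [x y] _; rewrite /g /= lee_fin indicE.
    have [Kx|Kx] := pselect (K (x, y)).
      rewrite mem_set// mulr1 [leRHS]ger0_norm ?mulr_ge0// /G /= 2!normrM -[leRHS]mulr1.
      rewrite ler_pM ?mulr_ge0 ?normr_cos_le1//.
      by rewrite ler_pM// ?(h _).1.
    rewrite memNset// mulr0 normr0 /G /=; suff -> : v (y - x) * v y = 0 by rewrite mul0r normr0.
    apply/eqP; rewrite mulf_eq0; apply/negPn/negP => /norP[v1 v2].
    apply: Kx; split.
      apply/(@ocube0E R d (q + q) x (addr_gt0 q0 q0)).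
      rewrite (_ : x = y - (y - x)); last by rewrite subKr.
      apply: le_lt_trans (ler_normB _ _) _; apply: ltrD; rewrite ltNge.
        by apply: contra v2 => /v0 ->.
      by apply: contra v1 => /v0 ->.
    by apply/(@ocube0E R d q y q0); rewrite ltNge; apply: contra v2 => /v0 ->.
  apply: integrableZl => //; apply: integrable_indic_lty => //.
  suff : ((leb \x leb) K < +oo)%E by [].
  rewrite product_measure1E; [|exact: measurable_obox|exact: measurable_obox].
  apply: lte_mul_pinfty => //; last exact: lebesgue_obox_lty.
  by rewrite ge0_fin_numE//; exact: lebesgue_obox_lty.
rewrite /rint {1}/Rintegral.
rewrite (eq_integral (fun z : B => \int[leb]_y (EFin \o G) (z, y)))%E; last first.
  move=> z _; transitivity ((rint (fun y => v (y - z) * v y * cos (phase z t)))%:E).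
    congr (_%:E); rewrite mulrC -/(rint _) -rintZ; last by apply: Ccr_mul => //; exact: Ccr_shift.
    by congr rint; apply/funext => y; rewrite mulrC.
  rewrite -rintE//.
  rewrite (_ : (fun _ => _) = fun y => cos (phase z t) * (v (y - z) * v y)).
    by apply: CcrZ; apply: Ccr_mul => //; exact: Ccr_shift.
  by apply/funext => y; rewrite mulrC.
rewrite (Fubini iG).
rewrite (eq_integral (fun y : B => (v y * (cos (phase y t) * cos_transform v t + sin (phase y t) * sin_transform v t))%:E)); last first.
  move=> y _ /=.
  transitivity ((v y * rint (fun z => v (y - z) * cos (phase z t)))%:E).
    have h1 : Ccr (fun z => v (y - z) * cos (phase z t)) by apply: Ccr_cos; exact: Ccr_rev.
    rewrite -rintZ// -rintE; last exact: CcrZ.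
    by apply: eq_integral => z _; rewrite /G /= -mulrA mulrCA.
  congr ((_ * _)%:E).
  have hc := Ccr_cos t Cv; have hs := Ccr_sin t Cv.
  rewrite -(rint_rev y); last by apply: Ccr_cos; exact: Ccr_rev.
  rewrite /cos_transform /sin_transform -!rintZ// -rintD; try exact: CcrZ.
  congr rint; apply/funext => z; rewrite subKr angD angN cosD cosN sinN; ring.
have hc := Ccr_cos t Cv; have hs := Ccr_sin t Cv.
have -> : (fun y : B => (v y * (cos (phase y t) * cos_transform v t + sin (phase y t) * sin_transform v t))%:E) =
   (fun y : B => (cos_transform v t * (v y * cos (phase y t)) + sin_transform v t * (v y * sin (phase y t)))%:E).
  by apply/funext => y; congr _%:E; ring.
rewrite rintE /=; last by apply: CcrD; exact: CcrZ.
by rewrite rintD ?rintZ//; exact: CcrZ.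
Qed.

End FourierSide.

(** * From the diffraction measure to norms of smoothed combs *)

Section Interface.
Variables (R : realType) (d : nat).
Local Notation E := 'rV[R]_d.
Local Notation B := (borelRd R d).
Local Notation leb := (@lebesgue_Rd R d).
Local Notation C := R[i].
Implicit Types (u v : E -> R) (l : seq E).

Lemma normc_real (a : R) : `|a%:C%C| = `|a|%:C%C :> C.
Proof. by rewrite normc_def /= expr0n addr0 sqrtr_sqr. Qed.

Lemma conjcM (x y : C) : conjc (x * y) = conjc x * conjc y.
Proof. exact: rmorphM. Qed.

Lemma complex_gt0P (e : C) : 0 < e -> exists2 a : R, 0 < a & e = a%:C%C.
Proof.
case: e => a b; rewrite ltcE /= => /andP[/eqP b0 a0].
by exists a => //; rewrite b0.
Qed.

Lemma cvg_complex_Re (T : Type) (F : set_system T) {FF : Filter F}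
    (f : T -> C) (l : C) :
  (f x : C^o) @[x --> F] --> (l : C^o) ->
  (complex.Re (f x) : R) @[x --> F] --> (complex.Re l : R).
Proof.
move=> /cvgrPdist_lt fl; apply/cvgrPdist_lt => e e0.
have /fl : (0 : C) < e%:C%C by rewrite ltcR.
apply: filterS => x; rewrite -ltcR; apply: le_lt_trans.
have -> : complex.Re l - complex.Re (f x) = complex.Re (l - f x).
  by case: l {fl} => a b; case: (f x).
exact: normc_ge_Re.
Qed.

Lemma continuous_real_complex (u : E -> R) : continuous u ->
  continuous ((fun x => (u x)%:C%C) : E -> C^o).
Proof.
move=> cu x; apply/(@cvgrPdist_lt _ _ _ (nbhs x) (nbhs_filter x)) => e /complex_gt0P[a a0 ->].
have /(@cvgrPdist_lt _ _ _ (nbhs x) (nbhs_filter x) u (u x)) /(_ a a0) := cu x.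
apply: filterS => y.
by rewrite -(rmorphB (real_complex R)) normc_real ltcR.
Qed.

Lemma Cc_real (u : E -> R) : Ccr u -> Cc (fun x => (u x)%:C%C).
Proof.
move=> [cu [k [c h]]]; split; first exact: continuous_real_complex.
have sub : closure [set x | (u x)%:C%C != 0] `<=` [set x : E | `|x| <= k].
  have -> : [set x : E | `|x| <= k] = closure [set x : E | `|x| <= k].
    apply/closure_id; apply: (@closed_comp _ _ (fun x : E => `|x|) [set r | r <= k]).
      by move=> x _; exact: norm_continuous.
    exact: closed_le.
  apply: closure_subset => x /= ux; rewrite leNgt; apply: contra ux => kx.
  by rewrite (h x).2.
apply: bounded_closed_compact; last exact: closed_closure.
exists k; split; first exact: num_real.
by move=> M kM x /sub /= xk; apply: le_trans xk _; exact: ltW.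
Qed.

(** A Lipschitz bound survives translations and differences, hence the filter, and yields continuity
    of the autocorrelation by integration against [|v|]. *)
Definition Lip (u : E -> R) := exists2 K : R, 0 <= K &
  forall x y, `|u x - u y| <= K * `|x - y|.

Lemma Lip_continuous u : Lip u -> continuous u.
Proof.
move=> [K K0 hK] x; apply/(@cvgrPdist_lt _ _ _ (nbhs x) (nbhs_filter x) u (u x)) => e e0.
have K1 : 0 < K + 1 by rewrite ltr_wpDl.
near=> y; apply: le_lt_trans (hK _ _) _.
apply: (@le_lt_trans _ _ ((K + 1) * `|x - y|)); first by rewrite ler_wpM2r// lerDl.
rewrite mulrC -ltr_pdivlMr//; near: y.
apply: (@cvgr_dist_lt _ _ _ (nbhs x) (nbhs_filter x) id x); first exact: cvg_id.
exact: divr_gt0.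
Unshelve. all: end_near.
Qed.

Lemma LipD u v : Lip u -> Lip v -> Lip (fun x => u x + v x).
Proof.
move=> [K K0 hK] [K' K0' hK']; exists (K + K'); first exact: addr_ge0.
move=> x y; rewrite opprD addrACA mulrDl; apply: le_trans (ler_normD _ _) _.
by rewrite lerD.
Qed.

Lemma LipZ a u : Lip u -> Lip (fun x => a * u x).
Proof.
move=> [K K0 hK]; exists (`|a| * K); first exact: mulr_ge0.
by move=> x y; rewrite -mulrBr normrM -mulrA ler_wpM2l.
Qed.

Lemma LipB u v : Lip u -> Lip v -> Lip (u - v).
Proof.
move=> Lu Lv; rewrite (_ : u - v = fun x => u x + (-1) * v x).
  by apply: LipD => //; exact: LipZ.
by apply/funext => x; rewrite mulN1r.
Qed.

Lemma Lip_sum (J : Type) (r : seq J) (F : J -> E -> R) :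
  (forall j, Lip (F j)) -> Lip (fun x => \sum_(j <- r) F j x).
Proof.
move=> h; elim: r => [|j r ih].
  by exists 0 => // x y; rewrite !big_nil subrr normr0 mul0r.
rewrite (_ : (fun _ => _) = fun x => F j x + \sum_(j <- r) F j x); first exact: LipD.
by apply/funext => x; rewrite big_cons.
Qed.

Lemma Lip_ops l u : Lip u -> Lip (ops l u).
Proof.
move=> [K K0 hK]; apply: Lip_sum => s; exists K => // x y.
apply: le_trans (hK _ _) _; rewrite (_ : x - s - (y - s) = x - y)//.
by rewrite opprB addrA subrK.
Qed.

Lemma Lip_contr m k (Ds : seq (seq E)) u : Lip u -> Lip (iter m (contr (gram k Ds)) u).
Proof.
move=> Lu; apply: iter_contr_closed Lu => [? ? ? ?|v Lv]; first exact: LipB.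
apply: LipZ; apply: Lip_sum => l; apply: Lip_ops; exact: Lip_ops.
Qed.

(** The test function [v * v~], whose transform is [|v^|^2]. *)
Definition autocorr (v : E -> R) (z : E) : R := ip (fun y => v (y - z)) v.

Lemma Ccr_norm u : Ccr u -> Ccr (fun x => `|u x|).
Proof.
move=> [cu [k [c h]]]; split.
  move=> x; apply: (@continuous_comp _ _ _ u Num.norm); first exact: cu.
  exact: norm_continuous.
exists k, c => x; rewrite normr_id; split; first exact: (h x).1.
by move=> kx; rewrite (h x).2// normr0.
Qed.

Lemma ler_norm_rint u : Ccr u -> `|rint u| <= rint (fun x => `|u x|).
Proof. by move=> Cu; apply: le_normr_Rintegral => //; exact: Ccr_integrable. Qed.

Lemma Ccr_autocorr v : Ccr v -> Lip v -> Ccr (autocorr v).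
Proof.
move=> Cv [K K0 hK]; have Cnv := Ccr_norm Cv; split.
  apply: Lip_continuous; exists (K * rint (fun x => `|v x|)).
    by rewrite mulr_ge0// rint_ge0.
  move=> x y; rewrite /autocorr -ipB//; try exact: Ccr_shift.
  have Cd : Ccr ((fun p => v (p - x)) - (fun p => v (p - y))).
    by apply: CcrB; exact: Ccr_shift.
  apply: le_trans (ler_norm_rint _) _; first exact: Ccr_mul.
  rewrite mulrAC -rintZ//; apply: rint_le; [|exact: CcrZ|].
    by apply: Ccr_norm; exact: Ccr_mul.
  have xy p : p - x - (p - y) = y - x by rewrite opprB addrC addrA subrK.
  move=> p; rewrite normrM ler_wpM2r//.
  change (`|v (p - x) - v (p - y)| <= K * `|x - y|).
  by have := hK (p - x) (p - y); rewrite xy (distrC y).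
have [_ [k [c h]]] := Cv.
exists (`|k| + `|k|), (c * rint (fun x => `|v x|)) => z; split.
  rewrite /autocorr; apply: le_trans (ler_norm_rint _) _.
    by apply: Ccr_mul => //; exact: Ccr_shift.
  rewrite -rintZ//; apply: rint_le; [|exact: CcrZ|].
    by apply: Ccr_norm; apply: Ccr_mul => //; exact: Ccr_shift.
  by move=> p; rewrite normrM ler_wpM2r// (h _).1.
move=> kz; rewrite /autocorr /ip -[RHS](rint0 R d); congr rint; apply/funext => p.
have [kp|kp] := ltP k `|p|; first by rewrite [X in _ * X](h _).2// mulr0.
rewrite (h _).2 ?mul0r//; have : `|z| <= `|p| + `|p - z|.
  by rewrite -{1}(subKr p z); exact: ler_normB.
have := ler_norm k; lra.
Qed.

Variables (L : finType) (na : nat) (A : 'I_na -> tile R d L) (w : 'I_na -> C).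
Variable T : tile_patch R d L.

Definition tile_points (i : 'I_na) (r : R) : set E :=
  [set t | T (tile_shift t (A i)) /\ eball r t].

(** Finiteness allows the sum over a set in [comb] to be rewritten as a sum over a list of
    points. *)
Hypothesis hfin : forall i r, finite_set (tile_points i r).

Lemma combE r f : comb A w T r f =
  \sum_(i < na) w i * \sum_(t <- fset_set (tile_points i r)) f t.
Proof.
by apply: eq_bigr => i _; congr (_ * _); apply: fsbig_finite; exact: (hfin i r).
Qed.

(** Brings the autocorrelation into the form of a convolution of two functions in [Cc], on which
    [is_fourier_transform] can be applied. *)
Lemma fconv_autocorr (v : E -> R) :
  fconv (fun x => (v (- x))%:C%C) (fun x => (v x)%:C%C) =
  fun z => (autocorr v z)%:C%C.
Proof.
apply/funext => z; rewrite /fconv /cintegral; congr Complex.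
  rewrite /autocorr /ip /rint; apply: eq_Rintegral => y _.
  by simpc.
rewrite (_ : (fun _ => _) = fun=> 0); first by rewrite Rintegral_cst// mul0r.
by apply/funext => y; simpc.
Qed.

(** The pairing of [F * F~] with [v * v~] is the squared norm of [v * F]; expanding the comb [F] by
    tile type leaves inner products of smoothed combs. *)
Lemma mconv_comb r (v : E -> R) : Ccr v ->
  mconv (comb A w T r) (mtilde (comb A w T r)) (fun z => (autocorr v z)%:C%C) =
  \sum_(i < na) \sum_(j < na) w i * conjc (w j) *
    (ip (ops (fset_set (tile_points i r)) v) (ops (fset_set (tile_points j r)) v))%:C%C.
Proof.
move=> Cv; rewrite /mconv combE; apply: eq_bigr => i _.
under [RHS]eq_bigr => j _ do rewrite -mulrA; rewrite -[RHS]mulr_sumr; congr (_ * _).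
have e x : mtilde (comb A w T r) (fun y => (autocorr v (x + y))%:C%C) =
  \sum_(j < na) conjc (w j) * (ip (fun p => v (p - x)) (ops (fset_set (tile_points j r)) v))%:C%C.
  rewrite /mtilde combE -[LHS]/(conjc _) (raddf_sum (@conjc R)).
  apply: eq_bigr => j _; apply: etrans; first exact: conjcM.
  congr (_ * _).
  rewrite (raddf_sum (@conjc R)) /ops ip_sumr; last 2 first.
  - by move=> y; exact: Ccr_shift.
  - exact: Ccr_shift.
  rewrite (rmorph_sum (real_complex R)); apply: eq_bigr => y _.
  by rewrite -[LHS]/(conjc (conjc _)) conjcK /autocorr -ip_shift.
under eq_bigr => x _ do rewrite e.
rewrite exchange_big/=; apply: eq_bigr => j _; rewrite -mulr_sumr; congr (_ * _).
rewrite -(rmorph_sum (real_complex R)); congr (_%:C%C).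
rewrite [in RHS]/ops ip_suml//; first by move=> s; exact: Ccr_shift.
exact: Ccr_ops.
Qed.

Definition weight_sqr : R := \sum_(i < na) (complex.Re (w i) ^+ 2 + complex.Im (w i) ^+ 2).

(** The real part of [w i * conjc (w j)] is [p i * p j + q i * q j], so the double sum splits into
    two real quadratic forms. Each is the squared norm of a real combination of the [U i], and
    Cauchy-Schwarz over the tile types costs the factor [na]. *)
Lemma Re_mconv_comb_le r (v : E -> R) (k : R) : Ccr v ->
  (forall i, ip (ops (fset_set (tile_points i r)) v)
                (ops (fset_set (tile_points i r)) v) <= k) ->
  complex.Re (mconv (comb A w T r) (mtilde (comb A w T r))
     (fun z => (autocorr v z)%:C%C)) <= na%:R * weight_sqr * k.
Proof.
move=> Cv hk; rewrite mconv_comb//.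
set U := fun i : 'I_na => ops (fset_set (tile_points i r)) v.
have CU i : Ccr (U i) by exact: Ccr_ops.
have ReD (x y : C) : complex.Re (x + y) = complex.Re x + complex.Re y.
  by case: x => ? ?; case: y.
have Re_sum (J : Type) (s : seq J) (F : J -> C) :
    complex.Re (\sum_(j <- s) F j) = \sum_(j <- s) complex.Re (F j).
  by elim/big_rec2 : _ => [//|j a b _ <-]; rewrite ReD.
have quad (a : 'I_na -> R) :
    \sum_i \sum_j a i * a j * ip (U i) (U j) <= na%:R * \sum_i (a i ^+ 2 * ip (U i) (U i)).
  have Ca i : Ccr (fun x => a i * U i x) by exact: CcrZ.
  have := ip_sum_le (index_enum 'I_na) Ca.
  rewrite ip_suml//; last exact: Ccr_sum.
  under eq_bigr => i _.
    rewrite ip_sumr//.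
    under eq_bigr => j _ do rewrite ipZ// ipC ipZ// ipC mulrA.
    over.
  have e2 : \sum_i ip (fun x => a i * U i x) (fun x => a i * U i x) =
      \sum_i a i ^+ 2 * ip (U i) (U i).
    by apply: eq_bigr => i _; rewrite ipZ// ipC ipZ// mulrA -expr2.
  rewrite e2.
  by rewrite /index_enum -enumT size_enum_ord.
pose p i := complex.Re (w i); pose q i := complex.Im (w i).
rewrite Re_sum.
have -> : \sum_i complex.Re (\sum_j w i * conjc (w j) * (ip (U i) (U j))%:C%C) =
  \sum_i \sum_j p i * p j * ip (U i) (U j) + \sum_i \sum_j q i * q j * ip (U i) (U j).
  rewrite -big_split/=; apply: eq_bigr => i _; rewrite Re_sum -big_split/=.
  apply: eq_bigr => j _; rewrite /p /q; case: (w i) => a b; case: (w j) => a' b'.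
  by simpc => /=; ring.
apply: le_trans (lerD (quad p) (quad q)) _.
rewrite -mulrDr -mulrA ler_wpM2l// -big_split/= mulr_suml; apply: ler_sum => i _.
rewrite -mulrDl ler_wpM2l ?addr_ge0 ?sqr_ge0//; exact: hk.
Qed.

(** The integral of [|v^|^2] against [ghat] is the limit of the normalised squared norms of smoothed
    combs. The bound is a function [h] of the radius because boundary terms disappear only in the
    limit. Measurability of [fourier_norm2 v] is extracted from the integrability contained in
    [is_fourier_transform]. *)
Lemma diffraction_pow_le (ghat : {measure set B -> \bar R}) (v : E -> R)
    (h : R -> R) (k : R) : Ccr v -> Lip v ->
  is_diffraction_measure A w T ghat ->
  (\forall r \near +oo, forall i,
     ip (ops (fset_set (tile_points i r)) v) (ops (fset_set (tile_points i r)) v)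
     <= h r * fine (leb (eball r : set B))) ->
  (\forall r \near +oo, 0 < fine (leb (eball r : set B))) ->
  h r @[r --> +oo] --> k ->
  measurable_fun setT (fourier_norm2 v : B -> measurableTypeR R) /\
  (\int[ghat]_x (fourier_norm2 v x)%:E <= (na%:R * weight_sqr * k)%:E)%E.
Proof.
move=> Cv Lv [g [[_ hg] [_ hF]]] hh hv hk.
have Cf : Cc (fun x => (v (- x))%:C%C).
  by have := Cc_real (Ccr_rev 0 Cv); under eq_fun do rewrite sub0r.
have Ch := Cc_real Cv.
have := hF _ _ Cf Ch; rewrite fconv_autocorr => -[[iRe _] gE].
have Repow x : complex.Re (inv_fourier (fun z => (autocorr v z)%:C%C) x) = fourier_norm2 v x.
  rewrite -autocorr_fourier// /inv_fourier /cintegral/=.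
  by rewrite /rint; apply: eq_Rintegral => z _; rewrite /cis; simpc.
split.
  apply/measurable_EFinP; move/integrableP : iRe => [+ _].
  by congr measurable_fun; apply/funext => x; rewrite Repow.
have iE : (\int[ghat]_x (fourier_norm2 v x)%:E)%E =
    (complex.Re (g (fun z => (autocorr v z)%:C%C)))%:E.
  rewrite gE /cintegral/= /Rintegral.
  have -> : (fun x : B => (complex.Re (inv_fourier (fun z : E => (autocorr v z)%:C%C) x))%:E) =
     (fun x : B => (fourier_norm2 v x)%:E) by apply/funext => x; rewrite Repow.
  rewrite fineK//; apply: integrable_fin_num => //.
  by move: iRe; congr (integrable _ _ _); apply/funext => x; rewrite Repow.
rewrite iE lee_fin.
have Cfull := Cc_real (Ccr_autocorr Cv Lv).
have cvgRe := @cvg_complex_Re _ _ (@filter_filter R _ proper_pinfty_nbhs) _ _ (hg _ Cfull).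
apply: (ler_cvg_to cvgRe (cvgM (cvg_cst (na%:R * weight_sqr)) hk)).
near=> r.
have v0 : 0 < fine (leb (eball r : set B)) by near: r.
have H : forall i, ip (ops (fset_set (tile_points i r)) v)
    (ops (fset_set (tile_points i r)) v) <= h r * fine (leb (eball r : set B)).
  by near: r.
have {}H := Re_mconv_comb_le Cv H.
set M := mconv _ _ _ in H *.
have -> : complex.Re (((fine (leb (eball r : set B)))^-1)%:C%C * M) =
   (fine (leb (eball r : set B)))^-1 * complex.Re M.
  by case: M {H} => a b; simpc.
by rewrite mulrC ler_pdivrMr// -mulrA.
Unshelve. all: end_near.
Qed.

End Interface.

(** * Balls and packings *)

Section Euclid.
Variables (R : realType) (d : nat).
Local Notation E := 'rV[R]_d.
Local Notation B := (borelRd R d).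
Local Notation leb := (@lebesgue_Rd R d).
Implicit Types (x y : E) (l : seq E).

Lemma dotp_ge0 x : 0 <= dotp x x.
Proof. by apply: sumr_ge0 => i _; rewrite -expr2 sqr_ge0. Qed.

Lemma enorm_ge0 x : 0 <= enorm x.
Proof. exact: sqrtr_ge0. Qed.

Lemma sqr_enorm x : enorm x ^+ 2 = dotp x x.
Proof. by rewrite sqr_sqrtr// dotp_ge0. Qed.

(** Lagrange's identity: the defect is half a sum of squares of two-by-two minors. *)
Lemma cauchy_schwarz x y : dotp x y <= enorm x * enorm y.
Proof.
apply: (@le_trans _ _ `|dotp x y|); first exact: ler_norm.
rewrite -(@ler_pXn2r _ 2)// ?nnegrE ?mulr_ge0 ?enorm_ge0// exprMn !sqr_enorm.
rewrite real_normK ?num_real// expr2.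
have : 0 <= \sum_i \sum_j (x ord0 i * y ord0 j - x ord0 j * y ord0 i) ^+ 2.
  by apply: sumr_ge0 => i _; apply: sumr_ge0 => j _; exact: sqr_ge0.
rewrite (_ : \sum_i _ = 2 * (dotp x x * dotp y y - dotp x y * dotp x y)).
  by rewrite pmulr_rge0// subr_ge0.
have -> : 2 * (dotp x x * dotp y y - dotp x y * dotp x y) =
    dotp x x * dotp y y + dotp y y * dotp x x - 2 * (dotp x y * dotp x y) by ring.
rewrite /dotp !big_distrlr /= mulr_sumr -big_split -sumrB; apply: eq_bigr => i _.
by rewrite mulr_sumr -big_split -sumrB; apply: eq_bigr => j _ /=; ring.
Qed.

Lemma enormD x y : enorm (x + y) <= enorm x + enorm y.
Proof.
rewrite -(@ler_pXn2r _ 2)// ?nnegrE ?addr_ge0 ?enorm_ge0// sqrrD !sqr_enorm.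
have -> : dotp (x + y) (x + y) = dotp x x + 2 * dotp x y + dotp y y.
  rewrite /dotp mulr_sumr -!big_split; apply: eq_bigr => i _ /=; rewrite !mxE; ring.
by have := cauchy_schwarz x y; lra.
Qed.

Lemma enormN x : enorm (- x) = enorm x.
Proof. by rewrite /enorm /dotp; congr Num.sqrt; apply: eq_bigr => i _; rewrite !mxE mulrNN. Qed.

Lemma enormZ (a : R) x : enorm (a *: x) = `|a| * enorm x.
Proof.
rewrite /enorm (_ : dotp (a *: x) (a *: x) = a ^+ 2 * dotp x x).
  by rewrite sqrtrM ?sqr_ge0// sqrtr_sqr.
by rewrite /dotp mulr_sumr; apply: eq_bigr => i _; rewrite !mxE; ring.
Qed.

Lemma norm_le_enorm x : `|x| <= enorm x.
Proof.
apply: norm_le_coord; first exact: enorm_ge0.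
move=> i; rewrite -(@ler_pXn2r _ 2)// ?nnegrE ?enorm_ge0// sqr_enorm real_normK ?num_real//.
rewrite /dotp (bigD1 i)//= expr2 lerDl; apply: sumr_ge0 => j _.
by rewrite -expr2 sqr_ge0.
Qed.

Lemma enorm_le_norm x : enorm x <= d%:R * `|x|.
Proof.
rewrite -(@ler_pXn2r _ 2)// ?nnegrE ?mulr_ge0 ?enorm_ge0// sqr_enorm.
apply: (@le_trans _ _ (\sum_(i < d) `|x| ^+ 2)).
  apply: ler_sum => i _; rewrite -expr2 -[leLHS]real_normK ?num_real//.
  by rewrite ler_pXn2r ?nnegrE// coord_le_norm.
rewrite sumr_const card_ord exprMn -[leLHS]mulr_natl ler_wpM2r ?sqr_ge0//.
by rewrite expr2 -natrM ler_nat; case: (d) => // n; rewrite leq_pmulr.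
Qed.

Lemma continuous_enorm : continuous (@enorm R d).
Proof.
move=> x; apply: (@continuous_comp _ _ _ (fun x : E => dotp x x) Num.sqrt); last exact: sqrt_continuous.
rewrite (_ : (fun _ => _) = \sum_(i < d) (fun x : E => x ord0 i * x ord0 i)); last first.
  by apply/funext => y; rewrite fct_sumE.
elim/big_ind : _ => [|f g cf cg|i _].
- exact: cst_continuous.
- exact: continuousD.
- by apply: continuousM; exact: continuous_coord.
Qed.

Lemma closed_eball r : closed (eball r : set E).
Proof.
apply: (@closed_comp _ _ (@enorm R d) [set s | s <= r]); last exact: closed_le.
by move=> x _; exact: continuous_enorm.
Qed.

Lemma measurable_eball r : measurable (eball r : set B).
Proof. by apply: borelRd_measurable_closed; exact: closed_eball. Qed.

Lemma eball_lty r : (leb (eball r) < +oo)%E.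
Proof.
have r0 : 0 < `|r| + 1 by rewrite ltr_wpDl.
apply: (@le_lt_trans _ _ (leb (ocube 0 (`|r| + 1)))); last exact: lebesgue_obox_lty.
apply: lebesgue_le; [exact: measurable_eball|exact: measurable_obox|].
move=> x xr; apply/ocube0E => //; apply: le_lt_trans (norm_le_enorm x) _.
by apply: le_lt_trans (xr : enorm x <= r) _; rewrite (le_lt_trans (ler_norm _))// ltrDl.
Qed.

Definition evol (r : R) : R := fine (leb (eball r : set B)).

Lemma evolE r : leb (eball r) = (evol r)%:E.
Proof. by rewrite fineK// ge0_fin_numE// eball_lty. Qed.

Lemma evol_scale r : 0 < r -> evol r = r ^+ d * evol 1.
Proof.
move=> r0; have D0 i : (const_mx r : E) ord0 i != 0 by rewrite mxE gt_eqF.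
have := @lebesgue_diag R d (const_mx r) (eball r : set B) (measurable_eball r) D0.
rewrite (eq_bigr (fun=> r)) => [|i _]; last by rewrite mxE gtr0_norm.
rewrite prodr_const card_ord evolE -EFinM.
have -> : [set x : E | eball r (x *m diag_mx (const_mx r))] = eball 1.
  by apply/seteqP; split=> x; rewrite /eball /= diag_const_mx mul_mx_scalar enormZ gtr0_norm// ger_pMr.
by rewrite evolE => -[->]; rewrite mulrA divff ?mul1r// expf_neq0// gt_eqF.
Qed.

Lemma evol1_gt0 : 0 < evol 1.
Proof.
have q0 : 0 < (d%:R + 1)^-1 :> R by rewrite invr_gt0 ltr_wpDl.
rewrite -lte_fin -evolE; apply: (@lt_le_trans _ _ (leb (ocube 0 (d%:R + 1)^-1))).
  by rewrite lebesgue_ocube ?(ltW q0)// lte_fin exprn_gt0// mulr_gt0.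
apply: lebesgue_le; [exact: measurable_obox|exact: measurable_eball|].
move=> x /ocube0E - /(_ q0) h; rewrite /eball/=.
apply: le_trans (enorm_le_norm x) _; apply: (@le_trans _ _ (d%:R * (d%:R + 1)^-1)).
  by rewrite ler_wpM2l// ltW.
by rewrite ler_pdivrMr ?mul1r ?lerDl// ltr_wpDl.
Qed.

Lemma evol_gt0 r : 0 < r -> 0 < evol r.
Proof. by move=> r0; rewrite evol_scale// mulr_gt0 ?exprn_gt0// evol1_gt0. Qed.

(** The volume is homogeneous of degree [d], so a shell of fixed thickness is negligible against the
    ball, however large that thickness. *)
Lemma cvg_evol_ratio (c : R) : evol (r + c) / evol r @[r --> +oo] --> (1 : R).
Proof.
have h1 : (1 + c * r^-1) ^+ d @[r --> +oo] --> (1 : R).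
  have hV : (r : R)^-1 @[r --> +oo] --> (0 : R).
    by apply/(@gtr0_cvgV0 R R _ _ id); [exact: nbhs_pinfty_gt|exact: cvg_id].
  have h0 : (1 + c * r^-1) @[r --> +oo] --> (1 + c * 0 : R).
    by apply: cvgD; [exact: cvg_cst|apply: cvgM; [exact: cvg_cst|]].
  rewrite mulr0 addr0 in h0.
  have := @cvg_comp _ _ _ _ (fun z : R => z ^+ d) _ _ _ h0 (@exprn_continuous R d 1).
  by rewrite expr1n.
apply: cvg_trans h1; apply: near_eq_cvg; near=> r.
have r0 : 0 < r by near: r; exact: nbhs_pinfty_gt.
have rc0 : 0 < r + c by rewrite -ltrBlDr sub0r; near: r; apply: nbhs_pinfty_gt; exact: num_real.
rewrite (evol_scale r0) (evol_scale rc0); move: (evol 1) evol1_gt0 => k k0.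
have rd0 : r ^+ d != 0 by rewrite expf_neq0// gt_eqF.
have -> : 1 + c * r^-1 = (r + c) / r by rewrite mulrDl divff// gt_eqF.
by rewrite expr_div_n; field; rewrite rd0 gt_eqF.
Unshelve. all: end_near.
Qed.

(** The common source of all counting bounds below: [U] is a cube or its image under an expansion
    map, [W] a cube, a ball or a shell. *)
Lemma packing l (U W : set B) : measurable U -> measurable W -> uniq l ->
  (forall x y, x \in l -> y \in l -> x != y ->
     [set z : E | U (z - x)] `&` [set z | U (z - y)] = set0) ->
  (forall x, x \in l -> [set z : E | U (z - x)] `<=` W) ->
  ((size l)%:R%:E * leb U <= leb W)%E.
Proof.
move=> mU mW ul dis sub.
have mUx x : measurable ([set z : E | U (z - x)] : set B).
  apply: (@measurable_preimageT R d _ B (fun z : B => (z : E) - x) U) => //.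
  exact: measurable_fun_addE.
have mbig s : measurable (\big[setU/set0]_(x <- s) [set z : E | U (z - x)] : set B).
  by apply: bigsetU_measurable => x _; exact: mUx.
have subbig : \big[setU/set0]_(x <- l) [set z : E | U (z - x)] `<=` W.
  rewrite -bigcup_seq => z [x /= xl]; exact: sub.
apply: le_trans (lebesgue_le (mbig l) mW subbig).
elim: l ul dis {sub subbig} => [|x s ih] /=; first by rewrite mul0e big_nil measure0.
move=> /andP[xs us] dis; rewrite big_cons measureU//; last first.
  rewrite -bigcup_seq setI_bigcupr; apply: bigcup0 => y /= ys.
  apply: dis; rewrite ?inE ?eqxx ?ys ?orbT//.
  by apply: contraNneq xs => ->.
rewrite -natr1 addrC EFinD ge0_muleDl ?lee_fin// mul1e; apply: leeD.
  by have := lexx (leb U); rewrite -{2}(lebesgue_shift (- x) mU).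
by apply: ih => // y z ys zs; apply: dis; rewrite inE ?ys ?zs orbT.
Qed.

End Euclid.

(** * Tiles and substitutions *)

Section LinearExpansion.
Variables (R : realType) (d : nat).
Local Notation E := 'rV[R]_d.
Implicit Types (f g : {linear E -> E}) (x y : E).

Definition is_expanding f :=
  1 < inf [set enorm (f v) | v in [set v : E | enorm v = 1]].

Lemma enorm_eq0 x : enorm x = 0 -> x = 0.
Proof.
move=> x0; apply/eqP; rewrite -normr_eq0 eq_le normr_ge0 andbT -x0.
exact: norm_le_enorm.
Qed.

Lemma is_expandingP f : is_expanding f ->
  (exists v : E, enorm v = 1) /\
  forall x, inf [set enorm (f v) | v in [set v : E | enorm v = 1]] * enorm x <= enorm (f x).
Proof.
rewrite /is_expanding; set S := [set _ | _ in _] => f1.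
have S0 : S !=set0.
  (* The infimum of the empty set is [0] by convention, so [1 < inf S] provides a unit vector; in
     particular the dimension is positive. *)
  apply/set0P/negP => /eqP S0; move: f1; rewrite S0 inf0 ltr10 //.
have hS : has_inf S.
  by split => //; exists 0 => _ [v _ <-]; exact: enorm_ge0.
split; first by have [_ [v v1 _]] := S0; exists v.
move=> x; have [->|x0] := eqVneq x 0.
  by rewrite linear0 (_ : enorm 0 = 0) ?mulr0// -[0]addr0 /enorm /dotp big1 ?sqrtr0// => i _; rewrite !mxE addr0 mul0r.
have ex0 : 0 < enorm x.
  by rewrite lt_neqAle enorm_ge0 andbT eq_sym; apply: contra x0 => /eqP/enorm_eq0/eqP.
rewrite -ler_pdivlMr//; apply: ge_inf; first by case: hS.
exists ((enorm x)^-1 *: x).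
  by rewrite /= enormZ normfV ger0_norm ?enorm_ge0// mulVf// gt_eqF.
by rewrite linearZ enormZ normfV ger0_norm ?enorm_ge0// mulrC.
Qed.

Lemma expanding_le f x : is_expanding f -> enorm x <= enorm (f x).
Proof.
move=> fe; have [_ /(_ x)] := is_expandingP fe; apply: le_trans.
by rewrite ler_peMl ?enorm_ge0// ltW.
Qed.

Lemma is_expanding_comp f g : is_expanding f -> is_expanding g ->
  is_expanding (f \o g : {linear E -> E}).
Proof.
move=> fe ge; have [[v0 v01] hf] := is_expandingP fe; have [_ hg] := is_expandingP ge.
move: fe ge; rewrite /is_expanding; set a := inf _ in hf *; set b := inf _ in hg *.
move=> a1 b1; apply: (@lt_le_trans _ _ (a * b)); first by rewrite -[1]mulr1 ltr_pM.
apply: lb_le_inf; first by exists (enorm (f (g v0))), v0.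
move=> _ [v /= v1 <-]; apply: le_trans (hf _); rewrite ler_pM2l ?(lt_trans ltr01)//.
by apply: le_trans (hg v); rewrite v1 mulr1.
Qed.

Lemma lin1_mxE f x : f x = x *m lin1_mx f.
Proof. by rewrite mul_rV_lin1. Qed.

Lemma expanding_inj f : is_expanding f -> injective f.
Proof.
move=> fe x y fxy; apply/eqP; rewrite -subr_eq0; apply/eqP/enorm_eq0/eqP.
rewrite eq_le enorm_ge0 andbT; apply: le_trans (expanding_le _ fe) _.
by rewrite linearB fxy subrr /enorm /dotp big1 ?sqrtr0// => i _; rewrite !mxE mul0r.
Qed.

Lemma expanding_unit f : is_expanding f -> lin1_mx f \in unitmx.
Proof.
move=> fe; rewrite unitmxE unitfE; apply/det0P => -[v v0 fv0].
move/eqP: v0; apply; apply: (expanding_inj fe).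
by rewrite linear0 lin1_mxE.
Qed.

Lemma ldet_neq0 f : is_expanding f -> ldet f != 0.
Proof. by move=> /expanding_unit; rewrite unitmxE unitfE. Qed.

Lemma linear_bound f : exists2 k : R, 0 < k & forall x, `|f x| <= k * `|x|.
Proof.
have [k k0 hk] := mulmx_norm_bound (lin1_mx f).
by exists k => // x; rewrite lin1_mxE.
Qed.

Lemma expanding_surj f : is_expanding f -> forall y, exists x, f x = y.
Proof.
move=> fe y; exists (y *m invmx (lin1_mx f)).
by rewrite lin1_mxE mulmxKV// expanding_unit.
Qed.

Lemma nbhs_rowP x (S : set E) :
  nbhs x S <-> exists2 e : R, 0 < e & forall y, `|x - y| < e -> S y.
Proof.
split=> [/(@nbhs_normP R E x S)[e /= e0 h]|[e e0 h]]; first by exists e.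
by apply/(@nbhs_normP R E x S); exists e.
Qed.

Lemma interior_normP (S : set E) x :
  S° x <-> exists2 e : R, 0 < e & forall y, `|x - y| < e -> S y.
Proof. exact: nbhs_rowP. Qed.

(** A ball around [x] pulls back, under a bounded linear bijection, to a neighbourhood of the
    preimage of [x]. *)
Lemma interior_expanding_image f (S W : set E) x : is_expanding f ->
  S `<=` f @` W -> S° x -> exists2 z, W° z & f z = x.
Proof.
move=> fe SW /interior_normP[e e0 h]; have [z zx] := expanding_surj fe x.
exists z => //; have [k k0 hk] := linear_bound f.
apply/interior_normP; exists (e / k); first exact: divr_gt0.
move=> y zy; have /SW[w Ww /(expanding_inj fe) <-//] : S (f y).
apply: h; rewrite -zx -linearB; apply: le_lt_trans (hk _) _.
by rewrite mulrC -ltr_pdivlMr.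
Qed.

End LinearExpansion.

Section TileGeometry.
Variables (R : realType) (d : nat) (L : finType).
Local Notation E := 'rV[R]_d.
Implicit Types (x y : E) (S : set E) (T : tile R d L) (P : tile_patch R d L).

Lemma set_shiftE x S : set_shift x S = [set z | S (z - x)].
Proof.
apply/seteqP; split=> [_ [y Sy <-]|z Sz] /=; first by rewrite addrK.
by exists (z - x) => //; rewrite subrK.
Qed.

Lemma set_shiftD x y S : set_shift x (set_shift y S) = set_shift (y + x) S.
Proof.
by rewrite !set_shiftE; apply/seteqP; split=> z /=; rewrite opprD addrA (addrAC z).
Qed.

Lemma set_shift0 S : set_shift 0 S = S.
Proof. by rewrite set_shiftE; apply/seteqP; split=> z /=; rewrite subr0. Qed.

Lemma tile_shiftD x y T : tile_shift x (tile_shift y T) = tile_shift (y + x) T.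
Proof. by rewrite /tile_shift /= set_shiftD. Qed.

Lemma tile_shift0 T : tile_shift 0 T = T.
Proof. by case: T => S l; rewrite /tile_shift /= set_shift0. Qed.

Lemma tile_shift_eq x y T T' :
  tile_shift x T = tile_shift y T' <-> T' = tile_shift (x - y) T.
Proof.
split=> [h|->]; last by rewrite tile_shiftD subrK.
by rewrite -[LHS]tile_shift0 -(subrr y) -[tile_shift (_ - _) _]tile_shiftD -h tile_shiftD.
Qed.

Lemma interior_shift x S : (set_shift x S)° = set_shift x (S°).
Proof.
rewrite !set_shiftE; apply/seteqP; split=> z /= /interior_normP[e e0 h];
  apply/interior_normP; exists e => // y zy.
  by have := h (y + x); rewrite /= addrK; apply; rewrite opprD addrA addrAC.
by apply: h; rewrite opprB addrA subrK.
Qed.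

Lemma closure_shift x S : closure (set_shift x S) = set_shift x (closure S).
Proof.
have clP (U : set E) z : closure U z <-> forall e : R, 0 < e -> exists2 y, U y & `|z - y| < e.
  split=> [h e e0|h V /nbhs_rowP[e e0 hV]].
    have [|y [Uy zy]] := h [set y | `|z - y| < e].
      by apply/nbhs_rowP; exists e.
    by exists y.
  by have [y Uy zy] := h _ e0; exists y; split => //; exact: hV.
rewrite !set_shiftE; apply/seteqP; split=> z /= /clP h; apply/clP => e e0;
  have [y Uy zy] := h _ e0.
  by exists (y - x) => //; rewrite opprB addrA subrK.
by exists (y + x); rewrite /= ?addrK// opprD addrA addrAC.
Qed.

Lemma compact_norm_bound S : compact S -> exists k : R, forall x, S x -> `|x| <= k.
Proof.
move=> /compact_bounded[k [kr h]]; exists (k + 1) => x Sx.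
by apply: h => //; rewrite ltrDl.
Qed.

Lemma is_tile_shift x T : is_tile T -> is_tile (tile_shift x T).
Proof.
move=> [[y Ty] cT Tcl]; split; first by exists (y + x); exists y.
- apply: bounded_closed_compact.
    have [k hk] := compact_norm_bound cT; exists (k + `|x|); split; first exact: num_real.
    move=> M kM _ [z Tz <-]; apply: le_trans (ltW kM).
    by apply: le_trans (ler_normD _ _) _; rewrite lerD2r hk.
  have cS : closed (supp T) by rewrite Tcl; exact: closed_closure.
  have e : closure (set_shift x (supp T)) = set_shift x (supp T).
    by rewrite closure_shift; congr set_shift; exact/esym/closure_id.
  change (closed (set_shift x (supp T))).
  by rewrite -e; exact: closed_closure.
- by rewrite [supp _]/(set_shift x T.1) interior_shift closure_shift -[T.1]/(supp T) -Tcl.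
Qed.

Lemma tile_interior_neq0 T : is_tile T -> exists x, (supp T)° x.
Proof.
move=> [[y Ty] _ Tcl]; apply: contrapT => h.
suff : closure (supp T)° y.
  move=> /(_ setT) [|z [Tz _]]; first exact: filterT.
  by apply: h; exists z.
by rewrite -Tcl.
Qed.

(** A nonzero period would put all [y + x *+ n] in the support, against boundedness. *)
Lemma tile_shift_fix x T : is_tile T -> tile_shift x T = T -> x = 0.
Proof.
move=> [[y Ty] cT _] /(congr1 fst)/= hS; have [k hk] := compact_norm_bound cT.
have it n : supp T (y + x *+ n).
  elim: n => [|n ih]; first by rewrite addr0.
  by rewrite /supp -hS; exists (y + x *+ n) => //; rewrite mulrSr addrA.
apply/eqP; rewrite -normr_eq0; apply: contrapT => /negP x0.
have {}x0 : 0 < `|x| by rewrite lt_neqAle eq_sym x0 normr_ge0.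
pose n := (Num.trunc ((k + `|y|) / `|x|)).+1.
have : (k + `|y|) / `|x| < n%:R by exact: truncnS_gt.
rewrite ltr_pdivrMr// mulr_natl -normrMn; apply/negP; rewrite -leNgt.
have := hk _ (it n); have := ler_normB (y + x *+ n) y; rewrite addrC addKr; lra.
Qed.

Lemma interior_tile_shift x T z : (supp (tile_shift x T))° z <-> (supp T)° (z - x).
Proof. by rewrite [supp _]/(set_shift x T.1) interior_shift set_shiftE. Qed.

Lemma patch_tile_eq P T T' z : is_patch P -> P T -> P T' ->
  (supp T)° z -> (supp T')° z -> T = T'.
Proof. by move=> [_ tP] PT PT' h h'; apply: (tP _ _ PT PT'); exists z. Qed.

End TileGeometry.

(** * Positions of tiles, digits, and composition of substitutions *)

Section Substitutions.
Variables (R : realType) (d : nat) (L : finType) (na : nat).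
Variable A : 'I_na -> tile R d L.
Hypothesis hA : is_alphabet A.
Local Notation E := 'rV[R]_d.
Implicit Types (x y t s : E) (i j : 'I_na) (P : tile_patch R d L).
Implicit Types (rho : substitution A).

(** Prototiles are not translates of one another and have no periods, so positions and digits encode
    tiles faithfully. *)
Lemma alphabet_shift_inj i j x y :
  tile_shift x (A i) = tile_shift y (A j) -> i = j /\ x = y.
Proof.
move=> /tile_shift_eq h; have ij := hA.2 _ _ _ h; split => //.
move: h; rewrite -ij => /esym /(tile_shift_fix (hA.1 i)) /eqP.
by rewrite subr_eq0 => /eqP.
Qed.

Definition positions P i : set E := [set t | P (tile_shift t (A i))].

Lemma rule_interior rho j x T z : patch_shift (expansion rho x) (rule rho j) T ->
  (supp T)° z -> exists2 y, (supp (tile_shift x (A j)))° y & expansion rho y = z.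
Proof.
move=> [T' rT' <-]; apply: interior_expanding_image; first exact: expansionP.
move=> _ [y Ty <-]; have : patch_supp (rule rho j) y by exists T'.
by rewrite rule_supp => -[v Av <-]; exists (v + x); [exists v|rewrite linearD].
Qed.

(** The common interior point is pulled back by the injective expansion to a common interior point
    of two tiles of [P], which therefore coincide. *)
Lemma subst_ancestor rho P j j' x x' T T' z : is_patch P ->
  P (tile_shift x (A j)) -> P (tile_shift x' (A j')) ->
  patch_shift (expansion rho x) (rule rho j) T ->
  patch_shift (expansion rho x') (rule rho j') T' ->
  (supp T)° z -> (supp T')° z -> j = j' /\ x = x'.
Proof.
move=> pP Pj Pj' hT hT' Tz T'z; apply: alphabet_shift_inj.
have [y hy yz] := rule_interior hT Tz; have [y' hy' yz'] := rule_interior hT' T'z.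
apply: (patch_tile_eq pP Pj Pj' hy).
by rewrite (@expanding_inj _ _ (expansion rho) (expansionP rho) y y')// yz yz'.
Qed.

Lemma subst_Apatch rho P : is_Apatch A P -> is_Apatch A (subst rho P).
Proof.
move=> [pP PA].
have tr T : subst rho P T -> exists i x, T = tile_shift x (A i).
  move=> [j [x [_ [T' rT' <-]]]]; have [_ /(_ _ rT')[i [y ->]]] := rule_Apatch rho j.
  by exists i, (y + expansion rho x); rewrite tile_shiftD.
split => //; split=> [T /tr[i [x ->]]|]; first exact: is_tile_shift (hA.1 i).
move=> T T' [j [x [Pj hT]]] [j' [x' [Pj' hT']]] [z [Tz T'z]].
have [jj xx] := subst_ancestor pP Pj Pj' hT hT' Tz T'z.
subst j' x'; move: hT hT' Tz T'z => [S rS <-] [S' rS' <-].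
move=> /interior_tile_shift h /interior_tile_shift h'.
by congr tile_shift; exact: patch_tile_eq (rule_Apatch rho j).1 rS rS' h h'.
Qed.

Lemma positions_subst rho P i t :
  positions (subst rho P) i t <->
  exists j y s, [/\ positions P j y, digits rho i j s & t = expansion rho y + s].
Proof.
split=> [[j [y [Py [T' rT' T'E]]]]|[j [y [s [Py rs ->]]]]].
  have [_ /(_ _ rT')[i' [s sE]]] := rule_Apatch rho j.
  move: T'E; rewrite sE tile_shiftD => /alphabet_shift_inj[ii st].
  exists j, y, s; split => //; last by rewrite addrC.
  by rewrite /digits /= -ii -sE.
exists j, y; split => //; exists (tile_shift s (A i)) => //.
by rewrite tile_shiftD addrC.
Qed.

(** The tile at the common position has interior points, so [subst_ancestor] applies to it as a
    child of both ancestors. *)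
Lemma positions_subst_inj rho P i j j' y y' s s' : is_patch P ->
  positions P j y -> positions P j' y' -> digits rho i j s -> digits rho i j' s' ->
  expansion rho y + s = expansion rho y' + s' -> [/\ j = j', y = y' & s = s'].
Proof.
move=> pP Py Py' hs hs' e.
have [z hz] := tile_interior_neq0 (is_tile_shift (expansion rho y + s) (hA.1 i)).
have h : patch_shift (expansion rho y) (rule rho j) (tile_shift (expansion rho y + s) (A i)).
  by exists (tile_shift s (A i)) => //; rewrite tile_shiftD addrC.
have h' : patch_shift (expansion rho y') (rule rho j') (tile_shift (expansion rho y + s) (A i)).
  by rewrite e; exists (tile_shift s' (A i)) => //; rewrite tile_shiftD addrC.
have [jj yy] := subst_ancestor pP Py Py' h h' hz hz.
by split => //; move: e; rewrite yy => /addrI.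
Qed.

Lemma alphabet_radius : exists2 k : R, 0 < k &
  forall i x, supp (A i) x -> `|x| <= k.
Proof.
have h i : exists k : R, forall x, supp (A i) x -> `|x| <= k.
  by apply: compact_norm_bound; have [_ ? _] := hA.1 i.
have [k hk] := choice h; exists (1 + \sum_i `|k i|).
  by rewrite ltr_wpDr// sumr_ge0.
move=> i x Aix; apply: le_trans (hk i x Aix) _; rewrite (bigD1 i)//= addrCA.
by apply: le_trans (ler_norm _) _; rewrite lerDl addr_ge0// sumr_ge0.
Qed.

(** A single inner radius [q] for all prototiles. It fixes the scale of packing, the separation of
    positions and the size of the bump. *)
Lemma alphabet_cube : exists2 q : R, 0 < q & forall i, exists p,
  forall x, `|p - x| < q -> (supp (A i))° x.
Proof.
have h i : exists qp : R * E, 0 < qp.1 /\ forall x, `|qp.2 - x| < qp.1 -> (supp (A i))° x.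
  have [p hp] := tile_interior_neq0 (hA.1 i).
  have [e e0 he] := (@nbhs_rowP _ _ p ((supp (A i))°)).1 (nbhs_interior hp).
  by exists (e, p).
have [f hf] := choice h.
exists (\big[Num.min/1]_i (f i).1).
  by apply/bigmin_gtP; split => // i _; exact: (hf i).1.
move=> i; exists (f i).2 => x xq; apply: (hf i).2; apply: lt_le_trans xq _.
exact: bigmin_le.
Qed.

Section separation.
Variables (q : R) (q0 : 0 < q).
Hypothesis hq : forall i, exists p, forall x, `|p - x| < q -> (supp (A i))° x.

(** If [p] is the centre of an inner cube of [A i], both tiles have [z + p] in their interior. *)
Lemma positions_disjoint P i x y z : is_patch P ->
  positions P i x -> positions P i y -> `|z - x| < q -> `|z - y| < q -> x = y.
Proof.
move=> pP Px Py zx zy; have [p hp] := hq i.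
suff /alphabet_shift_inj[] : tile_shift x (A i) = tile_shift y (A i) by [].
apply: (patch_tile_eq pP Px Py (z := z + p)); apply/interior_tile_shift; apply: hp.
  by rewrite (_ : p - _ = x - z) 1?distrC//; apply/rowP => k; rewrite !mxE; ring.
by rewrite (_ : p - _ = y - z) 1?distrC//; apply/rowP => k; rewrite !mxE; ring.
Qed.

Lemma positions_separated P i x y : is_patch P ->
  positions P i x -> positions P i y -> x != y -> q <= `|x - y|.
Proof.
move=> pP Px Py xy; rewrite leNgt; apply: contra xy => h; apply/eqP.
by apply: (positions_disjoint pP Px Py (z := x)); rewrite ?subrr ?normr0.
Qed.
End separation.

Lemma separated_finite (S : set E) (q k : R) : 0 < q ->
  (forall x, S x -> `|x| <= k) ->
  (forall x y, S x -> S y -> x != y -> q <= `|x - y|) -> finite_set S.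
Proof.
move=> q0 Sk sep; apply: contrapT => infS.
have q2 : 0 < q / 2 by rewrite divr_gt0.
have k0 : 0 < `|k| + q by rewrite ltr_wpDl.
pose W : set E := ocube 0 (`|k| + q).
pose V := fine (lebesgue_Rd (W : set (borelRd R d))) / q ^+ d.
have [B BS Bn] := infinite_set_fset (Num.trunc V).+1 infS.
have mU : measurable (ocube 0 (q / 2) : set (borelRd R d)) by exact: measurable_obox.
have mW : measurable (W : set (borelRd R d)) by exact: measurable_obox.
have := @packing R d B _ _ mU mW (fset_uniq B).
rewrite lebesgue_ocube ?(ltW q2)// (_ : 2 * (q / 2) = q); last by field.
rewrite -[lebesgue_Rd W]fineK; last by rewrite ge0_fin_numE// lebesgue_obox_lty.
rewrite -EFinM lee_fin => h; suff : (size B)%:R <= V.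
  apply/negP; rewrite -ltNge; apply: (@lt_le_trans _ _ (Num.trunc V).+1%:R).
    exact: truncnS_gt.
  by rewrite ler_nat.
rewrite ler_pdivlMr ?exprn_gt0//; apply: h => [x y xB yB xy|x xB z].
  apply/seteqP; split=> z //= [/ocube0E - /(_ q2) h1 /ocube0E - /(_ q2) h2].
  have := sep x y (BS _ xB) (BS _ yB) xy; apply/negP; rewrite -ltNge.
  rewrite (_ : x - y = (z - y) - (z - x)); last by apply/rowP => k'; rewrite !mxE; ring.
  by apply: le_lt_trans (ler_normB _ _) _; lra.
move=> /ocube0E - /(_ q2) h1; apply/(@ocube0E R d _ _ k0).
rewrite -(subrK x z); apply: le_lt_trans (ler_normD _ _) _.
have := Sk x (BS _ xB); have := ler_norm k; lra.
Qed.

Lemma positions_finite P i (r : R) : is_patch P ->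
  finite_set [set t | positions P i t /\ enorm t <= r].
Proof.
move=> pP; have [q q0 hq] := alphabet_cube.
apply: (@separated_finite _ q r q0).
  by move=> x [_ xr]; apply: le_trans xr; exact: norm_le_enorm.
by move=> x y [Px _] [Py _]; exact: (positions_separated q0 hq pP Px Py).
Qed.

(** The tile [A i + s] lies inside the expanded support of [A j], which is bounded. *)
Lemma digits_bounded rho : exists2 c : R, 0 < c &
  forall i j s, digits rho i j s -> enorm s <= c.
Proof.
have [k k0 hk] := alphabet_radius; have [m m0 hm] := linear_bound (expansion rho).
exists (d%:R * (m * k + k) + 1).
  by rewrite ltr_wpDl// mulr_ge0// addr_ge0 ?mulr_ge0 ?ltW.
move=> i j s hs; apply: le_trans (enorm_le_norm s) _.
apply: (@le_trans _ _ (d%:R * (m * k + k))); last by rewrite lerDl.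
rewrite ler_wpM2l//; have [[y Ay] _ _] := hA.1 i.
have : patch_supp (rule rho j) (y + s) by exists (tile_shift s (A i)) => //; exists y.
rewrite rule_supp => -[v /hk vk vE].
rewrite -(addKr y s) addrC -vE; apply: le_trans (ler_normB _ _) _.
apply: lerD; last exact: hk Ay.
by apply: le_trans (hm _) _; rewrite ler_pM2l.
Qed.

Lemma digits_finite rho i j : finite_set (digits rho i j).
Proof.
have [c c0 hc] := digits_bounded rho.
apply: (sub_finite_set _ (@positions_finite (rule rho j) i c (rule_Apatch rho j).1)).
by move=> s hs; split => //; exact: hc hs.
Qed.

Lemma Apatch_shift x P : is_Apatch A P -> is_Apatch A (patch_shift x P).
Proof.
move=> [[Pt tP] PA]; split.
  split=> [_ [T PT <-]|]; first by apply: is_tile_shift; exact: Pt.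
  move=> _ _ [T PT <-] [T' PT' <-] [z [/interior_tile_shift h /interior_tile_shift h']].
  by congr tile_shift; apply: tP => //; exists (z - x).
move=> _ [T PT <-]; have [i [y ->]] := PA _ PT.
by exists i, (y + x); rewrite tile_shiftD.
Qed.

Lemma single_Apatch j : is_Apatch A [set A j].
Proof.
split; first split.
- by move=> _ ->; exact: hA.1.
- by move=> _ _ -> ->.
by move=> _ ->; exists j, 0; rewrite tile_shift0.
Qed.

Lemma sub_Apatch P Q : is_Apatch A Q -> P `<=` Q -> is_Apatch A P.
Proof.
move=> [[Qt tQ] QA] PQ; split; last by move=> T /PQ /QA.
by split=> [T /PQ /Qt//|T T' /PQ QT /PQ QT']; exact: tQ.
Qed.

Section words.
Variables (ma : nat) (rho : 'I_ma -> substitution A).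

Lemma subst_word_Apatch (s : seq 'I_ma) P : is_Apatch A P -> is_Apatch A (subst_word rho s P).
Proof. by move=> hP; elim: s => //= j s ih; exact: subst_Apatch. Qed.

Lemma legal_Apatch P : legal rho P -> is_Apatch A P.
Proof.
move=> [_ [j [s [x [_ sub]]]]]; apply: sub_Apatch sub; apply: Apatch_shift.
by apply: subst_word_Apatch; exact: single_Apatch.
Qed.
End words.

Section composition.
Variables rho1 rho2 : substitution A.

Definition comp_rule j := subst rho1 (rule rho2 j).

Lemma comp_rule_Apatch j : is_Apatch A (comp_rule j).
Proof. by apply: subst_Apatch; exact: rule_Apatch. Qed.

Lemma patch_supp_subst rho P : is_Apatch A P ->
  patch_supp (subst rho P) = expansion rho @` patch_supp P.
Proof.
move=> [_ PA]; apply/seteqP; split=> [z [T [j [x [Px [T' rT' <-]]]]]|].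
  move=> [y Ty <-]; have : patch_supp (rule rho j) y by exists T'.
  rewrite rule_supp => -[v Av <-]; exists (v + x); last by rewrite linearD.
  by exists (tile_shift x (A j)) => //; exists v.
move=> _ [v [T PT Tv] <-]; have [j [x TE]] := PA _ PT; move: Tv; rewrite TE => -[y Ay <-].
have : patch_supp (rule rho j) (expansion rho y) by rewrite rule_supp; exists y.
move=> [T' rT' T'y]; exists (tile_shift (expansion rho x) T').
  by exists j, x; split; [rewrite -TE|exists T'].
by exists (expansion rho y) => //; rewrite linearD.
Qed.

Lemma comp_rule_supp j :
  patch_supp (comp_rule j) = (expansion rho1 \o expansion rho2 : {linear E -> E}) @` supp (A j).
Proof.
rewrite patch_supp_subst; last exact: rule_Apatch.
by rewrite rule_supp image_comp.
Qed.

(** Packaging a composition as one substitution allows the estimate of the diffraction measure to be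
    proved for a single [sigma] and then applied at every level. *)
Definition subst_comp : substitution A :=
  Substitution (is_expanding_comp (expansionP rho1) (expansionP rho2))
    comp_rule_Apatch comp_rule_supp.

Lemma digits_comp i j t : digits subst_comp i j t <->
  exists k y s, [/\ digits rho2 k j y, digits rho1 i k s & t = expansion rho1 y + s].
Proof. exact: positions_subst. Qed.

Lemma subst_compE P : subst subst_comp P = subst rho1 (subst rho2 P).
Proof.
have aux T : (exists j x, P (tile_shift x (A j)) /\
      exists i t, digits subst_comp i j t /\ T = tile_shift (t + expansion rho1 (expansion rho2 x)) (A i))
   -> subst rho1 (subst rho2 P) T.
  move=> [j [x [Px [i [t [/digits_comp[k [y [s [hy hs ->]]]] ->]]]]]].
  exists k, (expansion rho2 x + y); split.
    exists j, x; split => //; exists (tile_shift y (A k)) => //.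
    by rewrite tile_shiftD addrC.
  exists (tile_shift s (A i)) => //; rewrite tile_shiftD linearD; congr tile_shift.
  by apply/rowP => l; rewrite !mxE; ring.
apply/seteqP; split=> T.
  move=> [j [x [Px [T' rT' <-]]]]; apply: aux; exists j, x; split => //.
  have [_ /(_ _ rT')[i [t T'E]]] := comp_rule_Apatch j.
  exists i, t; split; first by rewrite /digits /= -T'E.
  by rewrite T'E tile_shiftD.
move=> [k [y [[j [x [Px [T2 r2 T2E]]]] [T1 r1 <-]]]].
have [_ /(_ _ r2)[k' [y' T2E']]] := rule_Apatch rho2 j.
have [_ /(_ _ r1)[i [s T1E]]] := rule_Apatch rho1 k.
move: T2E; rewrite T2E' tile_shiftD => /alphabet_shift_inj[kk yy].
exists j, x; split => //; exists (tile_shift (expansion rho1 y' + s) (A i)).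
  apply/digits_comp; exists k, y', s; split => //.
    by rewrite /digits /= -kk -T2E'.
  by rewrite /digits /= -T1E.
rewrite tile_shiftD T1E tile_shiftD -yy linearD; congr tile_shift.
by apply/rowP => l; rewrite !mxE; ring.
Qed.
End composition.

End Substitutions.

(** The monoid structure gives access to the big-operator lemmas that split off the last factor of
    the noncommutative product [fourier_prod]. *)
HB.instance Definition _ (K : pzSemiRingType) n :=
  Monoid.isLaw.Build 'M[K]_n 1%:M (@mulmx K n n n) (@mulmxA K n n n n)
    (@mul1mx K n n) (@mulmx1 K n n).

(** * Products of Fourier matrices as Fourier matrices of compositions *)

Section FourierComposition.
Variables (R : realType) (d : nat) (L : finType) (na : nat).
Variable A : 'I_na -> tile R d L.
Hypothesis hA : is_alphabet A.
Local Notation E := 'rV[R]_d.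
Implicit Types (rho : substitution A) (t : E) (i j : 'I_na).

Definition digit_seq rho i j : seq E := fset_set (digits rho i j).

Lemma mem_dig rho i j s : s \in digit_seq rho i j -> digits rho i j s.
Proof. by rewrite in_fset_set ?inE//; [exact: set_mem|exact: digits_finite]. Qed.

Lemma dig_mem rho i j s : digits rho i j s -> s \in digit_seq rho i j.
Proof. by move=> h; rewrite in_fset_set ?inE//; [exact: mem_set|exact: digits_finite]. Qed.

Lemma fourier_mxE rho t i j : fourier_mx rho t i j = csum (digit_seq rho i j) t.
Proof. by rewrite mxE fsbig_finite//; exact: digits_finite. Qed.

(** The list counterpart of [\sum_j B_ij X_j], with the positions [X_j] given by [Y j] before
    expansion. *)
Definition expand_list rho (Y : 'I_na -> seq E) i : seq E :=
  [seq expansion rho p.1 + p.2 | j <- enum 'I_na,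
     p <- [seq (y, s) | y <- Y j, s <- digit_seq rho i j]].

Lemma expand_list_sum (V : nmodType) rho Y i (F : E -> V) :
  \sum_(z <- expand_list rho Y i) F z =
  \sum_j \sum_(y <- Y j) \sum_(s <- digit_seq rho i j) F (expansion rho y + s).
Proof.
rewrite /expand_list big_allpairs_dep /= big_enum /=; apply: eq_bigr => j _.
by rewrite big_allpairs_dep.
Qed.

Lemma mem_expand_list rho Y i z : z \in expand_list rho Y i <->
  exists j y s, [/\ y \in Y j, digits rho i j s & z = expansion rho y + s].
Proof.
split=> [/allpairsPdep[j [p [_ /allpairsP[[y s] /= [yY sD ->]] ->]]]|].
  by exists j, y, s; split => //; exact: mem_dig.
move=> [j [y [s [yY sD ->]]]]; apply/allpairsPdep; exists j, (y, s).
split; [by rewrite mem_enum| |by []].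
by apply/allpairsP; exists (y, s); split => //; exact: dig_mem.
Qed.

Lemma expand_list_uniq rho P Y i : is_patch P -> (forall j, uniq (Y j)) ->
  (forall j y, y \in Y j -> positions A P j y) -> uniq (expand_list rho Y i).
Proof.
move=> pP uY YP; apply: allpairs_uniq_dep => [|j _|].
- exact: enum_uniq.
- apply: allpairs_uniq; [exact: uY|exact: fset_uniq|].
  by move=> [? ?] [? ?] _ _ /= [-> ->].
move=> _ _ /allpairsPdep[j [p [_ hp ->]]] /allpairsPdep[j' [p' [_ hp' ->]]] /=.
have /allpairsP[[y s] /= [yY sD ->]] := hp.
have /allpairsP[[y' s'] /= [yY' sD' ->]] := hp'.
move=> /(positions_subst_inj hA pP (YP _ _ yY) (YP _ _ yY') (mem_dig sD) (mem_dig sD')).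
by move=> [-> -> ->].
Qed.

Lemma dotp_adjoint (f : {linear E -> E}) (y t : E) : dotp (f y) t = dotp y (adjoint f t).
Proof.
have e (u v : E) : dotp u v = (u *m v^T) ord0 ord0.
  by rewrite /dotp mxE; apply: eq_bigr => k _; rewrite mxE.
by rewrite !e /adjoint trmx_mul trmxK mulmxA -lin1_mxE.
Qed.

Lemma cisD (a b : R) : cis (a + b) = cis a * cis b.
Proof. by rewrite /cis; simpc; rewrite cosD sinD; congr Complex; ring. Qed.

(** Digits of the composition decompose uniquely as [expansion rho1 y + s]. The exponential of a sum
    factors, and [dotp_adjoint] moves the expansion onto [t]. *)
Lemma fourier_mx_comp rho1 rho2 t :
  fourier_mx (subst_comp hA rho1 rho2) t =
  fourier_mx rho1 t *m fourier_mx rho2 (adjoint (expansion rho1) t).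
Proof.
apply/matrixP => i j; rewrite fourier_mxE [RHS]mxE.
under eq_bigr => k _ do rewrite !fourier_mxE.
have -> : csum (digit_seq (subst_comp hA rho1 rho2) i j) t =
    csum (expand_list rho1 (fun k => digit_seq rho2 k j) i) t.
  apply: perm_big; apply: uniq_perm.
  - exact: fset_uniq.
  - apply: (@expand_list_uniq rho1 (rule rho2 j)); first by have [] := rule_Apatch rho2 j.
      by move=> k; exact: fset_uniq.
    by move=> k y; exact: mem_dig.
  move=> z; apply/idP/idP => [/mem_dig/(digits_comp hA)[k [y [s [hy hs ->]]]]|].
    by apply/mem_expand_list; exists k, y, s; split => //; exact: dig_mem.
  move=> /mem_expand_list[k [y [s [/mem_dig hy hs ->]]]]; apply: dig_mem.
  by apply/(digits_comp hA); exists k, y, s.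
rewrite /csum expand_list_sum; apply: eq_bigr => k _.
rewrite mulrC mulr_suml; apply: eq_bigr => y _; rewrite mulr_sumr; apply: eq_bigr => s _.
by rewrite angD cisD /phase dotp_adjoint.
Qed.

Lemma lin1_mx_comp (f g : {linear E -> E}) :
  lin1_mx (f \o g : {linear E -> E}) = lin1_mx g *m lin1_mx f.
Proof.
by apply/row_matrixP => k; rewrite !rowE mulmxA !mul_rV_lin1.
Qed.

Lemma ldet_comp (f g : {linear E -> E}) :
  ldet (f \o g : {linear E -> E}) = ldet f * ldet g.
Proof. by rewrite /ldet lin1_mx_comp det_mulmx mulrC. Qed.

Lemma adjoint_comp (f g : {linear E -> E}) t :
  adjoint (f \o g : {linear E -> E}) t = adjoint g (adjoint f t).
Proof. by rewrite /adjoint lin1_mx_comp trmx_mul mulmxA. Qed.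

Section iterates.
Variables (ma : nat) (rho : 'I_ma -> substitution A) (i : nat -> 'I_ma).

(** Composes the first [n.+1] substitutions; there is no identity substitution
    to start from, as expansion maps are strictly expanding. *)
Fixpoint comp_upto n : substitution A :=
  if n is n'.+1 then subst_comp hA (comp_upto n') (rho (i n)) else rho (i 0%N).

Lemma adj_orbit_comp t n : adj_orbit rho i t n.+1 = adjoint (expansion (comp_upto n)) t.
Proof.
elim: n => [//|n ih]; rewrite [LHS]/= -[adjoint _ (adj_orbit _ _ _ _)]/(adj_orbit rho i t n.+1) ih.
by rewrite /= adjoint_comp.
Qed.

Lemma fourier_prod_comp t n : fourier_prod rho i t n.+1 = fourier_mx (comp_upto n) t.
Proof.
elim: n => [|n ih]; first by rewrite /fourier_prod big_ord_recr big_ord0 /= mul1mx.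
rewrite /fourier_prod big_ord_recr -/(fourier_prod rho i t n.+1) ih /=.
rewrite -[adjoint _ _]/(adj_orbit rho i t n.+1) adj_orbit_comp.
by rewrite fourier_mx_comp.
Qed.

Lemma ldet_comp_upto n :
  \prod_(j < n.+1) `|ldet (expansion (rho (i j)))| = `|ldet (expansion (comp_upto n))|.
Proof.
elim: n => [|n ih]; first by rewrite big_ord1.
by rewrite big_ord_recr ih /= ldet_comp normrM.
Qed.

Lemma subst_from_comp n m P : (n < m)%N ->
  subst_from rho i 0 m P = subst (comp_upto n) (subst_from rho i n.+1 m P).
Proof.
elim: n => [|n ih] nm.
  rewrite /subst_from /index_iota subn0; case: m nm => // m _.
  by rewrite /= subn1.
rewrite ih; last exact: ltnW.
rewrite /= subst_compE; congr subst.
rewrite {1}/subst_from /index_iota; have -> : (m - n.+1 = (m - n.+2).+1)%N by rewrite subnSK.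
by [].
Qed.
End iterates.

End FourierComposition.

(** * The estimate for one substitution *)

Section LocalDecomposition.
Variables (R : realType) (d : nat) (L : finType) (na : nat).
Variable A : 'I_na -> tile R d L.
Hypothesis hA : is_alphabet A.
Variable T : tile_patch R d L.
Local Notation E := 'rV[R]_d.
Local Notation B := (borelRd R d).
Local Notation leb := (@lebesgue_Rd R d).
Implicit Types (sigma : substitution A) (P : tile_patch R d L) (x y z t p : E).

(** What the S-adic limit provides at one level: on each ball, [T] agrees up to small shifts with a
    substituted patch. The patch [P] depends on the ball and plays the part of the de-substituted
    tiling. *)
Definition approximable sigma := forall r : R, 0 < r -> exists P x y,
  [/\ is_Apatch A P, enorm x < 1, enorm y < 1 &
      inside (patch_shift x (subst sigma P)) (eball r) =
      inside (patch_shift y T) (eball r)].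

Lemma tile_points_finite i r : is_patch T -> finite_set (tile_points A T i r).
Proof. by move=> pT; exact: (positions_finite hA). Qed.

Lemma patch_shift_tile x P i t :
  patch_shift x P (tile_shift (t + x) (A i)) <-> P (tile_shift t (A i)).
Proof.
split=> [[T' PT' e]|Pt]; last by exists (tile_shift t (A i)); rewrite ?tile_shiftD.
have -> : tile_shift t (A i) = T'; last by [].
rewrite -[RHS]tile_shift0 -(subrr x) -[tile_shift (_ - _) _]tile_shiftD e tile_shiftD.
by rewrite addrK.
Qed.

(** [Y] lists the positions of [P] whose expansions fall near the ball, and [z] reconciles the two
    small shifts. Substituting [Y] recovers all points of [T] in the ball; the surplus lies in a
    shell whose thickness [c] may depend on [sigma] but not on [r]. *)
Lemma local_decomposition sigma : approximable sigma ->
  exists2 c : R, 0 < c & forall r : R, 0 < r -> exists P z (Y : 'I_na -> seq E),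
  [/\ is_Apatch A P, forall j, uniq (Y j),
      forall j y, y \in Y j -> positions A P j y /\ enorm (expansion sigma y) <= r + c &
      forall i, (forall t, tile_points A T i r t -> t + z \in expand_list sigma Y i) /\
        forall p, p \in expand_list sigma Y i -> ~ tile_points A T i r (p - z) ->
          r < enorm (p - z) <= r + c].
Proof.
move=> app; have [cd cd0 hcd] := digits_bounded hA sigma.
have [k k0 hk] := alphabet_radius hA.
(* Positions kept in [Y] expand to within [r + 2 + cd]; a digit adds [cd] and the shift [z] adds
   [2]. *)
exists (4 + 2 * cd); first by rewrite addr_gt0// mulr_gt0.
move=> r r0; have dk0 : 0 <= d%:R * k by rewrite mulr_ge0// ltW.
(* The radius leaves room for the extent [d k] of a tile placed in the ball and for the shift
   [y]. *)
have [|P [x [y [PA x1 y1 agree]]]] := app (r + (d%:R * k + 2)).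
  by rewrite addr_gt0// ltr_wpDl.
pose z := y - x.
have z2 : enorm z <= 2.
  by apply: le_trans (enormD _ _) _; rewrite enormN; lra.
have fe := expansionP sigma.
have finY j : finite_set [set u | positions A P j u /\ enorm (expansion sigma u) <= r + 2 + cd].
  apply: (sub_finite_set _ (@positions_finite _ _ _ _ A hA P j (r + 2 + cd) PA.1)).
  by move=> u [Pu uc]; split => //; apply: le_trans uc; exact: expanding_le.
pose Y j : seq E := fset_set [set u | positions A P j u /\ enorm (expansion sigma u) <= r + 2 + cd].
have memY j u : u \in Y j <-> positions A P j u /\ enorm (expansion sigma u) <= r + 2 + cd.
  by rewrite /Y in_fset_set//; split=> [/set_mem|?]; last exact/mem_set.
have tile_in i t : enorm t <= r -> supp (tile_shift (t + y) (A i)) `<=` eball (r + (d%:R * k + 2)).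
  move=> tr _ [a Aa <-]; rewrite /eball /=.
  apply: le_trans (enormD _ _) _; apply: (@le_trans _ _ (d%:R * k + (r + 1))).
    apply: lerD; first by apply: le_trans (enorm_le_norm _) _; rewrite ler_wpM2l// (hk i).
    by apply: le_trans (enormD _ _) _; lra.
  lra.
have agreeP i t : enorm t <= r ->
    (T (tile_shift t (A i)) <-> positions A (subst sigma P) i (t + z)).
  move=> tr; have e : t + z + x = t + y by rewrite /z -addrA subrK.
  split=> [Tt|Pt].
    have : inside (patch_shift y T) (eball (r + (d%:R * k + 2))) (tile_shift (t + y) (A i)).
      by split; [exact/patch_shift_tile|exact: tile_in].
    by rewrite -agree -e => -[/patch_shift_tile].
  have : inside (patch_shift x (subst sigma P)) (eball (r + (d%:R * k + 2))) (tile_shift (t + y) (A i)).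
    by split; [rewrite -e; exact/patch_shift_tile|exact: tile_in].
  by rewrite agree => -[/patch_shift_tile].
exists P, z, Y; split.
- exact: PA.
- by move=> j; exact: fset_uniq.
- by move=> j u /memY[Pu uc]; split => //; apply: le_trans uc _; lra.
move=> i; split=> [t [Tt tr]|p /mem_expand_list - /(_ hA)[j [u [s [/memY[Pu uc] hs pE]]]] np].
  have /(positions_subst hA)[j [u [s [Pu hs e]]]] := (agreeP i t tr).1 Tt.
  apply/(mem_expand_list hA); exists j, u, s; split => //; apply/memY; split => //.
  have -> : expansion sigma u = t + z - s by rewrite e addrK.
  apply: le_trans (enormD _ _) _; rewrite enormN; have := enormD t z.
  by have := hcd _ _ _ hs; have : enorm t <= r by []; lra.
have pp : positions A (subst sigma P) i p by apply/(positions_subst hA); exists j, u, s.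
apply/andP; split.
  rewrite ltNge; apply/negP => pr; apply: np; split => //.
  by apply/(agreeP i _ pr); rewrite subrK.
apply: le_trans (enormD _ _) _; rewrite enormN pE.
by have := enormD (expansion sigma u) s; have := hcd _ _ _ hs; lra.
Qed.

Variables (q : R) (q0 : 0 < q).
Hypothesis hq : forall i, exists p, forall x, `|p - x| < q -> (supp (A i))° x.

(** The disjoint cubes around the positions are carried by the expansion to disjoint sets of volume
    [|det| (2 q)^d]. This is the origin of the factor [1 / |det|]. *)
Lemma count_preimages sigma : exists2 c : R, 0 < c &
  forall P j (l : seq E) (r : R), is_patch P -> uniq l ->
  (forall y, y \in l -> positions A P j y /\ enorm (expansion sigma y) <= r) ->
  (size l)%:R * (`|ldet (expansion sigma)| * (2 * q) ^+ d) <= evol d (r + c).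
Proof.
have fe := expansionP sigma; have [k k0 hk] := linear_bound (expansion sigma).
exists (d%:R * (k * q) + 1); first by rewrite ltr_wpDl// !mulr_ge0// ltW.
move=> P j l r pP ul hl; set M := lin1_mx (expansion sigma).
have uM : M \in unitmx by exact: expanding_unit.
have uiM : invmx M \in unitmx by rewrite unitmx_inv.
pose U : set B := [set x : E | ocube 0 q (x *m invmx M)].
have mU : measurable U.
  exact: (@measurable_preimage_mulmx R d (invmx M) (ocube 0 q) (measurable_obox _ _)).
have mW : measurable (eball (r + (d%:R * (k * q) + 1)) : set B) by exact: measurable_eball.
have lebU : leb U = (`|ldet (expansion sigma)| * (2 * q) ^+ d)%:E.
  rewrite /U (scales_volume_det uiM (measurable_obox _ _)) lebesgue_ocube ?(ltW q0)//.
  by rewrite -EFinM det_inv normfV invrK.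
pose l' := map (expansion sigma) l.
have ul' : uniq l' by rewrite map_inj_uniq//; exact: expanding_inj.
have Uz z y : U (z - expansion sigma y) -> `|z *m invmx M - y| < q.
  by move=> /ocube0E - /(_ q0); rewrite mulmxBl lin1_mxE mulmxK.
have := @packing R d l' U _ mU mW ul'.
rewrite lebU evolE -EFinM lee_fin size_map; apply.
  move=> _ _ /mapP[x xl ->] /mapP[y yl ->] xy; apply/seteqP; split=> z //= [/Uz h1 /Uz h2].
  move/eqP: xy; apply; congr (expansion sigma _).
  exact: (positions_disjoint hA hq pP (hl x xl).1 (hl y yl).1 h1 h2).
move=> _ /mapP[x xl ->] z /Uz h; rewrite /eball /=.
have -> : z = expansion sigma x + expansion sigma (z *m invmx M - x).
  by rewrite -linearD addrC subrK lin1_mxE mulmxKV.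
apply: le_trans (enormD _ _) _; apply: lerD; first exact: (hl x xl).2.
apply: (@le_trans _ _ (d%:R * (k * q))); last by rewrite lerDl.
apply: le_trans (enorm_le_norm _) _; rewrite ler_wpM2l//.
by apply: le_trans (hk _) _; rewrite ler_pM2l// ltW.
Qed.

(** Packing in a thickened shell. There is no factor [1 / |det|], but a difference of volumes of
    this kind is negligible against the ball as [r] grows. *)
Lemma count_annulus P i (l : seq E) z (r c : R) : is_patch P -> uniq l ->
  (forall p, p \in l -> positions A P i p) ->
  (forall p, p \in l -> r < enorm (p - z) <= r + c) -> 0 < c ->
  (size l)%:R * (2 * q) ^+ d <=
  evol d (r + (c + d%:R * q)) - evol d (r - (c + d%:R * q)).
Proof.
move=> pP ul lP lr c0; have dq0 : 0 <= d%:R * q by rewrite mulr_ge0// ltW.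
pose c' := c + d%:R * q.
pose l' := map (fun p => p - z) l.
have ul' : uniq l' by rewrite map_inj_uniq//; exact: addIr.
have mU : measurable (ocube 0 q : set B) by exact: measurable_obox.
have mb s : measurable (eball s : set B) by exact: measurable_eball.
have mW : measurable (eball (r + c') `\` eball (r - c') : set B) by exact: measurableD.
have := @packing R d l' _ _ mU mW ul'.
have -> : leb (eball (r + c') `\` eball (r - c')) = (evol d (r + c') - evol d (r - c'))%:E.
  rewrite measureD//; last by have := eball_lty d (r + c').
  rewrite setIidr; last first.
    move=> x /=; rewrite /eball /= => h; apply: le_trans h _.
    have : 0 <= c' by rewrite addr_ge0// ltW.
    lra.
  by rewrite EFinB -!evolE.
rewrite lebesgue_ocube ?(ltW q0)// -EFinM lee_fin size_map; apply.
  move=> _ _ /mapP[x xl ->] /mapP[y yl ->] xy; apply/seteqP; split=> u //=.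
  move=> [/ocube0E - /(_ q0) h1 /ocube0E - /(_ q0) h2].
  move/eqP: xy; apply; congr (_ - z).
  by apply: (positions_disjoint hA hq pP (lP x xl) (lP y yl) (z := u + z));
    [move: h1|move: h2]; rewrite opprB addrA.
move=> _ /mapP[x xl ->] u /= /ocube0E - /(_ q0) h; have /andP[h1 h2] := lr x xl.
have hu : enorm (u - (x - z)) <= d%:R * q.
  by apply: le_trans (enorm_le_norm _) _; rewrite ler_wpM2l// ltW.
rewrite /eball /=; split.
  rewrite -(subrK (x - z) u); apply: le_trans (enormD _ _) _; rewrite /c'; lra.
apply/negP; rewrite -ltNge; have := enormD u (- (u - (x - z))).
rewrite enormN subKr => h3; rewrite /c'; lra.
Qed.

End LocalDecomposition.

Section UpperEstimate.
Variables (R : realType) (d : nat) (L : finType) (na : nat).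
Variable A : 'I_na -> tile R d L.
Hypothesis hA : is_alphabet A.
Variable T : tile_patch R d L.
Hypothesis pT : is_patch T.
Local Notation E := 'rV[R]_d.
Local Notation B := (borelRd R d).
Implicit Types (sigma : substitution A) (P : tile_patch R d L) (x y z t p : E).
Implicit Types (f v : E -> R).

Lemma ip_sub_le (a b : E -> R) : Ccr a -> Ccr b ->
  ip (a - b) (a - b) <= 2 * ip a a + 2 * ip b b.
Proof.
move=> Ca Cb; have Caa := Ccr_mul Ca Ca; have Cbb := Ccr_mul Cb Cb.
rewrite /ip -!rintZ// -rintD; [|exact: CcrZ|exact: CcrZ].
apply: rint_le; first by apply: Ccr_mul; exact: CcrB.
  by apply: CcrD; exact: CcrZ.
move=> x; change ((a x - b x) * (a x - b x) <= 2 * (a x * a x) + 2 * (b x * b x)).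
by have := sqr_ge0 (a x + b x); rewrite expr2; lra.
Qed.

Definition digit_lists sigma : seq (seq E) :=
  [seq digit_seq sigma i j | i <- enum 'I_na, j <- enum 'I_na].

Lemma mem_digit_lists sigma i j : digit_seq sigma i j \in digit_lists sigma.
Proof. by apply/allpairsP; exists (i, j); rewrite /= !mem_enum. Qed.

Variables (q : R) (q0 : 0 < q).
Hypothesis hq : forall i, exists p, forall x, `|p - x| < q -> (supp (A i))° x.

Section fixed_substitution.
Variables (sigma : substitution A) (app : approximable T sigma).
Variables (f : E -> R) (Cf : Ccr f) (rad : R).
Hypothesis f_supp : forall x, f x != 0 -> `|x| < rad.
(** Separation is measured by [enorm] and supports by the sup norm, with [enorm x <= d |x|]; the
    [+ 1] keeps the factor positive. *)
Hypothesis rad_small : 2 * rad * (d%:R + 1) <= q.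
Variables (M : R) (M0 : 0 < M).
Hypothesis DM : \sum_(l <- digit_lists sigma) (size l)%:R ^+ 2 <= M.
Variable m : nat.

Let v := iter m (contr (gram M^-1 (digit_lists sigma))) f.

Let Cv : Ccr v. Proof. exact: Ccr_contr. Qed.

Let sep (l : seq E) : uniq l ->
  (forall x y, x \in l -> y \in l -> x != y -> q <= enorm (x - y)) ->
  ip (ops l f) (ops l f) = (size l)%:R * ip f f.
Proof.
move=> ul hl; have [rad0|rad0] := leP rad 0.
  have -> : f = fun=> 0.
    apply/funext => x; apply/eqP/negPn/negP => /f_supp.
    by rewrite ltNge (le_trans rad0).
  rewrite /ops /ip; under [X in rint X]eq_fun do rewrite big1 ?mul0r//.
  by under [X in _ * rint X]eq_fun do rewrite mul0r; rewrite rint0 mulr0.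
apply: (ip_ops_separated Cf ul f_supp) => x y xl yl xy.
have d1 : 0 < d%:R + 1 :> R by rewrite ltr_wpDl.
rewrite -(ler_pM2r d1); apply: le_trans rad_small _; apply: le_trans (hl x y xl yl xy) _.
apply: le_trans (enorm_le_norm _) _; rewrite mulrC ler_wpM2l// lerDl//.
Qed.

(** The points in the ball are all substituted positions minus the surplus [Bd]. The former profit
    from the decay of the filter under each [B_ij], at the cost of one [na] from Cauchy-Schwarz and
    one from the sum over [j]; for the latter the contraction bound suffices. The factors [2] come
    from [ip_sub_le]. *)
Lemma tile_sum_bound : exists c : R, 0 < c /\
  forall (r : R), 0 < r -> forall i,
  ip (ops (fset_set (tile_points A T i r)) v) (ops (fset_set (tile_points A T i r)) v) <=
  ip f f * (2 * na%:R ^+ 2 * (M / (m.*2.+1)%:R) *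
       (evol d (r + c) / (`|ldet (expansion sigma)| * (2 * q) ^+ d)) +
     2 * ((evol d (r + c) - evol d (r - c)) / (2 * q) ^+ d)).
Proof.
have [c c0 hc] := local_decomposition hA app.
have [c1 c10 hc1] := count_preimages hA q0 hq sigma.
have fe := expansionP sigma.
have dq0 : 0 <= d%:R * q by rewrite mulr_ge0// ltW.
have mono (s s' : R) : s <= s' -> evol d s <= evol d s'.
  move=> ss; rewrite -lee_fin -!evolE; apply: lebesgue_le; try exact: measurable_eball.
  by move=> x /=; rewrite /eball /= => h; exact: le_trans ss.
have q2 : 0 < (2 * q) ^+ d by rewrite exprn_gt0// mulr_gt0.
have ld0 : 0 < `|ldet (expansion sigma)| by rewrite normr_gt0 ldet_neq0.
have m0 : 0 < (m.*2.+1)%:R :> R by rewrite ltr0n.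
have ff0 := ip_ge0 f.
exists (c + c1 + d%:R * q); split; first by rewrite ltr_wpDr// addr_gt0.
move=> r r0 i; have [P [z [Y [PA uY hY hi]]]] := hc r r0; have [pP _] := PA.
have [hS hBd] := hi i.
pose W := map (fun p => p - z) (expand_list sigma Y i).
have uW : uniq W.
  rewrite map_inj_uniq; last exact: addIr.
  by apply: (@expand_list_uniq _ _ _ _ A hA sigma P Y i pP uY) => j y /hY[].
set S := fset_set _.
have memS t : t \in S <-> tile_points A T i r t.
  rewrite /S in_fset_set; last exact: tile_points_finite.
  by split=> [/set_mem|?]; last exact/mem_set.
have WP p : p \in W -> positions A (subst sigma P) i (p + z).
  move=> /mapP[p' /(mem_expand_list hA)[j [y [s [/hY[Py _] hs ->]]]] ->].
  by rewrite subrK; apply/(positions_subst hA); exists j, y, s.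
have SW t : t \in S -> t \in W.
  by move=> /memS /hS tz; apply/mapP; exists (t + z); rewrite ?addrK.
pose Bd := [seq p <- W | p \notin S].
have opsS : ops S v = ops W v - ops Bd v.
  apply/funext => x; rewrite -[RHS]/(ops W v x - ops Bd v x) /ops.
  rewrite [in RHS](bigID (fun p => p \in S))/= big_filter addrK -[in RHS]big_filter.
  apply: perm_big; apply: uniq_perm; [exact: fset_uniq|exact: filter_uniq|].
  by move=> t; rewrite mem_filter; apply/idP/andP => [tS|[]//]; split => //; exact: SW.
pose X j : seq E := map (fun u => expansion sigma u - z) (Y j).
have CF j : Ccr (ops (digit_seq sigma i j) (ops (X j) v)) by apply: Ccr_ops; exact: Ccr_ops.
have opsW : ops W v = fun x => \sum_j ops (digit_seq sigma i j) (ops (X j) v) x.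
  apply/funext => x; rewrite /ops big_map expand_list_sum; apply: eq_bigr => j _.
  rewrite exchange_big/=; apply: eq_bigr => s _; rewrite big_map; apply: eq_bigr => y _.
  by congr v; apply/rowP => l; rewrite !mxE; ring.
have XE j : ip (ops (digit_seq sigma i j) (ops (X j) v)) (ops (digit_seq sigma i j) (ops (X j) v)) <=
    M / (m.*2.+1)%:R * ((size (Y j))%:R * ip f f).
  (* The filter is moved past [ops (X j)], so that [ip_ops_contr] applies to the sum of bumps
     [ops (X j) f], whose norm orthogonality computes. *)
  rewrite /v ops_contr mulrAC ler_pdivlMr// mulrC.
  have <- : ip (ops (X j) f) (ops (X j) f) = (size (Y j))%:R * ip f f.
    rewrite sep ?size_map//.
      by rewrite map_inj_uniq ?uY// => y y' /addIr; exact: expanding_inj.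
    move=> _ _ /mapP[y yY ->] /mapP[y' yY' ->] yy.
    have {}yy : y != y' by apply: contraNneq yy => ->.
    (* Expansion does not decrease [enorm], so the expanded positions remain [q]-separated. *)
    rewrite opprB addrA subrK -linearB.
    apply: le_trans (expanding_le _ fe); apply: le_trans (norm_le_enorm _).
    exact: (positions_separated hA q0 hq pP (hY j y yY).1 (hY j y' yY').1 yy).
  by apply: ip_ops_contr => //; [exact: Ccr_ops|exact: mem_digit_lists].
have uBd : uniq Bd by exact: filter_uniq.
have [psP _] := subst_Apatch hA sigma PA.
have BdE : ip (ops Bd v) (ops Bd v) <= (size Bd)%:R * ip f f.
  rewrite /v ops_contr; apply: le_trans (ip_contr_le M0 DM m (Ccr_ops Bd Cf)) _.
  rewrite sep// => x y; rewrite !mem_filter => /andP[_ xW] /andP[_ yW] xy.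
  apply: le_trans (norm_le_enorm _).
  rewrite (_ : x - y = (x + z) - (y + z)); last by rewrite opprD addrACA subrr addr0.
  apply: (positions_separated hA q0 hq psP (WP x xW) (WP y yW)).
  by apply: contra xy => /eqP/addIr ->.
have sY j : (size (Y j))%:R <= evol d (r + (c + c1 + d%:R * q)) / (`|ldet (expansion sigma)| * (2 * q) ^+ d).
  rewrite ler_pdivlMr ?mulr_gt0//; apply: le_trans (hc1 P j (Y j) (r + c) pP (uY j) _) _.
    by move=> y; exact: hY.
  by apply: mono; lra.
have sBd : (size Bd)%:R <= (evol d (r + (c + c1 + d%:R * q)) - evol d (r - (c + c1 + d%:R * q))) / (2 * q) ^+ d.
  rewrite ler_pdivlMr//.
  have := @count_annulus _ _ _ _ _ hA q q0 hq (subst sigma P) i (map (fun p => p + z) Bd) z r c psP.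
  rewrite size_map => h; apply: le_trans (h _ _ _ c0) _.
  - by rewrite map_inj_uniq//; exact: addIr.
  - by move=> _ /mapP[p pB ->]; apply: WP; move: pB; rewrite mem_filter => /andP[].
  - move=> _ /mapP[p pB ->]; apply: hBd; move: pB; rewrite mem_filter => /andP[pS /mapP[p' p'Z pE]].
      by rewrite pE subrK.
    by rewrite addrK => /memS; apply/negP.
  apply: lerB; apply: mono; lra.
rewrite opsS; apply: le_trans (ip_sub_le _ _) _; [exact: Ccr_ops|exact: Ccr_ops|].
rewrite mulrDr; apply: lerD; last first.
  rewrite mulrCA ler_wpM2l// mulrC; apply: le_trans BdE _.
  by rewrite ler_wpM2r.
rewrite opsW -[in leRHS]mulrA -[in leRHS]mulrA mulrCA ler_wpM2l//.
apply: le_trans (ip_sum_le _ CF) _.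
rewrite /index_enum -enumT size_enum_ord expr2 -[in leRHS]mulrA mulrCA ler_wpM2l//.
apply: (@le_trans _ _ (\sum_(j < na) ip f f * (M / m.*2.+1%:R * (evol d (r + (c + c1 + d%:R * q)) / (`|ldet (expansion sigma)| * (2 * q) ^+ d))))).
  rewrite enumT; apply: ler_sum => j _; apply: le_trans (XE j) _.
  rewrite [leRHS]mulrCA ler_wpM2l ?divr_ge0 ?(ltW M0)// [leRHS]mulrC.
  by rewrite ler_wpM2r.
rewrite sumr_const card_ord -[leLHS]mulr_natl mulrCA.
by [].
Qed.

End fixed_substitution.
End UpperEstimate.

(** * The mass of the diffraction measure where the Fourier matrix is small *)

Section GhatEstimate.
Variables (R : realType) (d : nat) (L : finType) (na : nat).
Variable A : 'I_na -> tile R d L.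
Hypothesis hA : is_alphabet A.
Variable T : tile_patch R d L.
Hypothesis pT : is_patch T.
Local Notation E := 'rV[R]_d.
Local Notation B := (borelRd R d).
Local Notation leb := (@lebesgue_Rd R d).
Implicit Types (sigma : substitution A) (x y z t p : E).

Definition bump (rad : R) : E -> R := fun x => Num.max 0 (rad - `|x|).

Lemma bump_supp rad x : bump rad x != 0 -> `|x| < rad.
Proof.
rewrite /bump; have [h|h] := leP 0 (rad - `|x|).
  by move=> h2; rewrite -subr_gt0 lt_neqAle eq_sym h2.
by move/eqP.
Qed.

Lemma bump_ge0 rad x : 0 <= bump rad x.
Proof. by rewrite /bump le_max lexx. Qed.

Lemma Lip_bump rad : Lip (bump rad).
Proof.
exists 1 => // x y; rewrite mul1r /bump.
have h : `| `|x| - `|y| | <= `|x - y| by exact: ler_dist_dist.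
apply: le_trans h.
by have [h1|h1] := leP 0 (rad - `|x|); have [h2|h2] := leP 0 (rad - `|y|); rewrite ler_norml ?subr0 ?sub0r ?opprB;
  have := ler_norm (`|x| - `|y|); have := ler_norm (`|y| - `|x|);
  rewrite -(distrC `|x|) => ? ?; apply/andP; split; lra.
Qed.

Lemma Ccr_bump rad : Ccr (bump rad).
Proof.
split; first by apply: Lip_continuous; exact: Lip_bump.
exists rad, `|rad| => x; split.
  rewrite ger0_norm ?bump_ge0// /bump ge_max normr_ge0/=.
  by rewrite lerBlDr (le_trans (ler_norm _))// lerDl.
move=> h; apply/eqP/negPn/negP => /bump_supp; by rewrite ltNge ltW.
Qed.

Lemma rint_bump_gt0 rad : 0 < rad -> 0 < rint (bump rad).
Proof.
move=> r0; have r2 : 0 < rad / 2 by rewrite divr_gt0.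
rewrite -lte_fin -rintE; last exact: Ccr_bump.
apply: (@lt_le_trans _ _ ((rad / 2)%:E * leb (ocube 0 (rad / 2)))%E).
  by rewrite lebesgue_ocube ?(ltW r2)// lte_fin mulr_gt0// exprn_gt0// mulr_gt0.
have mK : measurable (ocube 0 (rad / 2) : set B) by exact: measurable_obox.
rewrite muleC -integral_indic_setZr ?lee_fin ?(ltW r2)//.
apply: ge0_le_integral => //.
- by move=> x _; rewrite -EFinM lee_fin mulr_ge0// ltW.
- apply/measurable_EFinP; apply: measurable_funM => //; exact: measurable_indic.
- by apply/measurable_EFinP; exact: Ccr_measurable (Ccr_bump rad).
move=> x _; rewrite -EFinM lee_fin indicE; have [Kx|Kx] := pselect (ocube 0 (rad / 2) x).
  rewrite mem_set// mul1r /bump le_max; apply/orP; right.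
  by move/ocube0E : Kx => /(_ r2); lra.
by rewrite memNset// mul0r bump_ge0.
Qed.

Lemma cos_near0 : exists2 delta : R, 0 < delta & forall a : R, `|a| < delta -> 1 / 2 <= cos a.
Proof.
have /(@cvgrPdist_lt _ _ _ (nbhs (0 : R)) (nbhs_filter _) (@cos R)) := @continuous_cos R 0.
rewrite cos0 => /(_ (1 / 2)) [|e /= e0 he]; first by rewrite divr_gt0.
exists e => // a ae; have := he a; rewrite /= sub0r normrN => /(_ ae).
by have := ler_norm (1 - cos a); lra.
Qed.

Lemma dotp_norm_le x t : `|dotp x t| <= d%:R * (`|x| * `|t|).
Proof.
rewrite /dotp; apply: le_trans (ler_norm_sum _ _ _) _.
rewrite -[X in X%:R]card_ord mulr_natl -sumr_const; apply: ler_sum => i _.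
by rewrite normrM; apply: ler_pM => //; exact: coord_le_norm.
Qed.

(** On a small enough support all phases stay where the cosine is at least [1 / 2], so the cosine
    transform is at least half the integral. The bound [r0] leaves room for the separation
    requirement. *)
Lemma pow_bump_ge (N : R) : 0 < N -> forall r0 : R, 0 < r0 ->
  exists rad : R, [/\ 0 < rad, rad <= r0 &
    forall t, `|t| <= N -> (rint (bump rad) / 2) ^+ 2 <= fourier_norm2 (bump rad) t].
Proof.
move=> N0 r0 r00; have [delta delta0 hd] := cos_near0.
have p0 : 0 < (pi : R) by exact: pi_gt0.
pose k : R := 2 * pi * (d%:R * N) + 1.
have k0 : 0 < k by rewrite ltr_wpDl//; apply: mulr_ge0; apply: mulr_ge0 => //; exact: ltW.
pose rad := Num.min r0 (delta / k).
have rad0 : 0 < rad by rewrite lt_min r00 divr_gt0.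
exists rad; split => //; first by rewrite ge_min lexx.
move=> t tN.
have hcos x : bump rad x != 0 -> 1 / 2 <= cos (phase x t).
  move=> /bump_supp xr; apply: hd; rewrite /phase normrM ger0_norm ?mulr_ge0 ?(ltW p0)//.
  apply: (@le_lt_trans _ _ (2 * pi * (d%:R * (rad * N)))).
    rewrite ler_wpM2l ?mulr_ge0 ?(ltW p0)//; apply: le_trans (dotp_norm_le _ _) _.
    by rewrite ler_wpM2l// ler_pM// ltW.
  apply: (@lt_le_trans _ _ (k * rad)).
    rewrite (_ : 2 * pi * (d%:R * (rad * N)) = 2 * pi * (d%:R * N) * rad); last by ring.
    by rewrite ltr_pM2r// ltrDl.
  by rewrite mulrC -ler_pdivlMr// /rad ge_min lexx orbT.
have Cb := Ccr_bump rad.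
rewrite /fourier_norm2 -[leLHS]addr0 lerD ?sqr_ge0//.
have h : rint (bump rad) / 2 <= cos_transform (bump rad) t.
  rewrite mulrC -rintZ//; apply: rint_le; [exact: CcrZ|exact: Ccr_cos|] => x.
  have [->|bx] := eqVneq (bump rad x) 0; first by rewrite mulr0 mul0r.
  by rewrite mulrC ler_wpM2l ?bump_ge0//; have := hcos x bx; rewrite div1r.
have r2 : 0 <= rint (bump rad) / 2 by rewrite divr_ge0// ltW// rint_bump_gt0.
by rewrite ler_pXn2r// nnegrE// (le_trans r2).
Qed.

(** The function [b] of the overview: the squared Frobenius norm of the Fourier matrix. *)
Definition fourier_sqr sigma t : R :=
  \sum_(l <- digit_lists sigma) Normc.normc (csum l t) ^+ 2.

Lemma measurable_fourier_sqr sigma :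
  measurable_fun setT (fourier_sqr sigma : B -> measurableTypeR R).
Proof.
have angC (s t : E) : phase s t = phase t s.
  by rewrite /phase; congr (_ * _); apply: eq_bigr => i _; rewrite mulrC.
have Ecs (l : seq E) t : Normc.normc (csum l t) ^+ 2 =
    (\sum_(s <- l) cos (phase t s)) ^+ 2 + (\sum_(s <- l) sin (phase t s)) ^+ 2.
  have -> : csum l t = Complex (\sum_(s <- l) cos (phase t s)) (\sum_(s <- l) sin (phase t s)).
    rewrite /csum; elim: l => [|s l ih]; first by rewrite !big_nil.
    by rewrite !big_cons ih /cis angC; simpc.
  by rewrite /= sqr_sqrtr// addr_ge0// sqr_ge0.
rewrite /fourier_sqr; apply: measurable_sum => l.
rewrite (_ : (fun _ => _) = fun t => (\sum_(s <- l) cos (phase t s)) ^+ 2 + (\sum_(s <- l) sin (phase t s)) ^+ 2); last first.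
  by apply/funext => t; exact: Ecs.
apply: measurable_funD; apply: measurable_funX; apply: measurable_sum => s.
  by apply: borelRd_measurable_continuous; exact: continuous_cos_ang.
by apply: borelRd_measurable_continuous; exact: continuous_sin_ang.
Qed.

Lemma fourier_sqr_ge0 sigma t : 0 <= fourier_sqr sigma t.
Proof. by apply: sumr_ge0 => l _; rewrite sqr_ge0. Qed.

Lemma measurable_norm_le (N : R) : measurable ([set t : E | `|t| <= N] : set B).
Proof.
apply: borelRd_measurable_closed.
apply: (@closed_comp _ _ (fun x : E => `|x|) [set r | r <= N]); last exact: closed_le.
by move=> x _; exact: norm_continuous.
Qed.

Variables (w : 'I_na -> R[i]) (ghat : {measure set B -> \bar R}).
Hypothesis hghat : is_diffraction_measure A w T ghat.

(** The order of the quantifiers matters: [C] is chosen before [sigma] and [theta], so one constant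
    serves every level of the S-adic hierarchy. *)
Lemma ghat_fourier_small (N : R) : 0 < N -> exists C : R,
  forall sigma (theta : R), approximable T sigma -> 0 < theta ->
  (ghat [set t : E | (fourier_sqr sigma t <= theta /\ `|t| <= N)%R] <=
   (C * (theta / `|ldet (expansion sigma)|))%:E)%E.
Proof.
move=> N0; have [q q0 hq] := alphabet_cube hA.
have d1 : 0 < d%:R + 1 :> R by rewrite ltr_wpDl.
have [|rad [rad0 rad_le hrad]] := @pow_bump_ge N N0 (q / (2 * (d%:R + 1))).
  by rewrite divr_gt0// mulr_gt0.
set f := bump rad in hrad.
have Cf : Ccr f by exact: Ccr_bump.
pose cf := (rint f / 2) ^+ 2 / 2.
have cf0 : 0 < cf by rewrite !(divr_gt0, exprn_gt0)// rint_bump_gt0.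
pose Q : R := (2 * q) ^+ d.
have Q0 : 0 < Q by rewrite exprn_gt0// mulr_gt0.
(* The limit of the bound of [tile_sum_bound], with [4] standing for the ratio of [M / (2 m + 1)] to
   [theta]. *)
pose C0 := na%:R * weight_sqr w * (ip f f * (2 * na%:R ^+ 2 * (4 / Q))).
exists (C0 / cf) => sigma theta app theta0.
pose D := `|ldet (expansion sigma)|.
have D0 : 0 < D by rewrite normr_gt0 ldet_neq0//; exact: expansionP.
pose S0 : R := \sum_(l <- digit_lists sigma) (size l)%:R ^+ 2.
have S00 : 0 <= S0 by apply: sumr_ge0 => l _; rewrite sqr_ge0.
(* [m] is chosen so that [(1 - b / M) ^ (2 m) >= 1 / 2] wherever [b <= theta],
   while the operator bound [M / (2 m + 1)] is at most [4 theta]. *)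
pose M := S0 + 4 * theta.
have M0 : 0 < M by rewrite ltr_wpDl// mulr_gt0.
have SM : S0 <= M by rewrite lerDl mulr_ge0// ltW.
pose m := Num.trunc (M / (4 * theta)).
have t4 : 0 < 4 * theta by rewrite mulr_gt0.
have m1 : m%:R * (4 * theta) <= M.
  by rewrite -ler_pdivlMr// truncn_le// divr_ge0 ?ltW.
have m2 : M <= (m.*2.+1)%:R * (4 * theta).
  rewrite -ler_pdivrMr//; apply: (@le_trans _ _ m.+1%:R); first by rewrite ltW// truncnS_gt.
  by rewrite ler_nat ltnS -addnn leq_addr.
have md0 : 0 < (m.*2.+1)%:R :> R by rewrite ltr0n.
pose v := iter m (contr (gram M^-1 (digit_lists sigma))) f.
have Cv : Ccr v by exact: Ccr_contr.
have Lv : Lip v by apply: Lip_contr; exact: Lip_bump.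
have rs : 2 * rad * (d%:R + 1) <= q.
  by move: rad_le; rewrite ler_pdivlMr ?mulr_gt0//; apply: le_trans; rewrite mulrCA mulrA.
have [c [c0 hc]] := tile_sum_bound hA pT q0 hq app Cf (@bump_supp rad) rs M0 SM m.
pose K0 := M / (m.*2.+1)%:R.
have K0le : K0 <= 4 * theta by rewrite ler_pdivrMr// mulrC.
pose h r := ip f f * (2 * na%:R ^+ 2 * K0 / (D * Q) * (evol d (r + c) / evol d r) +
     2 / Q * (evol d (r + c) / evol d r - evol d (r + - c) / evol d r)).
(* All volume ratios tend to [1]: the shell term tends to [0], and with it goes the dependence on
   [c]. *)
have hlim : h r @[r --> +oo] -->
    ip f f * (2 * na%:R ^+ 2 * K0 / (D * Q) * 1 + 2 / Q * (1 - 1)).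
  apply: cvgM; first exact: cvg_cst.
  apply: cvgD; apply: cvgM; try exact: cvg_cst; first exact: cvg_evol_ratio.
  by apply: cvgB; exact: cvg_evol_ratio.
have [mpow ipow] : measurable_fun setT (fourier_norm2 v : B -> measurableTypeR R) /\
  (\int[ghat]_x (fourier_norm2 v x)%:E <= (na%:R * weight_sqr w *
     (ip f f * (2 * na%:R ^+ 2 * K0 / (D * Q) * 1 + 2 / Q * (1 - 1))))%:E)%E.
  apply: (diffraction_pow_le _ Cv Lv hghat _ _ hlim).
  - by move=> i r; exact: (tile_points_finite hA).
  - near=> r; have r0 : 0 < r by near: r; exact: nbhs_pinfty_gt.
    move=> i; apply: le_trans (hc r r0 i) _.
    have ev0 := evol_gt0 d r0; rewrite -/(evol d r) /h -/D -/Q -/K0.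
    rewrite le_eqVlt; apply/orP; left; apply/eqP; move: (evol d r) (evol d (r + c)) (evol d (r - c)) ev0 => a b b' a0.
    by field; rewrite !gt_eqF.
  - near=> r; rewrite -/(evol d r); apply: evol_gt0; near: r; exact: nbhs_pinfty_gt.
set G := [set t : E | _ /\ _].
have mG : measurable (G : set B).
  rewrite (_ : G = [set t : E | fourier_sqr sigma t <= theta] `&` [set t : E | `|t| <= N])//.
  apply: measurableI; last exact: measurable_norm_le.
  have := measurable_fourier_sqr sigma measurableT (measurable_itv `]-oo, theta]).
  by rewrite setTI; congr measurable; apply/seteqP; split=> t /=; rewrite in_itv.
have GE : (cf%:E * ghat G <= \int[ghat]_x (fourier_norm2 v x)%:E)%E.
  rewrite muleC -integral_indic_setZr ?lee_fin ?(ltW cf0)//.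
  apply: ge0_le_integral => //.
  - by move=> x _; rewrite -EFinM lee_fin mulr_ge0// ltW.
  - apply/measurable_EFinP; apply: measurable_funM => //; exact: measurable_indic.
  - by apply/measurable_EFinP.
  move=> t _; rewrite -EFinM lee_fin indicE; have [Gt|Gt] := pselect (G t); last first.
    by rewrite memNset// mul0r pow_ge0.
  rewrite mem_set// mul1r /v pow_contr//.
  have [bt tN] := Gt; have b0 := fourier_sqr_ge0 sigma t.
  rewrite -/(fourier_sqr sigma t).
  have xle : M^-1 * fourier_sqr sigma t <= M^-1 * theta by rewrite ler_pM2l ?invr_gt0.
  have Mt : M^-1 * theta * 4 <= 1.
    by rewrite -mulrA mulrC (mulrC theta) ler_pdivrMr// mul1r lerDr.
  (* Bernoulli's inequality bounds the power below by [1 - 2 m theta / M], and [m1] gives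
     [2 m theta / M <= 1 / 2]. *)
  have hb : 1 / 2 <= (1 - M^-1 * fourier_sqr sigma t) ^+ m.*2.
    apply: le_trans (bernoulli_sub _ _); last first.
      apply/andP; split; first by rewrite mulr_ge0// invr_ge0 ltW.
      apply: le_trans xle _; have : 0 <= M^-1 * theta.
        by apply: mulr_ge0; rewrite ?invr_ge0 ltW.
      lra.
    have : m.*2%:R * (M^-1 * fourier_sqr sigma t) <= m.*2%:R * (M^-1 * theta) by rewrite ler_wpM2l.
    have : m.*2%:R * (M^-1 * theta) <= 1 / 2.
      rewrite mulrCA mulrC ler_pdivrMr//.
      have -> : m.*2%:R = m%:R * 2 :> R by rewrite -mul2n natrM mulrC.
      by move: m1; lra.
    lra.
  rewrite /cf -[(_ ^+ 2) / 2]mulr1 mulrAC -mulrA mulrC.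
  apply: ler_pM => //; [exact: sqr_ge0|exact: hrad].
rewrite -(@lee_pmul2l _ cf%:E) ?lte_fin//; apply: le_trans GE _; apply: le_trans ipow _.
rewrite -EFinM lee_fin subrr mulr0 addr0 mulr1 -/D.
have -> : cf * (C0 / cf * (theta / D)) =
    na%:R * weight_sqr w * (ip f f * (2 * na%:R ^+ 2 * (4 * theta) / (D * Q))).
  by rewrite /C0; field; rewrite !gt_eqF.
have w0 : 0 <= weight_sqr w by apply: sumr_ge0 => j _; rewrite addr_ge0// sqr_ge0.
apply: ler_wpM2l; first exact: mulr_ge0.
apply: ler_wpM2l; first exact: ip_ge0.
rewrite ler_pM2r ?invr_gt0 ?mulr_gt0//; exact: ler_wpM2l.
Unshelve. all: end_near.
Qed.

End GhatEstimate.

(** * The S-adic limit *)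

Section OperatorNorm.
Variables (R : realType) (n : nat).
Local Notation C := R[i].
Implicit Types (B : 'M[C]_n).

Lemma normc_ge0 (z : C) : 0 <= Normc.normc z.
Proof. by case: z => a b; exact: sqrtr_ge0. Qed.

Lemma normc_sum_le (J : Type) (r : seq J) (F : J -> C) :
  Normc.normc (\sum_(j <- r) F j) <= \sum_(j <- r) Normc.normc (F j).
Proof.
elim/big_rec2 : _ => [|j a b _ h]; first by rewrite Normc.normc0.
by apply: le_trans (le_normcD _ _) _; rewrite lerD2l.
Qed.

Lemma sqr_cvnorm (v : 'cV[C]_n) : cvnorm v ^+ 2 = \sum_(i < n) Normc.normc (v i ord0) ^+ 2.
Proof. by rewrite sqr_sqrtr// sumr_ge0// => i _; rewrite sqr_ge0. Qed.

Lemma cvnorm_ge0 (v : 'cV[C]_n) : 0 <= cvnorm v.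
Proof. exact: sqrtr_ge0. Qed.

Lemma normc_le_cvnorm (v : 'cV[C]_n) i : Normc.normc (v i ord0) <= cvnorm v.
Proof.
rewrite -(@ler_pXn2r _ 2)// ?nnegrE ?cvnorm_ge0 ?normc_ge0// sqr_cvnorm.
by rewrite (bigD1 i)//= lerDl sumr_ge0// => j _; rewrite sqr_ge0.
Qed.

Lemma cvnorm_le_opnorm B (v : 'cV[C]_n) : cvnorm v <= 1 -> cvnorm (B *m v) <= opnorm B.
Proof.
move=> v1; apply: ub_le_sup; last by exists v.
(* The supremum dominates its elements only for sets bounded above; sums of moduli along rows
   provide a bound. *)
exists (Num.sqrt (\sum_(i < n) (\sum_(j < n) Normc.normc (B i j)) ^+ 2)).
move=> _ [u /= u1 <-]; rewrite ler_sqrt; last by rewrite sumr_ge0// => i _; rewrite sqr_ge0.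
apply: ler_sum => i _.
rewrite ler_pXn2r ?nnegrE ?normc_ge0//; last by rewrite sumr_ge0// => j _; exact: normc_ge0.
rewrite mxE; apply: le_trans (normc_sum_le _ _) _; apply: ler_sum => j _.
rewrite Normc.normcM ler_piMr ?normc_ge0//.
by apply: le_trans u1; exact: normc_le_cvnorm.
Qed.

(** The column is the image of the unit vector [delta_mx j ord0], and [s] is its norm. *)
Lemma column_le_opnorm B j :
  exists2 s : R, 0 <= s <= opnorm B & s ^+ 2 = \sum_(i < n) Normc.normc (B i j) ^+ 2.
Proof.
exists (cvnorm (B *m delta_mx j ord0)).
  rewrite cvnorm_ge0/=; apply: cvnorm_le_opnorm.
  rewrite -(@ler_pXn2r _ 2)// ?nnegrE ?cvnorm_ge0// expr1n sqr_cvnorm (bigD1 j)//= big1.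
    by rewrite mxE !eqxx Normc.normc1 expr1n addr0.
  by move=> i /negbTE ij; rewrite mxE ij Normc.normc0 expr0n.
rewrite sqr_cvnorm; apply: eq_bigr => i _; congr (Normc.normc _ ^+ 2).
rewrite mxE (bigD1 j)//= big1 => [|k /negbTE kj]; rewrite mxE ?kj ?mulr0//.
by rewrite !eqxx mulr1 addr0.
Qed.

End OperatorNorm.

(** The lower limit is the supremum of the tail infima, so some tail infimum already exceeds [a]. *)
Lemma limn_einf_gt (R : realType) (u : (\bar R)^nat) (a : \bar R) :
  (a < limn_einf u)%E -> exists N, forall k, (N <= k)%N -> (a < u k)%E.
Proof.
have -> : limn_einf u = ereal_sup (range (einfs u)).
  by rewrite limn_einf_lim; apply/cvg_lim => //; exact: cvg_einfs_sup.
move=> /ereal_sup_gt[_ [N _ <-] aN]; exists N => k Nk; apply: lt_le_trans aN _.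
by apply: ereal_inf_lbound; exists k.
Qed.

Section Conclusion.
Variables (R : realType) (d na ma : nat) (L : finType).
Variables (A : 'I_na -> tile R d L) (hA : is_alphabet A).
Variables (rho : 'I_ma -> substitution A) (i : nat -> 'I_ma).
Local Notation E := 'rV[R]_d.
Local Notation B := (borelRd R d).

(** For [l] large, [nl l] exceeds [n], so the first [n + 1] substitutions factor out of the
    approximant. Convergence is used with tolerance [1]. *)
Lemma Sadic_approximable (T : tile_patch R d L) n :
  Sadic_tiling rho i T -> approximable T (comp_upto hA rho i n).
Proof.
move=> [nl [P [nlP Pleg _ Tcvg]]] r r0.
have [N _ hN] := Tcvg 1 r ltr01 r0.
pose l := maxn N n.+1.
have [x [y [x1 y1 e]]] := hN l (leq_maxl N n.+1).
have lnl k : (k <= nl k)%N.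
  by elim: k => // k ih; apply: leq_ltn_trans ih _; exact: nlP.
have nnl : (n < nl l)%N by apply: leq_trans (lnl l); exact: leq_maxr.
exists (subst_from rho i n.+1 (nl l) (P l)), x, y; split => //.
  by apply: subst_word_Apatch => //; exact: legal_Apatch (Pleg l).
by rewrite -subst_from_comp.
Qed.

Lemma fourier_sqr_mx (sigma : substitution A) (t : E) :
  fourier_sqr sigma t = \sum_j \sum_k Normc.normc (fourier_mx sigma t k j) ^+ 2.
Proof.
rewrite /fourier_sqr /digit_lists big_allpairs_dep exchange_big/= big_enum/=.
apply: eq_bigr => j _; rewrite big_enum/=; apply: eq_bigr => k _.
by rewrite fourier_mxE.
Qed.

(** Multiplying the gap by [2 (n + 1)] and exponentiating bounds the squared operator norm by
    [e^(-2 eps (n + 1)) |det|]. Each of the [na] columns has squared length at most that norm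
    squared. *)
Lemma exponent_gap_fourier (eps : R) (t : E) n :
  (eps%:E < exponent_gap rho i t n.+1)%E ->
  fourier_sqr (comp_upto hA rho i n) t <=
  na%:R * (expR (- (2 * eps)) ^+ n.+1 * `|ldet (expansion (comp_upto hA rho i n))|).
Proof.
rewrite /exponent_gap (ldet_comp_upto hA rho i n) (fourier_prod_comp hA) fourier_sqr_mx.
set M := fourier_mx _ t; set D := `|_| => gap.
have D0 : 0 < D by rewrite normr_gt0 ldet_neq0//; exact: expansionP.
rewrite -[X in X%:R]card_ord mulr_natl -sumr_const; apply: ler_sum => j _.
have [s /andP[s0 so] <-] := column_le_opnorm M j.
have e0 : 0 < expR (- (2 * eps)) ^+ n.+1 by rewrite exprn_gt0// expR_gt0.
(* A zero column is bounded trivially; otherwise the operator norm is positive and [lne] is an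
   ordinary logarithm. *)
move: s0; rewrite le_eqVlt => /predU1P[<-|s0].
  by rewrite expr0n/= mulr_ge0// ltW.
have o0 : 0 < opnorm M by exact: lt_le_trans so.
have n0 : 0 < (n.+1)%:R :> R by rewrite ltr0n.
move: gap; rewrite lne_EFin// -EFinM -EFinB lte_fin => gap.
apply: (@le_trans _ _ (opnorm M ^+ 2)); first by rewrite ler_pXn2r ?nnegrE// ltW.
apply: ltW; rewrite -ltr_ln ?posrE ?exprn_gt0 ?mulr_gt0//.
rewrite lnM ?posrE// !lnXn ?expR_gt0// expRK.
have : eps * (2 * n.+1%:R) < (ln D / (2 * n.+1%:R) - n.+1%:R^-1 * ln (opnorm M)) * (2 * n.+1%:R).
  by rewrite ltr_pM2r// mulr_gt0.
have -> : (ln D / (2 * n.+1%:R) - n.+1%:R^-1 * ln (opnorm M)) * (2 * n.+1%:R) = ln D - 2 * ln (opnorm M).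
  by field; rewrite gt_eqF.
by rewrite -mulr_natl -[X in _ -> _ < X + _]mulr_natl; lra.
Qed.

End Conclusion.

Lemma le_geometric_eq0 (R : realType) (a x c : R) n0 : 0 <= a < 1 -> 0 <= x ->
  (forall n, (n0 <= n)%N -> x <= c * a ^+ n.+1) -> x = 0.
Proof.
move=> /andP[a0 a1] x0 h; apply/eqP; rewrite eq_le x0 andbT.
have ca : c * a * a ^+ n @[n --> \oo] --> (c * a * 0 : R).
  by apply: cvgM; [exact: cvg_cst|apply: cvg_expr; rewrite ger0_norm].
rewrite mulr0 in ca; apply: (ler_cvg_to (cvg_cst x) ca).
by exists n0 => // n /= n0n; rewrite -mulrA -exprS; exact: h.
Qed.

Theorem theorem3p2 (R : realType) (d na ma : nat) (L : finType)
    (A : 'I_na -> tile R d L) (hA : is_alphabet A)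
    (rho : 'I_ma -> substitution A) (hFLC : FLC rho)
    (i : nat -> 'I_ma) (T : nat -> tile_patch R d L)
    (hT : desubstituted_tilings rho i T)
    (hfreq : forall k, patch_frequencies_converge (T k))
    (eps : R) (heps : 0 < eps)
    (hgap : {ae lebesgue_Rd, forall t : borelRd R d,
      (eps%:E < limn_einf (fun k => exponent_gap rho i t k.+1))%E})
    (w : 'I_na -> R[i]) (ghat : {measure set (borelRd R d) -> \bar R})
    (hghat : is_diffraction_measure A w (T 0%N) ghat)
    (ac : {measure set (borelRd R d) -> \bar R}) (hac : is_ac_part ghat ac) :
  forall X, measurable X -> ac X = 0%E.
Proof.
move=> X mX; have [s [ghatE acleb _]] := hac.
have T0 := desubstituted_tilings_Sadic hT.
have pT : is_patch (T 0%N) by have [? [? [_ _ [? _] _]]] := T0.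
pose sig n := comp_upto hA rho i n.
pose D n := `|ldet (expansion (sig n))|.
have D0 n : 0 < D n by rewrite normr_gt0 ldet_neq0//; exact: expansionP.
pose a := expR (- (2 * eps)).
have a0 : 0 < a by exact: expR_gt0.
have a1 : a < 1 by rewrite expR_lt1 oppr_lt0 mulr_gt0.
(* Taking [na + 1] rather than [na] keeps the threshold positive for every [na]. *)
pose theta n := (na%:R + 1) * (a ^+ n.+1 * D n).
have theta0 n : 0 < theta n by rewrite !mulr_gt0 ?exprn_gt0// ltr_wpDl.
pose G n N : set (borelRd R d) :=
  [set t : 'rV[R]_d | fourier_sqr (sig n) t <= theta n /\ `|t| <= N.+1%:R].
have mG n N : measurable (G n N).
  rewrite (_ : G n N = [set t : 'rV[R]_d | fourier_sqr (sig n) t <= theta n] `&` [set t : 'rV[R]_d | `|t| <= N.+1%:R])//.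
  apply: measurableI; last exact: measurable_norm_le.
  have := measurable_fourier_sqr (sig n) measurableT (measurable_itv `]-oo, (theta n)]).
  by rewrite setTI; congr measurable; apply/seteqP; split=> t /=; rewrite in_itv.
pose H n0 N : set (borelRd R d) := \bigcap_(n in [set n | (n0 <= n)%N]) G n N.
have mH n0 N : measurable (H n0 N).
  by apply: bigcap_measurable => [|n _]; [exists n0; exact: leqnn|exact: mG].
have ghatH n0 N : ghat (H n0 N) = 0%E.
  have [C hC] := ghat_fourier_small hA pT hghat (ltr0Sn R N).
  (* The determinant in [theta n] cancels the one in [ghat_fourier_small], so a geometric bound
     remains. *)
  have le n : (n0 <= n)%N -> (ghat (H n0 N) <= (C * (na%:R + 1) * a ^+ n.+1)%:E)%E.
    move=> n0n; apply: (@le_trans _ _ (ghat (G n N))).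
      by apply: le_measure; [exact/mem_set|exact/mem_set|move=> t; exact].
    have := hC (sig n) (theta n) (Sadic_approximable hA n T0) (theta0 n).
    move=> /le_trans; apply; rewrite lee_fin -/(D n) /theta.
    by rewrite le_eqVlt; apply/orP; left; apply/eqP; field; rewrite gt_eqF.
  have fH : ghat (H n0 N) \is a fin_num.
    by rewrite ge0_fin_numE//; apply: le_lt_trans (le n0 (leqnn n0)) _; exact: ltry.
  rewrite -(fineK fH); congr (_%:E).
  apply: (@le_geometric_eq0 _ a _ (C * (na%:R + 1)) n0); rewrite ?fine_ge0 ?(ltW a0)//.
  by move=> n /le; rewrite -{1}(fineK fH) lee_fin.
(* By the Lebesgue decomposition, [ac] is dominated by [ghat] on measurable sets. *)
have acH n0 N : ac.-negligible (H n0 N).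
  apply/negligibleP => //; apply/eqP; rewrite eq_le measure_ge0 andbT.
  by have <- := ghatH n0 N; rewrite ghatE// leeDl.
have [N0 [mN0 N00 hN0]] : (@lebesgue_Rd R d).-negligible
  (~` [set t : borelRd R d | (eps%:E < limn_einf (fun k => exponent_gap rho i t k.+1))%E]) := hgap.
(* Absolute continuity disposes of the exceptional set of the hypothesis; the sets [H n0 N] cover
   the rest of the space. *)
have acN0 : ac.-negligible N0.
  apply/negligibleP => //.
  have : (@lebesgue_Rd R d).-null_set N0 by apply: negligible_null_set; apply/negligibleP.
  by move=> /acleb; apply.
apply: measure_negligible => //.
apply: (@negligibleS _ _ _ ac (N0 `|` \bigcup_n0 \bigcup_N H n0 N)); last first.
  apply: negligibleU => //; apply: negligible_bigcup => n0.
  by apply: negligible_bigcup => N; exact: acH.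
move=> t _; have [|gap] := pselect (N0 t); first by left.
right; have {}gap : (eps%:E < limn_einf (fun k => exponent_gap rho i t k.+1))%E.
  by apply: contrapT => h; apply: gap; exact: hN0.
(* The index shift in [hgap] matches [comp_upto n], which composes [n + 1] substitutions. *)
have [n0 hn0] := limn_einf_gt gap.
exists n0 => //; exists (Num.trunc `|t : 'rV[R]_d|) => // n /= n0n; split; last first.
  by apply: ltW; exact: truncnS_gt.
apply: le_trans (exponent_gap_fourier hA (hn0 n n0n)) _.
by rewrite ler_wpM2r ?lerDl// mulr_ge0 ?exprn_ge0 ?ltW.
Qed.
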